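(* Let $\alpha\in\pi\mathbb Q$, $\alpha\ge 0$, and let $S\subset[0,\pi)$ be the finite set of values taken by the sequence $(n\alpha\ \mathrm{mod}\ \pi)_{n\ge1}$. Then for all $x\in S\setminus\{0\}$, $$\lim_{n\to+\infty}\left|\frac{\mathbb E\left[\mathcal N(f_n,[0,2\pi])\right]}{n}-\ell^\alpha(x)\right|\mathbf 1_{n\alpha= x\ \mathrm{mod}\ \pi}=0.$$ In particular, if $S\setminus\{0\}\neq\emptyset$ (i.e. $\alpha\notin\pi\mathbb Z$), the sequence $n^{-1}\mathbb E\left[\mathcal N(f_n,[0,2\pi])\right]$ does not converge as $n$ goes to infinity.
   Context: Let $(a_k)_{k\ge1}$ and $(b_k)_{k\ge1}$ be two independent (centered) stationary Gaussian processes with $\mathbb E[a_ka_l]=\mathbb E[b_kb_l]=\cos((k-l)\alpha)$ and $\mathbb E[a_kb_l]=0$ for all $k,l\ge1$. For $n\ge 1$ and $t\in\mathbb R$ set $f_n(t)=\frac{1}{\sqrt n}\sum_{k=1}^n\big(a_k\cos(kt)+b_k\sin(kt)\big)$. $\mathcal N(f_n,[0,2\pi])$ denotes the number of real zeros of $f_n$ in $[0,2\pi]$. For $x\in(0,\pi)$ define $$g_x^\alpha(s,u)=\frac{\sin(x)\sin\left(\frac{s-\alpha}{2}\right)\sin\left(\frac{s+\alpha}{2}\right)}{\sin^2\left(\frac{u-x}{2}\right)\sin^2\left(\frac{s+\alpha}{2}\right)+\sin^2\left(\frac{u+x}{2}\right)\sin^2\left(\frac{s-\alpha}{2}\right)},$$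 $$\ell^\alpha(x)=\frac{1}{4\pi^2}\int_{[0,2\pi]^2}\sqrt{1+|g_x^\alpha(s,u)|^2}\,ds\,du$$ (the integrand is defined almost everywhere). The indicator $\mathbf 1_{n\alpha=x\ \mathrm{mod}\ \pi}$ equals $1$ if $n\alpha-x\in\pi\mathbb Z$ and $0$ otherwise. *)

(* Defs.v *)
From HB Require Import structures.
From mathcomp Require Import all_boot all_order all_algebra.
From mathcomp Require Import all_classical all_reals all_analysis.
Set Implicit Arguments.
Unset Strict Implicit.
Unset Printing Implicit Defensive.
Import Order.TTheory GRing.Theory Num.Theory.
Import numFieldNormedType.Exports.
Local Open Scope classical_set_scope.
Local Open Scope ring_scope.

(* Processes indexed by k >= 1 are sequences over nat; the entry of index 0 is
   never constrained nor used. *)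

Section Processes.
Context {R : realType} {d : measure_display} {T : measurableType d}.
Variable P : probability T R.

(* [normal_prob m 0] is the uniform law on [0, 1] in the library, so the
   degenerate normal law N(m, 0) has to be given separately, as a Dirac mass. *)
Definition gaussian_rv (X : T -> R) : Prop :=
  exists m s : R, forall A : set R, measurable A ->
    P (X @^-1` A) = if s == 0 then \d_m A else normal_prob m s A.

(* Some c k may vanish, so all finite linear combinations are covered. *)
Definition gaussian_process (a : nat -> T -> R) : Prop :=
  forall (n : nat) (c : nat -> R),
    gaussian_rv (fun w => \sum_(1 <= k < n.+1) c k * a k w).

Definition centered_process (a : nat -> T -> R) : Prop :=
  forall k : nat, (0 < k)%N -> ('E_P[a k] = 0)%E.

Definition stationary_process (a : nat -> T -> R) : Prop :=
  forall (h n : nat) (A : nat -> set R), (forall k, measurable (A k)) ->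
    P (\bigcap_(k in [set k | (0 < k <= n)%N]) (a (k + h)%N @^-1` A k)) =
    P (\bigcap_(k in [set k | (0 < k <= n)%N]) (a k @^-1` A k)).

Definition sigma_process (a : nat -> T -> R) : set (set T) :=
  <<s \bigcup_(k in [set k | (0 < k)%N])
        preimage_set_system setT (a k) (@measurable _ R) >>.

Definition independent_processes (a b : nat -> T -> R) : Prop :=
  forall A B : set T, sigma_process a A -> sigma_process b B ->
    P (A `&` B) = (P A * P B)%E.

End Processes.

Section Zeros.
Context {R : realType}.

Definition trig_poly (T : Type) (a b : nat -> T -> R) (n : nat) (w : T)
    (t : R) : R :=
  (Num.sqrt n%:R)^-1 *
  \sum_(1 <= k < n.+1) (a k w * cos (k%:R * t) + b k w * sin (k%:R * t)).

(* [+oo] when there are infinitely many zeros *)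
Definition num_zeros (f : R -> R) (u v : R) : \bar R :=
  counting [set t | u <= t <= v /\ f t = 0].

Definition expected_zeros d (T : measurableType d) (P : probability T R)
    (a b : nat -> T -> R) (n : nat) : \bar R :=
  (\int[P]_w num_zeros (trig_poly a b n w) 0%R (2 * pi)%R)%E.

(* By the convention [y / 0 = 0], [gfun] is total; its denominator vanishes
   only on a Lebesgue-null set of [(s, u)] when [x] is in [(0, pi)]. *)
Definition gfun (alpha x s u : R) : R :=
  sin x * sin ((s - alpha) / 2) * sin ((s + alpha) / 2) /
  (sin ((u - x) / 2) ^+ 2 * sin ((s + alpha) / 2) ^+ 2 +
   sin ((u + x) / 2) ^+ 2 * sin ((s - alpha) / 2) ^+ 2).

Definition ell (alpha x : R) : \bar R :=
  let I : set R := `[0, 2 * pi]%classic in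
  ((4 * pi ^+ 2)^-1%:E *
   \int[(@lebesgue_measure R) \x (@lebesgue_measure R)]_(z in I `*` I)
      (Num.sqrt (1 + `|gfun alpha x z.1 z.2| ^+ 2))%:E)%E.

Definition in_piZ (y : R) : Prop := exists m : int, y = pi * m%:~R.

(* the representative of y modulo pi in [0, pi) *)
Definition modpi (y : R) : R := y - pi * (Num.floor (y / pi))%:~R.

Definition values_modpi (alpha : R) : set R :=
  [set modpi (n%:R * alpha) | n in [set n : nat | (0 < n)%N]].

End Zeros.

(* Main.v *)
(* Assume sin alpha <> 0. The covariance cos((k - l) alpha) has rank two, so almost surely
   a_k = A cos(k alpha) + A' sin(k alpha) and b_k = B cos(k alpha) + B' sin(k alpha) with
   A, A', B, B' independent standard normal. Summing Dirichlet kernels,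
   (cos alpha - cos t) f_n(t) is, up to a constant factor, p(t) cos nt + q(t) sin nt +- w(t)
   with trigonometric polynomials p, q, w of degree one that depend on n only through the
   class x of n alpha modulo pi. Such a function has about n / pi zeros per unit length where
   |w| < sqrt(p^2 + q^2) and none where |w| > sqrt(p^2 + q^2); hence, along the class of x,
   N(f_n) / n converges almost surely to |{t : |w(t)| < sqrt(p(t)^2 + q(t)^2)}| / pi. As f_n
   has at most 2n + 1 zeros, expectations converge too, and by Fubini the limit is
   1 / pi times the integral over t of the probability that |w(t)| < sqrt(p(t)^2 + q(t)^2).
   At a fixed t this is the probability that a standard normal vector lies in a quadratic
   cone; parametrizing the sections of the cone by a phase u, the Gaussian integral becomes
   1 / (4 pi) times the integral over u of sqrt(1 + g(t, u)^2), whence ell(x).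
   If sin x = 0 the cone is almost everything and the limit is 2, whereas it is < 2
   otherwise: the classes of alpha and of 0 modulo pi give different limits. *)

Require Import Defs.
From HB Require Import structures.
From mathcomp Require Import all_boot all_order all_algebra.
From mathcomp Require Import all_classical all_reals all_analysis.
From mathcomp Require Import measurable_realfun.
From mathcomp Require complex.
From mathcomp Require Import ring lra zify.
Set Implicit Arguments.
Unset Strict Implicit.
Unset Printing Implicit Defensive.
Import Order.TTheory GRing.Theory Num.Theory.
Import numFieldNormedType.Exports.
Local Open Scope classical_set_scope.
Local Open Scope ring_scope.

(** * Zeros of a modulated oscillation *)

Section Trig.
Context {R : realType}.
Implicit Types (t b x y : R) (k : int).

(** The analytic half is deterministic. It asks of a path only that [p] and [q] have no common zero
    and that the level set [gap = 0] be null; both are shown almost sure later. On a short window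
    the slow coefficients are frozen, so that the oscillation and its first two derivatives are
    close to those of a cosine. Each window costs a bounded number of miscounted zeros, which is
    harmless because the number of windows is fixed before [n] grows. The probabilistic half rests
    on the invariance of the standard normal law of dimension four under orthogonal maps: new
    coordinates are chosen at each time [t], and again at each phase [u], so that few of them
    matter. To make such changes cheap, normality and independence are carried by one joint
    characteristic function. It is kept real: [cos (r X - c)] for all [c] records both its real and
    imaginary parts, and [1 + cos] supplies the nonnegative functions that Tonelli and image
    measures call for. *)

Lemma continuous_derivable (f df : R -> R) :
  (forall t, is_derive t 1 f (df t)) -> continuous f.
Proof.
by move=> f' t; apply: differentiable_continuous; apply/derivable1_diffP; apply: ex_derive.
Qed.

Lemma lip_of_derive (f df : R -> R) (L : R) :
  (forall t, is_derive t 1 f (df t)) -> (forall t, `|df t| <= L) ->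
  forall x y, `|f x - f y| <= L * `|x - y|.
Proof.
move=> f' Lf x y.
wlog xy : x y / y <= x.
  move=> H; have [xy|/ltW xy] := leP y x; first exact: H.
  by rewrite distrC (distrC x); exact: H.
have cf := continuous_derivable f'.
have [|z _ ->] := @MVT_segment _ f df y x xy (fun t _ => f' t).
  exact: continuous_subspaceT.
by rewrite normrM ler_wpM2r.
Qed.

Lemma sinDpik x k : `|sin (x + k%:~R * pi)| = `|sin x|.
Proof.
have H y n : `|sin (y + n%:R * pi)| = `|sin y|.
  elim: n => [|n IH]; first by rewrite mul0r addr0.
  by rewrite -natr1 mulrDl mul1r addrA sinDpi normrN.
case: k => n; first exact: H.
by rewrite -(H (x + (Negz n)%:~R * pi) n.+1) NegzE mulrNz mulNr subrK.
Qed.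

Lemma cosDpik x k : `|cos (x + k%:~R * pi)| = `|cos x|.
Proof. by rewrite -!sinDpihalf addrAC sinDpik. Qed.

(** [acos] determines [b] up to sign from the first equation; the sign is then the one that suits
    [y]. *)
Lemma polar x y (r : R) : x ^+ 2 + y ^+ 2 = r ^+ 2 -> 0 < r ->
  exists b, x = r * cos b /\ y = r * sin b.
Proof.
move=> xyr r0.
have r2 : 0 < r ^+ 2 by rewrite exprn_gt0.
have xr : -1 <= x / r <= 1.
  rewrite ler_pdivlMr// ler_pdivrMr// mulN1r mul1r; apply/andP; split; nra.
pose b := acos (x / r).
have cb : cos b = x / r by rewrite acosK// in_itv.
have sb : (r * sin b) ^+ 2 = y ^+ 2.
  have := cos2Dsin2 b; rewrite cb => /(congr1 (fun z => r ^+ 2 * z)).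
  rewrite mulrDr mulr1 -exprMn mulrCA divff ?gt_eqF// mulr1 -exprMn; nra.
have /orP[/eqP e|/eqP e] : (r * sin b == y) || (r * sin b == - y).
- by rewrite -eqf_sqr sb.
- by exists b; rewrite e cb mulrCA divff ?gt_eqF// mulr1.
- exists (- b); rewrite cosN sinN mulrN e opprK cb mulrCA divff ?gt_eqF//.
  by rewrite mulr1.
Qed.

(** [sin] is monotone on the half period centred at [k pi], so a bound on its modulus at two points
    extends to the points between them. *)
Lemma sin_between x y z k : x < y -> y < z ->
  - (pi / 2) <= x - k%:~R * pi -> z - k%:~R * pi <= pi / 2 ->
  `|sin x| <= 2^-1 -> `|sin z| <= 2^-1 -> `|sin y| <= 2^-1.
Proof.
move=> xy yz kx kz.
rewrite -(sinDpik x (-k)) -(sinDpik y (-k)) -(sinDpik z (-k)) mulrNz mulNr.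
set X := x - _ in kx *; set Y := y - _; set Z := z - _ in kz *.
have XY : X <= Y by rewrite lerD2r ltW.
have YZ : Y <= Z by rewrite lerD2r ltW.
rewrite !ler_norml => /andP[hx _] /andP[_ hz].
apply/andP; split.
- apply: (le_trans hx); move: XY; rewrite le_eqVlt => /predU1P[->//|XY].
  by apply/ltW; rewrite ltr_sin// in_itv/=; apply/andP; split; lra.
- apply: le_trans hz; move: YZ; rewrite le_eqVlt => /predU1P[->//|YZ].
  by apply/ltW; rewrite ltr_sin// in_itv/=; apply/andP; split; lra.
Qed.

End Trig.

(** * Zeros of a perturbed cosine on a short interval *)

Section Counting.
Context {R : realType}.
Implicit Types (t b c d n r x y z : R).

Lemma wavenumber_ge0 n c d : 0 < n -> c <= d -> 0 <= n * (d - c) / pi.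
Proof. by move=> n0 cd; rewrite divr_ge0 ?pi_ge0// mulr_ge0 ?subr_ge0// ltW. Qed.

(* By Rolle, between three consecutive zeros of [H] there are two zeros of [H1]
   enclosing a zero of [H2]; as [sin (n t - b)] and [cos (n t - b)] are never small
   together, distinct zeros of [H1] belong to distinct half periods. *)
Lemma zeros_upper (H H1 H2 : R -> R) n r b c d (s : seq R) :
  0 < n -> 0 < r -> c <= d ->
  (forall t, is_derive t 1 H (H1 t)) -> (forall t, is_derive t 1 H1 (H2 t)) ->
  (forall t, c <= t <= d -> `|H1 t / n + r * sin (n * t - b)| <= r / 2) ->
  (forall t, c <= t <= d -> `|H2 t / n ^+ 2 + r * cos (n * t - b)| <= r / 2) ->
  sorted <%R s -> (forall z, z \in s -> c <= z <= d /\ H z = 0) ->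
  (size s)%:R <= n * (d - c) / pi + 3.
Proof.
move=> n0 r0 cd dH dH1 h1 h2.
have pi0 : 0 < pi :> R := pi_gt0 R.
(* [K z] is the index [k] of the half period that contains [z]: [n z - b] lies in [[k pi - pi/2, k
   pi + pi/2[], where [sin_between] applies. *)
pose K z := Num.floor ((n * z - b) / pi + 2^-1).
have K_le z z' : z <= z' -> K z <= K z'.
  by move=> zz'; apply: le_floor; rewrite lerD2r ler_pM2r ?invr_gt0// lerD2r ler_pM2l.
have rolle x y : c <= x -> y <= d -> x < y -> H x = 0 -> H y = 0 ->
    exists2 z, x < z < y & H1 z = 0.
  move=> cx yd xy Hx Hy; have cH := continuous_derivable dH.
  have [||z] := @Rolle _ H x y xy (fun t _ => @ex_derive _ _ _ _ _ _ _ (dH t)).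
  - exact: continuous_subspaceT.
  - by rewrite Hx Hy.
  - rewrite in_itv/= => zi dz; exists z => //.
    by have [_ <-] := dH z; have [_ ->] := dz.
have K_lt z z' : c <= z -> z' <= d -> z < z' -> H1 z = 0 -> H1 z' = 0 -> K z < K z'.
  move=> cz z'd zz' Hz Hz'.
  rewrite lt_neqAle K_le ?andbT ?(ltW zz')//; apply/negP => /eqP Kzz'.
  have cH1 := continuous_derivable dH1.
  have [||y] := @Rolle _ H1 z z' zz' (fun t _ => @ex_derive _ _ _ _ _ _ _ (dH1 t)).
  - exact: continuous_subspaceT.
  - by rewrite Hz Hz'.
  rewrite in_itv/= => /andP[zy yz'] dy.
  have Hy : H2 y = 0 by have [_ <-] := dH1 y; have [_ ->] := dy.
  have small t : `|r * t| <= r / 2 -> `|t| <= 2^-1.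
    by rewrite normrM gtr0_norm// ler_pM2l.
  have sz : `|sin (n * z - b)| <= 2^-1.
    by apply: small; have := h1 z; rewrite Hz mul0r add0r; apply; lra.
  have sz' : `|sin (n * z' - b)| <= 2^-1.
    by apply: small; have := h1 z'; rewrite Hz' mul0r add0r; apply; lra.
  have sy : `|cos (n * y - b)| <= 2^-1.
    by apply: small; have := h2 y; rewrite Hy mul0r add0r; apply; lra.
  have /andP[fz _] := floor_itv ((n * z - b) / pi + 2^-1).
  have /andP[_ fz'] := floor_itv ((n * z' - b) / pi + 2^-1).
  rewrite -/(K z) in fz; rewrite -/(K z') -Kzz' intrD in fz'.
  have e u : (n * u - b) = (n * u - b) / pi * pi by rewrite divfK// gt_eqF.
  have bz : - (pi / 2) <= n * z - b - (K z)%:~R * pi by rewrite (e z); nra.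
  have bz' : n * z' - b - (K z)%:~R * pi <= pi / 2 by rewrite (e z'); nra.
  have /(_ _)/(_ _) := @sin_between R (n * z - b) (n * y - b) (n * z' - b) (K z).
  rewrite !ltrD2r !ltr_pM2l// => /(_ zy yz' bz bz' sz sz') siny.
  (* Sine and cosine both at most [1/2] in modulus contradict [cos^2 + sin^2 = 1]. *)
  have := cos2Dsin2 (n * y - b).
  move: sy siny; rewrite !ler_norml => /andP[? ?] /andP[? ?]; nra.
(* Prepending a zero of [H] yields a zero of [H1] to the left of the previous one, hence with a
   strictly smaller index [K]. *)
have key x y (l : seq R) : sorted <%R [:: x, y & l] ->
   (forall z, z \in [:: x, y & l] -> c <= z <= d /\ H z = 0) ->
   exists2 z, x < z < y & H1 z = 0 /\ (size l)%:Z + K z <= K d.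
  elim: l x y => [|y2 l IH] x y /=.
    move=> /andP[xy _] Hl.
    have [/andP[cx xd] Hx] := Hl x (mem_head _ _).
    have [/andP[cy yd] Hy] : c <= y <= d /\ H y = 0 by apply: Hl; rewrite !inE eqxx orbT.
    have [z zxy Hz] := rolle x y cx yd xy Hx Hy.
    by exists z => //; split=> //; rewrite add0r K_le//; lra.
  move=> /and3P[xy yy2 pl] Hl.
  have [|z0 H0|z2 /andP[yz2 z2y] [Hz2 Kz2]] := IH y y2; first by rewrite /= yy2.
    by apply: Hl; rewrite inE H0 orbT.
  have [/andP[cx xd] Hx] := Hl x (mem_head _ _).
  have [/andP[cy yd] Hy] : c <= y <= d /\ H y = 0 by apply: Hl; rewrite !inE eqxx orbT.
  have [/andP[cy2 y2d] Hy2] : c <= y2 <= d /\ H y2 = 0.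
    by apply: Hl; rewrite !inE eqxx !orbT.
  have [z /andP[xz zy] Hz] := rolle x y cx yd xy Hx Hy.
  exists z; first by rewrite xz.
  split=> //.
  have : K z < K z2 by apply: K_lt => //; lra.
  move: Kz2; rewrite -[(size l).+1]addn1 PoszD; move: (K z) (K z2) (K d) => ? ? ?.
  by clear; lia.
case: s => [|x [|y l]] so Hs.
- by rewrite addr_ge0// wavenumber_ge0.
- by rewrite -[leLHS]add0r lerD ?wavenumber_ge0// ler1n.
have [z /andP[xz zy] [Hz Kz]] := key x y l so Hs.
have [/andP[cx _] _] := Hs x (mem_head _ _).
have Kc : K c <= K z by rewrite K_le//; lra.
(* Origin of the constant 3: two zeros of [H] are not in [l], and [K d - K c] exceeds
   [n (d - c) / pi] by less than one. *)
have : (size l)%:Z + K c <= K d by apply: le_trans Kz; rewrite lerD2l.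
rewrite -(ler_int R) intrD => hl.
have /andP[_ fc] := floor_itv ((n * c - b) / pi + 2^-1).
have /andP[fd _] := floor_itv ((n * d - b) / pi + 2^-1).
rewrite -/(K c) intrD in fc; rewrite -/(K d) in fd.
have -> : n * (d - c) / pi = (n * d - b) / pi - (n * c - b) / pi.
  by rewrite -mulrBl; congr (_ / _); ring.
rewrite /= -!natr1.
set u := (size l)%:R; have -> : u = (size l)%:~R by [].
lra.
Qed.

Lemma IVT_sign (H : R -> R) x y : x < y -> continuous H -> H x * H y < 0 ->
  exists2 z, x < z < y & H z = 0.
Proof.
move=> xy cH Hxy.
have [||z] := @IVT _ H x y 0 (ltW xy).
- exact: continuous_subspaceT.
- rewrite ge_min le_max; nra.
rewrite in_itv/= => /andP[xz zy] Hz; exists z => //.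
rewrite !lt_neqAle xz zy !andbT; apply/andP; split; apply/eqP => e.
  by move: Hxy; rewrite e Hz mul0r ltxx.
by move: Hxy; rewrite -e Hz mulr0 ltxx.
Qed.

(** At the successive points where [cos (n t - b)] is [1] or [-1], the bound [|w| + e < r] forces
    [H] to have the sign of this cosine, which alternates; the intermediate value theorem gives a
    zero between neighbours. *)
Lemma zeros_lower (H : R -> R) n r b c d (w e : R) :
  0 < n -> c <= d -> continuous H ->
  (forall t, c <= t <= d -> `|H t - r * cos (n * t - b) - w| <= e) ->
  `|w| + e < r ->
  exists s : seq R, [/\ uniq s, (forall z, z \in s -> c < z < d /\ H z = 0) &
    n * (d - c) / pi - 2 <= (size s)%:R].
Proof.
move=> n0 cd cH he wr.
have pi0 : 0 < pi :> R := pi_gt0 R.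
(* [m] intervals need [m + 1] points: up to one half period is spent before the first of them, and
   [Num.trunc] loses less than one more. *)
pose m := (Num.trunc (n * (d - c) / pi)).-1.
have ge0 := wavenumber_ge0 n0 cd.
have [m0|m_gt0] := posnP m.
  exists [::]; split=> //=.
  have /andP[_ ] := truncn_itv ge0.
  have : (Num.trunc (n * (d - c) / pi) <= 1)%N by rewrite -subn_eq0 subn1 -/m m0.
  rewrite -(ler_nat R) -[in X in X -> _]natr1; lra.
have mE : m.+1%:R <= n * (d - c) / pi.
  rewrite (@le_trans _ _ (Num.trunc (n * (d - c) / pi))%:R) ?truncn_le// ler_nat.
  by rewrite /m prednK// lt0n; apply: contraTneq m_gt0; rewrite /m => ->.
(* Adding 1 to the floor puts the first extremum [tau 0] strictly to the right of [c]. *)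
pose k := Num.floor ((n * c - b) / pi) + 1.
pose tau (i : nat) := (b + k%:~R * pi + i%:R * pi) / n.
have /andP[k1 k2] := floor_itv ((n * c - b) / pi).
rewrite -/k in k2.
have k3 : k%:~R <= (n * c - b) / pi + 1 by rewrite intrD lerD2r.
have ctau0 : c < tau 0%N.
  rewrite /tau mul0r addr0 ltr_pdivlMr//.
  move: k2; rewrite ltr_pdivrMr//; lra.
have tauS i : tau i.+1 = tau i + pi / n.
  rewrite /tau -natr1; field; lra.
have tauE i : tau i = tau 0%N + i%:R * (pi / n) by rewrite /tau; field; lra.
have ctau i : c < tau i.
  by rewrite tauE (lt_le_trans ctau0)// lerDl mulr_ge0// divr_ge0// ltW.
have taud i : (i <= m)%N -> tau i <= d.
  move=> im; rewrite /tau ler_pdivrMr//.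
  have im' : i%:R <= m%:R :> R by rewrite ler_nat.
  move: mE; rewrite ler_pdivlMr// -natr1 => mE.
  have k4 : k%:~R * pi <= n * c - b + pi.
    by move: k3; rewrite -(ler_pM2r pi0) mulrDl divfK ?gt_eqF// mul1r.
  have : i%:R * pi <= m%:R * pi :> R by rewrite ler_pM2r.
  lra.
pose v i := cos (n * tau i - b).
have vS i : v i.+1 = - v i.
  by rewrite /v tauS mulrDr addrAC [n * (pi / n)]mulrC divfK ?gt_eqF// cosDpi.
have v1 i : `|v i| = 1.
  elim: i => [|i IH]; last by rewrite vS normrN.
  rewrite /v /tau mul0r addr0 mulrC divfK ?gt_eqF// addrAC subrr cosDpik cos0 normr1 //.
have vv i : v i * v i = 1 by rewrite -expr2 -real_normK ?num_real// v1 expr1n.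
have Hv i : (i <= m)%N -> 0 < H (tau i) * v i.
  move=> im; have := he (tau i); rewrite (ltW (ctau i)) taud// => /(_ isT).
  rewrite -/(v i); have := vv i.
  have : `|v i| <= 1 by rewrite v1.
  rewrite !ler_norml => /andP[a1 a2] a3 /andP[a4 a5].
  have [w1 w2] : w <= `|w| /\ - `|w| <= w by rewrite ler_norm lerNl -normrN ler_norm.
  have : v i = 1 \/ v i = -1.
    have : (v i - 1) * (v i + 1) = 0 by move: a3; nra.
    by move/eqP; rewrite mulf_eq0 subr_eq0 addr_eq0 => /orP[]/eqP; [left|right].
  case=> e1; rewrite e1 in a4 a5 *; lra.
have ex i : exists z, (i < m)%N -> tau i < z < tau i.+1 /\ H z = 0.
  have [im|mi] := ltnP i m; last by exists 0.
  have [||z] := @IVT_sign H (tau i) (tau i.+1) _ cH.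
  - by rewrite tauS ltrDl divr_gt0.
  - have := Hv i (ltnW im); have := Hv i.+1 im; rewrite vS => a1 a2.
    have : 0 < (H (tau i) * v i) * (H (tau i.+1) * - v i) by rewrite mulr_gt0.
    by rewrite mulrN mulrN oppr_gt0 mulrACA vv mulr1.
  by exists z.
have [f fP] := choice ex.
have fmono i j : (i < j)%N -> (j < m)%N -> f i < f j.
  move=> ij jm; have [/andP[_ a1] _] := fP i (ltn_trans ij jm).
  have [/andP[a2 _] _] := fP j jm.
  apply: (lt_le_trans a1); apply: le_trans (ltW a2).
  by rewrite (tauE i.+1) (tauE j) lerD2l ler_pM2r ?divr_gt0// ler_nat.
exists (mkseq f m); split.
- apply/(uniqP 0) => i j; rewrite !inE size_mkseq => im jm.
  rewrite !nth_mkseq// => fij; apply/eqP; case: ltngtP => // ij; exfalso.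
    by have := fmono _ _ ij jm; rewrite fij ltxx.
  by have := fmono _ _ ij im; rewrite fij ltxx.
- move=> z /mapP[i]; rewrite mem_iota add0n => /andP[_ im] ->.
  have [/andP[a1 a2] a3] := fP i im; split=> //.
  by rewrite (lt_trans (ctau i) a1)/= (lt_le_trans a2)// taud.
- rewrite size_mkseq.
  have /andP[_ ] := truncn_itv ge0.
  have -> : Num.trunc (n * (d - c) / pi) = m.+1.
    by rewrite /m prednK// lt0n; apply: contraTneq m_gt0; rewrite /m => ->.
  rewrite -!natr1; lra.
Qed.

End Counting.

(** * Oscillations with trigonometric coefficients of degree one *)

Section TrigAffine.
Context {R : realType}.
Implicit Types (p q w c : R * R * R) (t n b x y : R).

(** Trigonometric polynomials of degree one are kept as coefficient triples, on which [dtp] is the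
    derivation and [tpn] a norm. In this form [oscil] is closed under differentiation, and one norm
    bounds all the derivatives of the coefficients. *)
Definition tp c t := c.1.1 + c.1.2 * cos t + c.2 * sin t.
Definition dtp c : R * R * R := (0, c.2, - c.1.2).
Definition tpn c := `|c.1.1| + `|c.1.2| + `|c.2|.

Lemma tpn_ge0 c : 0 <= tpn c.
Proof. by rewrite /tpn !addr_ge0. Qed.

Lemma tpD c c' t : tp (c + c') t = tp c t + tp c' t.
Proof. by rewrite /tp/=; ring. Qed.

Lemma tpZ (k : R) c t : tp (k *: c) t = k * tp c t.
Proof. by rewrite /tp/= !mulrDr !mulrA. Qed.

Lemma tpN c t : tp (- c) t = - tp c t.
Proof. by rewrite /tp/=; ring. Qed.

Lemma is_derive_tp c t : is_derive t 1 (tp c) (tp (dtp c) t).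
Proof.
rewrite /tp /dtp /=; apply: is_derive_eq.
rewrite /GRing.scale/=; ring.
Qed.

Lemma continuous_tp c : continuous (tp c).
Proof. exact: continuous_derivable (is_derive_tp c). Qed.

Lemma tp_bound c t : `|tp c t| <= tpn c.
Proof.
rewrite /tp /tpn (le_trans (ler_normD _ _))// lerD//.
  by rewrite (le_trans (ler_normD _ _))// lerD2l normrM ler_piMr// cos_max.
by rewrite normrM ler_piMr// sin_max.
Qed.

Lemma tpn_dtp c : tpn (dtp c) <= tpn c.
Proof. by rewrite /tpn /dtp /= normr0 normrN add0r [leLHS]addrC -addrA lerDr. Qed.

Lemma tp_lip c x y : `|tp c x - tp c y| <= tpn c * `|x - y|.
Proof.
apply: (lip_of_derive (is_derive_tp c)) => t.
by rewrite (le_trans (tp_bound _ _))// tpn_dtp.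
Qed.

Definition oscil p q w n t := tp p t * cos (n * t) + tp q t * sin (n * t) + tp w t.

Lemma is_derive_oscil p q w n t :
  is_derive t 1 (oscil p q w n)
    (oscil (dtp p + n *: q) (dtp q - n *: p) (dtp w) n t).
Proof.
have := is_derive_tp p t; have := is_derive_tp q t; have := is_derive_tp w t.
move=> dw dq dp.
have dn : is_derive t 1 ( *%R n) n.
  by apply: is_derive_eq; rewrite /GRing.scale/= mulr1.
rewrite /oscil; apply: is_derive_eq.
rewrite !tpD tpN !tpZ /GRing.scale/=; ring.
Qed.

Lemma continuous_oscil p q w n : continuous (oscil p q w n).
Proof. exact: continuous_derivable (is_derive_oscil p q w n). Qed.

Definition amp p q t := Num.sqrt (tp p t ^+ 2 + tp q t ^+ 2).

Lemma amp_ge0 p q t : 0 <= amp p q t. Proof. exact: sqrtr_ge0. Qed.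

Lemma sqr_amp p q t : amp p q t ^+ 2 = tp p t ^+ 2 + tp q t ^+ 2.
Proof. by rewrite sqr_sqrtr// addr_ge0// sqr_ge0. Qed.

Lemma continuous_amp p q : continuous (amp p q).
Proof.
move=> t; rewrite /amp; apply: continuous_comp; last exact: sqrt_continuous.
apply: cvgD.
  by apply: (@cvg_comp _ _ _ (tp p) (fun z => z ^+ 2));
    [exact: continuous_tp|exact: exprn_continuous].
by apply: (@cvg_comp _ _ _ (tp q) (fun z => z ^+ 2));
  [exact: continuous_tp|exact: exprn_continuous].
Qed.

(** Cauchy-Schwarz against the unit vector [(cos b, sin b)]. *)
Lemma amp_ge_dot p q t b : tp p t * cos b + tp q t * sin b <= amp p q t.
Proof.
rewrite (le_trans (ler_norm _))// -(ler_pXn2r (n := 2)) ?nnegrE ?amp_ge0//.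
rewrite sqr_amp real_normK ?num_real//.
have := cos2Dsin2 b; move: (cos b) (sin b) (tp p t) (tp q t) => u v P Q uv.
have -> : P ^+ 2 + Q ^+ 2 = (P ^+ 2 + Q ^+ 2) * (u ^+ 2 + v ^+ 2) by rewrite uv mulr1.
have : 0 <= (P * v - Q * u) ^+ 2 by exact: sqr_ge0.
nra.
Qed.

Lemma amp_polar p q t : 0 < amp p q t ->
  exists b, tp p t = amp p q t * cos b /\ tp q t = amp p q t * sin b.
Proof. by move=> a0; apply: polar; rewrite ?sqr_amp. Qed.

Lemma dot_bound (u v b e : R) : `|u| <= e -> `|v| <= e ->
  `|u * cos b + v * sin b| <= e + e.
Proof.
move=> ue ve; rewrite (le_trans (ler_normD _ _))// !normrM.
apply: lerD.
  by rewrite (le_trans _ ue)// ler_piMr// cos_max.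
by rewrite (le_trans _ ve)// ler_piMr// sin_max.
Qed.

(** The phase that attains the amplitude at [x] bounds the amplitude at [y] from below, which avoids
    differentiating the square root. *)
Lemma amp_lip p q x y : 0 < amp p q x ->
  amp p q x <= amp p q y + (tpn p + tpn q) * `|x - y|.
Proof.
move=> ax; have [b [pb qb]] := amp_polar ax.
have := amp_ge_dot p q y b.
have : amp p q x = tp p x * cos b + tp q x * sin b.
  by rewrite pb qb -!mulrA -mulrDr -!expr2 cos2Dsin2 mulr1.
move=> ->; have := tp_lip p x y; have := tp_lip q x y.
set P := tp p x; set P' := tp p y; set Q := tp q x; set Q' := tp q y.
move=> hq hp h.
have h1 : (P - P') * cos b <= tpn p * `|x - y|.
  by rewrite (le_trans (ler_norm _))// normrM (le_trans _ hp)// ler_piMr// cos_max.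
have h2 : (Q - Q') * sin b <= tpn q * `|x - y|.
  by rewrite (le_trans (ler_norm _))// normrM (le_trans _ hq)// ler_piMr// sin_max.
move: h1 h2 h; rewrite !mulrBl mulrDl; lra.
Qed.

Section Window.
Variables (p q w : R * R * R).
Let L : R := tpn p + tpn q + tpn w.
Let tpnp : tpn p <= L. Proof. by rewrite /L -addrA lerDl addr_ge0// tpn_ge0. Qed.
Let tpnq : tpn q <= L. Proof. by rewrite /L addrAC lerDr addr_ge0// tpn_ge0. Qed.
Let tpnw : tpn w <= L. Proof. by rewrite /L lerDr addr_ge0// tpn_ge0. Qed.

(** Each of the three coefficients stays within [L (y0 - x0)] of its value at [x0]; once they are
    frozen there, the fast part is a single cosine of phase [b]. *)
Lemma oscil_freeze n x0 y0 b t : tp p x0 = amp p q x0 * cos b ->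
  tp q x0 = amp p q x0 * sin b -> x0 <= t <= y0 ->
  `|oscil p q w n t - amp p q x0 * cos (n * t - b) - tp w x0| <= 3 * L * (y0 - x0).
Proof.
move=> pb qb /andP[ct td].
have -> : oscil p q w n t - amp p q x0 * cos (n * t - b) - tp w x0 =
    ((tp p t - tp p x0) * cos (n * t) + (tp q t - tp q x0) * sin (n * t)) +
    (tp w t - tp w x0).
  by rewrite /oscil cosB pb qb; ring.
have lip c : tpn c <= L -> `|tp c t - tp c x0| <= L * (y0 - x0).
  move=> cL; rewrite (le_trans (tp_lip _ _ _))//.
  by rewrite ler_pM ?tpn_ge0// ger0_norm ?subr_ge0// lerD2r.
rewrite (le_trans (ler_normD _ _))//.
have -> : 3 * L * (y0 - x0) = L * (y0 - x0) + L * (y0 - x0) + L * (y0 - x0) by ring.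
by rewrite lerD// ?lip// dot_bound// lip.
Qed.

(** Differentiating the fast factors brings out [n]; the derivatives of the coefficients stay
    bounded and cost [3 L / n] after division by [n]. *)
Lemma oscil_freeze1 n x0 y0 b t : 0 < n -> tp p x0 = amp p q x0 * cos b ->
  tp q x0 = amp p q x0 * sin b -> x0 <= t <= y0 ->
  `|oscil (dtp p + n *: q) (dtp q - n *: p) (dtp w) n t / n
     + amp p q x0 * sin (n * t - b)| <= 2 * L * (y0 - x0) + 3 * L / n.
Proof.
move=> n0 pb qb /andP[ct td].
have lip c : tpn c <= L -> `|tp c t - tp c x0| <= L * (y0 - x0).
  move=> cL; rewrite (le_trans (tp_lip _ _ _))//.
  by rewrite ler_pM ?tpn_ge0// ger0_norm ?subr_ge0// lerD2r.
have bd c : tpn c <= L -> `|tp (dtp c) t| <= L.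
  by move=> cL; rewrite (le_trans (tp_bound _ _))// (le_trans (tpn_dtp _)).
have -> : oscil (dtp p + n *: q) (dtp q - n *: p) (dtp w) n t / n
     + amp p q x0 * sin (n * t - b) =
   ((tp q t - tp q x0) * cos (n * t) + (- (tp p t - tp p x0)) * sin (n * t)) +
   ((tp (dtp p) t * cos (n * t) + tp (dtp q) t * sin (n * t)) + tp (dtp w) t) / n.
  rewrite /oscil sinB !tpD tpN !tpZ pb qb; field; lra.
rewrite (le_trans (ler_normD _ _))//.
have -> : 2 * L * (y0 - x0) + 3 * L / n =
  (L * (y0 - x0) + L * (y0 - x0)) + (L + L + L) / n by ring.
rewrite lerD//.
  by rewrite dot_bound ?normrN ?lip.
rewrite normrM normfV (gtr0_norm n0) ler_pM2r ?invr_gt0//.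
by rewrite (le_trans (ler_normD _ _))// lerD ?dot_bound ?bd.
Qed.

Lemma oscil_freeze2 n x0 y0 b t : 1 <= n -> tp p x0 = amp p q x0 * cos b ->
  tp q x0 = amp p q x0 * sin b -> x0 <= t <= y0 ->
  `|oscil (dtp (dtp p + n *: q) + n *: (dtp q - n *: p))
          (dtp (dtp q - n *: p) - n *: (dtp p + n *: q)) (dtp (dtp w)) n t / n ^+ 2
     + amp p q x0 * cos (n * t - b)| <= 2 * L * (y0 - x0) + 7 * L / n.
Proof.
move=> n1 pb qb /andP[ct td].
have n0 : 0 < n by lra.
have lip c : tpn c <= L -> `|tp c t - tp c x0| <= L * (y0 - x0).
  move=> cL; rewrite (le_trans (tp_lip _ _ _))//.
  by rewrite ler_pM ?tpn_ge0// ger0_norm ?subr_ge0// lerD2r.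
have bd c : tpn c <= L -> `|tp (dtp c) t| <= L.
  by move=> cL; rewrite (le_trans (tp_bound _ _))// (le_trans (tpn_dtp _)).
have bd2 c : tpn c <= L -> `|tp (dtp (dtp c)) t| <= L.
  by move=> cL; rewrite bd// (le_trans (tpn_dtp _)).
have dD c c' : dtp (c + c') = dtp c + dtp c'.
  by rewrite /dtp /= ; congr (_, _, _) => /=; ring.
have dZ k c : dtp (k *: c) = k *: dtp c.
  by rewrite /dtp /= ; congr (_, _, _) => /=; rewrite /GRing.scale/=; ring.
have dN c : dtp (- c) = - dtp c.
  by rewrite /dtp /= ; congr (_, _, _) => /=; ring.
have -> : oscil (dtp (dtp p + n *: q) + n *: (dtp q - n *: p))
          (dtp (dtp q - n *: p) - n *: (dtp p + n *: q)) (dtp (dtp w)) n t / n ^+ 2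
     + amp p q x0 * cos (n * t - b) =
   ((- (tp p t - tp p x0)) * cos (n * t) + (- (tp q t - tp q x0)) * sin (n * t)) +
   (((tp (dtp q) t *+ 2) * cos (n * t) + (- (tp (dtp p) t *+ 2)) * sin (n * t)) +
   ((tp (dtp (dtp p)) t * cos (n * t) + tp (dtp (dtp q)) t * sin (n * t)) +
     tp (dtp (dtp w)) t) / n) / n.
  rewrite /oscil cosB !(dD, dZ, dN) !(tpD, tpN, tpZ) pb qb; field; lra.
rewrite (le_trans (ler_normD _ _))//.
(* The 7 is 4 from twice the first derivatives of [p] and [q], plus 3 from the second derivatives,
   whose factor [1 / n^2] is at most [1 / n]. *)
have -> : 2 * L * (y0 - x0) + 7 * L / n =
  (L * (y0 - x0) + L * (y0 - x0)) + ((L + L) + (L + L) + (L + L + L)) / n by ring.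
rewrite lerD//.
  by rewrite dot_bound ?normrN ?lip.
rewrite normrM normfV (gtr0_norm n0) ler_pM2r ?invr_gt0//.
rewrite (le_trans (ler_normD _ _))// lerD//.
  by rewrite dot_bound ?normrN// mulr2n (le_trans (ler_normD _ _))// lerD// bd.
rewrite normrM normfV (gtr0_norm n0) ler_pdivrMr//.
rewrite (@le_trans _ _ (L + L + L))//.
  by rewrite (le_trans (ler_normD _ _))// lerD ?dot_bound ?bd2.
have : 0 <= L by rewrite (le_trans _ tpnp)// tpn_ge0.
nra.
Qed.

Lemma window_upper n x0 y0 (v : R) (s : seq R) : 1 <= n -> x0 <= y0 ->
  0 < v -> (forall t, v <= amp p q t) ->
  2 * L * (y0 - x0) + 7 * L / n <= v / 2 ->
  uniq s -> (forall z, z \in s -> x0 <= z <= y0 /\ oscil p q w n z = 0) ->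
  (size s)%:R <= n * (y0 - x0) / pi + 3.
Proof.
move=> n1 cd v0 hv small us Hs.
have n0 : 0 < n by lra.
have a0 : 0 < amp p q x0 by exact: lt_le_trans (hv _).
have L0 : 0 <= L by rewrite (le_trans _ tpnp)// tpn_ge0.
have [b [pb qb]] := amp_polar a0.
rewrite -(size_sort <=%R).
have le2 : v / 2 <= amp p q x0 / 2 by rewrite ler_pM2r ?invr_gt0.
apply: (zeros_upper n0 a0 cd (is_derive_oscil p q w n) (is_derive_oscil _ _ _ n) (b := b)).
- move=> t ht; apply: le_trans (le_trans small le2).
  apply: (le_trans (oscil_freeze1 n0 pb qb ht)).
  by rewrite lerD2l ler_pM2r ?invr_gt0//; lra.
- move=> t ht; apply: le_trans (le_trans small le2).
  exact: (oscil_freeze2 n1 pb qb ht).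
- by rewrite lt_sorted_uniq_le sort_uniq us sort_le_sorted.
- by move=> z; rewrite mem_sort; exact: Hs.
Qed.

Lemma window_lower n x0 y0 : 0 < n -> x0 <= y0 -> 0 < amp p q x0 ->
  `|tp w x0| + 3 * L * (y0 - x0) < amp p q x0 ->
  exists s : seq R, [/\ uniq s,
    (forall z, z \in s -> x0 < z < y0 /\ oscil p q w n z = 0) &
    n * (y0 - x0) / pi - 2 <= (size s)%:R].
Proof.
move=> n0 cd a0 h; have [b [pb qb]] := amp_polar a0.
apply: (@zeros_lower R _ n (amp p q x0) b x0 y0 (tp w x0) (3 * L * (y0 - x0))) => //.
  exact: continuous_oscil.
by move=> t; exact: oscil_freeze.
Qed.

End Window.
End TrigAffine.

(** * Length of a set inside an interval *)

Section Length.
Context {R : realType}.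
Implicit Types (E : set R) (x y z : R).
Local Notation mu := (@lebesgue_measure R).

(** Half-open intervals, so that the lengths over adjacent windows add up exactly. *)
Definition len E x y : R := fine (mu (E `&` `[x, y[)).

Lemma len_fin E x y : measurable E -> mu (E `&` `[x, y[) \is a fin_num.
Proof.
move=> mE; rewrite ge0_fin_numE ?measure_ge0//.
have /= -> // := @le_lt_trans _ _ (mu `[x, y[).
  by apply: le_measure; rewrite ?inE//=; exact: measurableI.
by rewrite lebesgue_measure_itv/=; case: ifPn => // _; rewrite -EFinB ltry.
Qed.

Lemma len_ge0 E x y : 0 <= len E x y.
Proof. by rewrite fine_ge0. Qed.

Lemma len_add E x y z : measurable E -> x <= y -> y <= z ->
  len E x z = len E x y + len E y z.
Proof.
move=> mE xy yz; rewrite /len -fineD ?len_fin//; congr fine.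
rewrite -measureU.
- rewrite -setIUr; congr (mu (_ `&` _)).
  apply/seteqP; split => t /=; rewrite !in_itv/=.
    by move=> /andP[a b]; case: (ltP t y) => h; [left|right]; apply/andP.
  by move=> [] /andP[a b]; apply/andP; split; lra.
- exact: measurableI.
- exact: measurableI.
- apply/seteqP; split => // t [[_]] /=; rewrite !in_itv/= => /andP[_ a] [_ /andP[b _]].
  lra.
Qed.

Lemma len_full E x y : x <= y -> (forall t, x <= t < y -> E t) -> len E x y = y - x.
Proof.
move=> xy h; rewrite /len (_ : _ `&` _ = `[x, y[%classic).
  rewrite lebesgue_measure_itv/= lte_fin; case: ifPn => //= xy'.
  by apply/esym/eqP; rewrite subr_eq0; apply/eqP; lra.
by apply/seteqP; split=> t /=; rewrite in_itv/=; [case|move=> t1; split => //; exact: h].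
Qed.

Lemma len_empty E x y : (forall t, x <= t < y -> ~ E t) -> len E x y = 0.
Proof.
move=> h; rewrite /len (_ : _ `&` _ = set0) ?measure0//.
by apply/seteqP; split=> // t [/= a]; rewrite in_itv/= => /h.
Qed.

End Length.

(** * Asymptotic number of zeros over a period *)

Section ZeroCount.
Context {R : realType}.
Variables (p q w : R * R * R).
Hypothesis amp_gt0 : forall t, 0 < amp p q t.
Let L : R := tpn p + tpn q + tpn w.
Implicit Types (t n e : R).
Local Notation mu := (@lebesgue_measure R).

(* Where [gap < 0], the slow term [tp w] is dominated and [oscil] changes sign in each
   half period; where [gap > 0] it has no zero. *)
Definition gap t := `|tp w t| - amp p q t.

Lemma continuous_gap : continuous gap.
Proof.
move=> t; apply: cvgB; last exact: continuous_amp.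
by apply: (@cvg_comp _ _ _ (tp w) Num.norm); [exact: continuous_tp|exact: norm_continuous].
Qed.

Lemma measurable_gap : measurable_fun setT gap.
Proof. by apply: continuous_measurable_fun; exact: continuous_gap. Qed.

Lemma measurable_gap_le e : measurable [set t | gap t <= e].
Proof.
have := measurable_gap measurableT (measurable_itv `]-oo, e]).
by rewrite setTI; congr measurable; apply/seteqP; split=> t/=; rewrite in_itv.
Qed.

Lemma measurable_gap_lt e : measurable [set t | gap t < e].
Proof.
have := measurable_gap measurableT (measurable_itv `]-oo, e[).
by rewrite setTI; congr measurable; apply/seteqP; split=> t/=; rewrite in_itv.
Qed.

Let L0 : 0 <= L. Proof. by rewrite !addr_ge0// tpn_ge0. Qed.

(** The amplitude is continuous, positive and of period [2 pi], so its minimum over one period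
    bounds it everywhere. *)
Lemma amp_lb : exists2 v : R, 0 < v & forall t, v <= amp p q t.
Proof.
have [c _ cP] : exists2 c, c \in `[0, 2 * pi]%R & forall t, t \in `[0, 2 * pi]%R -> amp p q c <= amp p q t.
  apply: EVT_min; first by rewrite mulr_ge0// pi_ge0.
  exact/continuous_subspaceT/continuous_amp.
exists (amp p q c) => // t.
pose k := Num.floor (t / (2 * pi)).
have p0 : 0 < 2 * pi :> R by rewrite mulr_gt0// pi_gt0.
have [k1 k2] := andP (floor_itv (t / (2 * pi))).
rewrite -/k intrD in k1 k2.
have per u (m : nat) : amp p q (u + m%:R * (2 * pi)) = amp p q u.
  elim: m => [|m IH]; first by rewrite mul0r addr0.
  rewrite -natr1 mulrDl mul1r addrA -[in RHS]IH /amp /tp.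
  by rewrite [2 * pi]mulrC mulr_natr cosD2pi sinD2pi.
pose u := t - k%:~R * (2 * pi).
have -> : amp p q t = amp p q u.
  rewrite /u; case: (k) => m.
    by rewrite -[in LHS](subrK (m%:R * (2 * pi)) t) per.
  by rewrite -(per t m.+1) NegzE mulrNz mulNr opprK.
apply: cP; rewrite in_itv/= /u; apply/andP; split.
  by rewrite subr_ge0 -ler_pdivlMr.
move: k2; rewrite ltr_pdivrMr//; lra.
Qed.

Lemma gap_lip x y : gap x <= gap y + 2 * L * `|x - y|.
Proof.
have := @amp_lip _ p q y x (amp_gt0 y); have := tp_lip w x y.
have : `|tp w x| <= `|tp w y| + `|tp w x - tp w y|.
  by rewrite -[in leLHS](subrK (tp w y) (tp w x)) addrC ler_normD.
rewrite /gap (distrC y x) /L.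
have := tpn_ge0 p; have := tpn_ge0 q; have := tpn_ge0 w.
have : 0 <= `|x - y| by [].
nra.
Qed.

Lemma oscil_zero_gap n t : oscil p q w n t = 0 -> gap t <= 0.
Proof.
rewrite /oscil /gap subr_le0 addrC => /eqP; rewrite addr_eq0 => /eqP ->.
rewrite normrN ler_norml amp_ge_dot andbT.
(* The lower bound on the fast part is the upper one with the phase shifted by [pi]. *)
have := amp_ge_dot p q t (n * t + pi).
by rewrite cosDpi sinDpi; lra.
Qed.

(* Partition of [0, 2pi[ into windows of length [del]; all the windows but those on
   which [gap] keeps a constant sign are controlled by the measure of [|gap| <= eta]. *)
Section Windows.
Variables (eta del v n : R).
Hypotheses (eta0 : 0 < eta) (del0 : 0 < del) (del_eta : 6 * L * del <= eta)
  (v0 : 0 < v) (hv : forall t, v <= amp p q t) (n1 : 1 <= n)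
  (small : 2 * L * del + 7 * L / n <= v / 2).
Let n0 : 0 < n. Proof. exact: lt_le_trans n1. Qed.
Let pi0 : 0 < pi :> R. Proof. exact: pi_gt0. Qed.

(** A window that contains a zero has [gap <= 0] somewhere, hence [gap <= eta] throughout, and its
    full length enters [len]; windows without zeros need no estimate. *)
Lemma count_upper (j : nat) (s : seq R) : uniq s ->
  (forall z, z \in s -> 0 <= z < j%:R * del /\ oscil p q w n z = 0) ->
  (size s)%:R <= n / pi * len [set t | gap t <= eta] 0 (j%:R * del) + 3 * j%:R.
Proof.
elim: j s => [|j IH] s us Hs.
  case: s us Hs => [_ _|z s _ Hs].
    by rewrite mulr0 addr0 mulr_ge0 ?len_ge0// divr_ge0// ltW.
  have [] := Hs z (mem_head _ _); rewrite mul0r => /andP[a b]; lra.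
pose A := [set t | gap t <= eta].
have mA : measurable A := measurable_gap_le eta.
pose c := j%:R * del; pose d := j.+1%:R * del.
have dE : d = c + del by rewrite /d /c -natr1 mulrDl mul1r.
have c0 : 0 <= c by rewrite mulr_ge0// ltW.
have cd : c <= d by rewrite dE lerDl ltW.
rewrite (@len_add _ _ 0 c d)//.
have := IH (seq.filter (fun z => z < c) s) (filter_uniq _ us) => IH'.
have -> : (size s)%:R = (size (seq.filter (fun z => z < c) s))%:R +
    (size (seq.filter (predC (fun z => z < c)) s))%:R :> R.
  by rewrite -natrD !size_filter count_predC.
have {IH'} := IH' _; rewrite -/A -/c => IHs.
have {}IHs : (size (seq.filter (fun z => z < c) s))%:R <= n / pi * len A 0 c + 3 * j%:R.
  apply: IHs => z; rewrite mem_filter => /andP[zc /Hs[/andP[z0 _] ->]]; split=> //.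
  by rewrite z0.
suff : (size (seq.filter (predC (fun z => z < c)) s))%:R <= n / pi * len A c d + 3.
  by rewrite -natr1; lra.
set s' := seq.filter _ _.
have us' : uniq s' by exact: filter_uniq.
have Hs' z : z \in s' -> c <= z < d /\ oscil p q w n z = 0.
  by rewrite mem_filter /= -leNgt => /andP[cz /Hs[/andP[_ zd] ->]]; split=> //; rewrite cz.
have [s0|[z zs]] : s' = [::] \/ exists z, z \in s'.
  by case: (s') => [|z ?]; [left|right; exists z; rewrite mem_head].
  by rewrite s0 addr_ge0// mulr_ge0 ?len_ge0// divr_ge0// ltW.
have [/andP[cz zd] Hz] := Hs' z zs.
rewrite len_full//; last first.
  move=> t /andP[ct td]; rewrite /A/=.
  apply: (le_trans (gap_lip t z)); apply: le_trans del_eta.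
  rewrite -[leRHS]add0r lerD ?(oscil_zero_gap Hz)//.
  have : `|t - z| <= del by rewrite ler_norml; apply/andP; split; lra.
  by move: L0 del0; nra.
have -> : n / pi * (d - c) = n * (d - c) / pi by ring.
apply: (@window_upper R p q w n c d v) => //.
  by have -> : d - c = del by rewrite dE addrAC subrr add0r.
by move=> y /Hs'[/andP[-> /ltW ->] ->].
Qed.

(** A window meeting [gap < - eta] has, by the Lipschitz bound, enough room at its left end for
    [window_lower]; the other windows add nothing to [len]. *)
Lemma count_lower (j : nat) : exists s : seq R, [/\ uniq s,
  (forall z, z \in s -> 0 <= z < j%:R * del /\ oscil p q w n z = 0) &
  n / pi * len [set t | gap t < - eta] 0 (j%:R * del) - 2 * j%:R <= (size s)%:R].
Proof.
elim: j => [|j [s [us Hs Ss]]].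
  exists [::]; split=> //=; rewrite mul0r len_empty ?mulr0 ?subrr//.
  by move=> t ?; lra.
pose B := [set t | gap t < - eta].
have mB : measurable B := measurable_gap_lt (- eta).
pose c := j%:R * del; pose d := j.+1%:R * del.
have dE : d = c + del by rewrite /d /c -natr1 mulrDl mul1r.
have c0 : 0 <= c by rewrite mulr_ge0// ltW.
have cd : c < d by rewrite dE ltrDl.
rewrite -/B -/d (@len_add _ _ 0 c d) ?(ltW cd)//.
rewrite -/B -/c in Ss.
have [[t [/andP[ct td] Bt]]|noB] := pselect (exists t, c <= t < d /\ B t); last first.
  exists s; split=> //.
    by move=> z /Hs[/andP[-> zc] ->]; split=> //=; rewrite (lt_trans zc).
  rewrite (@len_empty _ _ c d) ?addr0; last first.
    by move=> u cud Bu; apply: noB; exists u.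
  by rewrite -natr1; lra.
have [||||s' [us' Hs' Ss']] := @window_lower R p q w n c d.
- exact: n0.
- exact: ltW.
- exact: amp_gt0.
- rewrite -/L; have := gap_lip c t.
  rewrite /B/= in Bt.
  have ctd : `|c - t| <= del by rewrite ler_norml; apply/andP; split; lra.
  have -> : d - c = del by rewrite dE addrAC subrr add0r.
  move=> gc; have : gap c < - eta + 2 * L * del.
    apply: (le_lt_trans gc); rewrite ltr_leD// ler_wpM2l// mulr_ge0//.
  rewrite {1}/gap; have : 0 <= L * del by rewrite mulr_ge0// ltW.
  by move: del_eta; lra.
exists (s ++ s'); split.
- rewrite cat_uniq us us' andbT /=; apply/hasPn => z /Hs'[/andP[cz _] _].
  by apply/negP => /Hs[/andP[_ zc] _]; move: cz; rewrite ltNge (ltW zc).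
- move=> z; rewrite mem_cat => /orP[/Hs[/andP[-> zc] ->]|/Hs'[/andP[cz ->] ->]].
    by split=> //=; rewrite (lt_trans zc).
  by rewrite andbT; split=> //; rewrite (le_trans c0)// ltW.
- rewrite size_cat natrD.
  have : len B c d <= d - c.
    have -> : d - c = len setT c d by rewrite len_full// ltW.
    rewrite /len fine_le ?len_fin//.
    by apply: le_measure; rewrite ?inE; [exact: measurableI|exact: measurableI|exact: setSI].
  have : 0 <= n / pi by rewrite divr_ge0// ltW.
  have E : n * (d - c) / pi = n / pi * (d - c) by ring.
  rewrite E in Ss'; rewrite -natr1; move: Ss' Ss.
  set m := n / pi => h1 h2 h3 h4.
  have : m * len B c d <= m * (d - c) by rewrite ler_wpM2l.
  by lra.
Qed.

End Windows.

(** Continuity of the measure from above: the sets [gap <= eta] shrink to [gap <= 0], which exceeds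
    [gap < 0] by the null level set only. *)
Lemma len_gap_le_cvg (e : R) : 0 < e ->
  mu ([set t | gap t = 0] `&` `[0, 2 * pi[) = 0%E ->
  exists2 eta : R, 0 < eta &
    len [set t | gap t <= eta] 0 (2 * pi) <= len [set t | gap t < 0] 0 (2 * pi) + e.
Proof.
move=> e0 null.
pose F k := [set t | gap t <= k.+1%:R^-1] `&` `[0, 2 * pi[.
have mF k : measurable (F k) by apply: measurableI => //; exact: measurable_gap_le.
have capF : \bigcap_k F k = [set t | gap t <= 0] `&` `[0, 2 * pi[.
  apply/seteqP; split => t.
    move=> Ft; split; last by have [] := Ft 0%N I.
    rewrite /=; apply/ler_addgt0Pl => d d0; rewrite addr0.
    have [k /ltW kd] : exists k, k.+1%:R^-1 < d.
      exists (Num.trunc d^-1).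
      by rewrite -[ltRHS]invrK ltf_pV2 ?posrE ?invr_gt0// truncnS_gt.
    by have [/= h _] := Ft k I; exact: le_trans kd.
  by move=> [/= g0 it] k _; split=> //=; rewrite (le_trans g0).
have mcap : measurable (\bigcap_k F k).
  by rewrite capF; apply: measurableI => //; exact: measurable_gap_le.
have Ffin : (mu (F 0%N) < +oo)%E.
  by rewrite -ge0_fin_numE ?measure_ge0// len_fin//; exact: measurable_gap_le.
have Fdec : {homo F : n m / (n <= m)%N >-> (m <= n)%O}.
  move=> n m nm; apply/subsetPset => t [/= h it]; split=> //=.
  by rewrite (le_trans h)// lef_pV2 ?posrE// ler_nat.
have cv := nonincreasing_cvg_mu Ffin mF mcap Fdec.
have muE : mu (\bigcap_k F k) = (len [set t | gap t < 0] 0 (2 * pi))%:E.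
  rewrite capF /len fineK ?len_fin//; last exact: measurable_gap_lt.
  have -> : [set t | gap t <= 0] `&` `[0, 2 * pi[ =
      ([set t | gap t < 0] `&` `[0, 2 * pi[) `|` ([set t | gap t = 0] `&` `[0, 2 * pi[).
    rewrite -setIUl; congr (_ `&` _); apply/seteqP; split=> t /=.
      by rewrite le_eqVlt => /predU1P[]; [right|left].
    by case=> [/ltW//|->].
  have m0 : measurable [set t | gap t = 0].
    have -> : [set t | gap t = 0] = [set t | gap t <= 0] `\` [set t | gap t < 0].
      apply/seteqP; split=> t /=; first by move=> ->; rewrite lexx ltxx.
      by move=> [a /negP]; rewrite -leNgt => b; apply/eqP; rewrite eq_le a b.
    by apply: measurableD; [exact: measurable_gap_le|exact: measurable_gap_lt].
  rewrite measureU.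
  - by rewrite -[RHS]adde0; congr (_ + _)%E; exact: null.
  - by apply: measurableI => //; exact: measurable_gap_lt.
  - exact: measurableI.
  - by apply/seteqP; split=> // t [[/= a _] [/= b _]]; move: a; rewrite b ltxx.
have /fine_cvgP[_ /cvgrPdist_lt/(_ _ e0)[k _ /(_ k (leqnn k))/=]] :
  (mu \o F) k @[k --> \oo] --> (len [set t | gap t < 0] 0 (2 * pi))%:E by rewrite -muE.
set l := len _ _ _; rewrite distrC => /ltW; rewrite ler_norml => /andP[_ h].
exists k.+1%:R^-1 => //.
by rewrite -lerBlDl.
Qed.

(** Continuity of the measure from below. *)
Lemma len_gap_lt_cvg (e : R) : 0 < e ->
  exists2 eta : R, 0 < eta &
    len [set t | gap t < 0] 0 (2 * pi) <= len [set t | gap t < - eta] 0 (2 * pi) + e.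
Proof.
move=> e0.
pose F k := [set t | gap t < - k.+1%:R^-1] `&` `[0, 2 * pi[.
have mF k : measurable (F k) by apply: measurableI => //; exact: measurable_gap_lt.
have cupF : \bigcup_k F k = [set t | gap t < 0] `&` `[0, 2 * pi[.
  apply/seteqP; split => t.
    by move=> [k _ [/= h it]]; split=> //=; rewrite (lt_trans h)// oppr_lt0.
  move=> [/= g0 it]; exists (Num.trunc (- gap t)^-1) => //; split=> //=.
  rewrite ltrNr -[ltRHS]invrK ltf_pV2 ?posrE ?invr_gt0 ?oppr_gt0//.
  by rewrite truncnS_gt.
have mcup : measurable (\bigcup_k F k).
  by rewrite cupF; apply: measurableI => //; exact: measurable_gap_lt.
have Finc : {homo F : n m / (n <= m)%N >-> (n <= m)%O}.
  move=> n m nm; apply/subsetPset => t [/= h it]; split=> //=.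
  by rewrite (lt_le_trans h)// lerN2 lef_pV2 ?posrE// ler_nat.
have cv := @nondecreasing_cvg_mu _ _ _ mu _ mF mcup Finc.
have muE : mu (\bigcup_k F k) = (len [set t | gap t < 0] 0 (2 * pi))%:E.
  by rewrite cupF /len fineK ?len_fin//; exact: measurable_gap_lt.
have /fine_cvgP[_ /cvgrPdist_lt/(_ _ e0)[k _ /(_ k (leqnn k))/=]] :
  (mu \o F) k @[k --> \oo] --> (len [set t | gap t < 0] 0 (2 * pi))%:E by rewrite -muE.
set l := len _ _ _; move=> /ltW; rewrite ler_norml => /andP[_ h].
exists k.+1%:R^-1 => //.
by rewrite -lerBlDl.
Qed.

Lemma len_mono (A B : set R) : measurable A -> measurable B -> A `<=` B ->
  forall x y, len A x y <= len B x y.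
Proof.
move=> mA mB AB x y; rewrite /len fine_le ?len_fin//.
by apply: le_measure; rewrite ?inE; [exact: measurableI|exact: measurableI|exact: setSI].
Qed.

(** The number [M] of windows depends on [e] and the coefficients but not on [n], so the errors per
    window become negligible. The null level set makes the measures of [gap <= eta] and
    [gap < - eta] close to that of [gap < 0]. *)
Theorem zeros_asymptotics (e : R) : 0 < e ->
  mu ([set t | gap t = 0] `&` `[0, 2 * pi[) = 0%E ->
  let l := len [set t | gap t < 0] 0 (2 * pi) / pi in
  exists N : nat, forall n : nat, (N <= n)%N ->
    (forall s : seq R, uniq s ->
      (forall z, z \in s -> 0 <= z <= 2 * pi /\ oscil p q w n%:R z = 0) ->
      (size s)%:R <= n%:R * (l + e)) /\
    (exists s : seq R, [/\ uniq s,
      forall z, z \in s -> 0 <= z <= 2 * pi /\ oscil p q w n%:R z = 0 &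
      n%:R * (l - e) <= (size s)%:R]).
Proof.
move=> e0 null l.
have pi0 : 0 < pi :> R := pi_gt0 R.
have e' : 0 < pi * (e / 2) by rewrite mulr_gt0// divr_gt0.
have [eta1 eta10 le1] := len_gap_le_cvg e' null.
have [eta2 eta20 le2] := len_gap_lt_cvg e'.
pose eta := Num.min eta1 eta2.
have eta0 : 0 < eta by rewrite lt_min eta10.
have eta_1 : eta <= eta1 by rewrite ge_min lexx.
have eta_2 : eta <= eta2 by rewrite ge_min lexx orbT.
have up : len [set t | gap t <= eta] 0 (2 * pi) <=
    len [set t | gap t < 0] 0 (2 * pi) + pi * (e / 2).
  apply: le_trans le1; apply: len_mono; [exact: measurable_gap_le..|].
  by move=> t /= h; exact: le_trans eta_1.
have lo : len [set t | gap t < 0] 0 (2 * pi) <=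
    len [set t | gap t < - eta] 0 (2 * pi) + pi * (e / 2).
  apply: (le_trans le2); rewrite lerD2r; apply: len_mono; [exact: measurable_gap_lt..|].
  by move=> t /= h; apply: (lt_le_trans h); rewrite lerN2.
have [v v0 hv] := amp_lb.
have arch (x : R) : exists2 M : nat, (0 < M)%N & x <= M%:R.
  by exists (Num.trunc x).+1 => //; rewrite ltW// truncnS_gt.
(* The two summands ensure [6 L del <= eta] and [2 L del <= v / 4]; another [v / 4] is left for
   [7 L / n]. *)
have [M M0 hM] := arch (2 * pi * (6 * L / eta + 8 * L / v)).
have M0' : 0 < M%:R :> R by rewrite ltr0n.
pose del : R := 2 * pi / M%:R.
have del0 : 0 < del by rewrite divr_gt0// mulr_gt0.
have delM : M%:R * del = 2 * pi by rewrite /del mulrC divfK// gt_eqF.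
have [d1 d2] : 6 * L * del <= eta /\ 2 * L * del <= v / 4.
  have h1 : 0 <= 6 * L / eta by rewrite divr_ge0// ?(ltW eta0)// mulr_ge0.
  have h2 : 0 <= 8 * L / v by rewrite divr_ge0// ?(ltW v0)// mulr_ge0.
  have {}hM : (6 * L / eta + 8 * L / v) * del <= 1.
    by rewrite /del mulrA ler_pdivrMr// mul1r mulrC.
  have h3 : 6 * L / eta * del <= 1.
    by apply: le_trans hM; rewrite ler_pM2r// lerDl.
  have h4 : 8 * L / v * del <= 1.
    by apply: le_trans hM; rewrite ler_pM2r// lerDr.
  move: h3 h4; rewrite mulrAC ler_pdivrMr// [8 * L / v * _]mulrAC ler_pdivrMr//; lra.
(* [N1] brings [7 L / n] below [v / 4], and [N2] absorbs [3 M + 1] miscounted zeros into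
   [n e / 2]. *)
have [N1 _ hN1] := arch (28 * L / v).
have [N2 _ hN2] := arch ((3 * M%:R + 1) / (e / 2)).
exists (maxn 1 (maxn N1 N2)) => n; rewrite !geq_max => /and3P[n1 nN1 nN2].
have n1' : 1 <= n%:R :> R by rewrite ler1n.
have n0 : 0 < n%:R :> R by rewrite ltr0n.
have small : 2 * L * del + 7 * L / n%:R <= v / 2.
  suff : 7 * L / n%:R <= v / 4 by lra.
  rewrite ler_pdivrMr//.
  have : 28 * L / v <= n%:R by rewrite (le_trans hN1)// ler_nat.
  rewrite ler_pdivrMr//; lra.
have big : 3 * M%:R + 1 <= n%:R * (e / 2).
  have : (3 * M%:R + 1) / (e / 2) <= n%:R by rewrite (le_trans hN2)// ler_nat.
  by rewrite ler_pdivrMr// divr_gt0.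
have npi : 0 <= n%:R / pi :> R by rewrite divr_ge0// ltW.
have E : n%:R / pi * (len [set t | gap t < 0] 0 (2 * pi)) = n%:R * l.
  by rewrite /l; ring.
have E2 : n%:R / pi * (pi * (e / 2)) = n%:R * (e / 2).
  by field; lra.
split.
- move=> s us Hs; pose lt2pi (z : R) := z < 2 * pi.
  have us' : uniq (seq.filter lt2pi s) by exact: filter_uniq.
  have := count_upper del0 d1 v0 hv n1' small (j := M) us'.
  rewrite delM => H.
  have {}H := H _; have {}H : (size (seq.filter lt2pi s))%:R <=
      n%:R / pi * len [set t | gap t <= eta] 0 (2 * pi) + 3 * M%:R.
    by apply: H => z; rewrite mem_filter /lt2pi => /andP[-> /Hs[/andP[-> _] ->]].
  (* The windows cover [[0, 2 pi[]; the endpoint [2 pi] may be one more zero. *)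
  have s1 : (size s <= size (seq.filter lt2pi s) + 1)%N.
    rewrite -(count_predC lt2pi s) -size_filter leq_add2l.
    rewrite -size_filter; set s' := seq.filter _ _.
    apply: (@uniq_leq_size _ s' [:: 2 * pi]); first exact: filter_uniq.
    move=> z; rewrite mem_filter /= /lt2pi -leNgt => /andP[h /Hs[/andP[_ h'] _]].
    by rewrite inE eq_le h h'.
  have {}s1 : (size s)%:R <= (size (seq.filter lt2pi s))%:R + 1 :> R.
    by rewrite natr1 ler_nat -addn1.
  have h : n%:R / pi * len [set t | gap t <= eta] 0 (2 * pi) <=
      n%:R * l + n%:R * (e / 2).
    by rewrite -E -E2 -mulrDr ler_wpM2l.
  rewrite mulrDr; lra.
- have [s [us Hs Ss]] := count_lower del0 d1 n1' M.
  exists s; split => //.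
    by move=> z /Hs; rewrite delM => -[/andP[-> /ltW ->] ->].
  rewrite delM in Ss.
  have h : n%:R * l <= n%:R / pi * len [set t | gap t < - eta] 0 (2 * pi) +
      n%:R * (e / 2).
    by rewrite -E -E2 -mulrDr ler_wpM2l.
  rewrite mulrBr; lra.
Qed.

End ZeroCount.

(** * Cardinality through finite lists *)

Section Counting.
Context {R : realType}.

Lemma counting_ge (T : choiceType) (Z : set T) (s : seq T) :
  uniq s -> (forall z, z \in s -> Z z) -> ((size s)%:R%:E <= @counting T R Z)%E.
Proof.
move=> us sZ; rewrite /counting; case: ifPn => [/asboolP fZ|_]; last exact: leey.
rewrite lee_fin ler_nat; apply: uniq_leq_size => // z /sZ Zz.
by have := in_fset_set fZ z => ->; rewrite inE.
Qed.

(** An infinite set contains finite subsets of every size, so a finite bound on the lists also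
    excludes it. *)
Lemma counting_le (T : choiceType) (Z : set T) (c : \bar R) :
  (forall s : seq T, uniq s -> (forall z, z \in s -> Z z) -> ((size s)%:R%:E <= c)%E) ->
  (@counting T R Z <= c)%E.
Proof.
move=> H; rewrite /counting; case: ifPn => [/asboolP fZ|/asboolP iZ].
  apply: H; first exact: finmap.fset_uniq.
  by move=> z; rewrite [z \in _](in_fset_set fZ z) inE.
case: c H => [c| |] H.
- have [B BZ] := infinite_set_fset (Num.trunc c).+1 iZ.
  move=> sB; have := H _ (finmap.fset_uniq B) BZ.
  rewrite lee_fin leNgt (lt_le_trans (truncnS_gt c))// ler_nat//.
- exact: leey.
- by have := H [::] isT (fun z => ltac:(by rewrite in_nil)).
Qed.

End Counting.

(** * Measurability of the number of zeros, and a deterministic bound *)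

Section MeasurableZeros.
Context {R : realType} {d : measure_display} {T : measurableType d}.
Variable F : T -> R -> R.
Hypothesis mF : forall t, measurable_fun setT (F^~ t).
Hypothesis cF : forall w, continuous (F w).

(** By continuity and compactness, a zero exists in the segment exactly when, for every [p], some
    point of some regular subdivision has [|F| < 1/(p+1)]; this is a countable condition on values
    at fixed times. *)
Lemma measurable_zero_segment (c e : R) : c <= e ->
  measurable [set w | exists t, c <= t <= e /\ F w t = 0].
Proof.
move=> ce.
pose g (N i : nat) : R := c + (e - c) * (i%:R / N.+1%:R).
have -> : [set w | exists t, c <= t <= e /\ F w t = 0] =
   \bigcap_(p in setT) \bigcup_(N in setT) \bigcup_(i in [set i | (i <= N.+1)%N])
     (setT `&` (fun w => `|F w (g N i)|) @^-1` `]-oo, p.+1%:R^-1[).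
  apply/seteqP; split => w.
    move=> [t [/andP[ct te] Ft]] p _.
    have /cvgrPdist_lt/(_ p.+1%:R^-1 (ltac:(by [])))[del /= del0 Hd] := @cF w t.
    have [ec|ec] := eqVneq e c.
      exists 0%N => //; exists 0%N => //; split=> //=; rewrite in_itv/=.
      have -> : g 0%N 0%N = t by rewrite /g ec subrr mul0r addr0; apply/eqP; rewrite eq_le ct -{1}ec te.
      by rewrite Ft normr0.
    have ec0 : 0 < e - c by rewrite subr_gt0 lt_neqAle eq_sym ec.
    pose N := Num.trunc ((e - c) / del).
    have hN : (e - c) / N.+1%:R < del.
      rewrite ltr_pdivrMr// mulrC -ltr_pdivrMr//; exact: truncnS_gt.
    pose y := (t - c) / (e - c) * N.+1%:R.
    have y0 : 0 <= y by rewrite mulr_ge0// divr_ge0 ?subr_ge0// ltW.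
    exists N => //; exists (Num.trunc y).
      rewrite /= -(ler_nat R) (@le_trans _ _ y) ?truncn_le//.
      by rewrite /y ler_piMl// ler_pdivrMr// mul1r lerD2r.
    split=> //=; rewrite in_itv/=.
    have := Hd (g N (Num.trunc y)); rewrite Ft sub0r normrN; apply.
    rewrite /ball_ /=.
    have /andP[h1 h2] := truncn_itv y0.
    have -> : t - g N (Num.trunc y) = (e - c) / N.+1%:R * (y - (Num.trunc y)%:R).
      rewrite {1}/g [in RHS]/y; move: (Num.trunc y)%:R => Y.
      have : N.+1%:R != 0 :> R by rewrite pnatr_eq0.
      by move: N.+1%:R => M M0; field; rewrite M0 gt_eqF.
    have q0 : 0 < (e - c) / N.+1%:R by rewrite divr_gt0.
    rewrite ger0_norm; last by rewrite mulr_ge0 ?subr_ge0// ltW.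
    apply: le_lt_trans hN; rewrite ler_piMr ?(ltW q0)//.
    by rewrite lerBlDl -(natr1 (Num.trunc y)) in h2 *; rewrite ltW.
  move=> H; have [t + tmin] : exists2 t, t \in `[c, e]%R & forall u, u \in `[c, e]%R -> `|F w t| <= `|F w u|.
    apply: EVT_min => //; apply: continuous_subspaceT => u.
    by apply: (@cvg_comp _ _ _ (F w) Num.norm); [exact: cF|exact: norm_continuous].
  rewrite in_itv/= => cte; exists t; split=> //.
  apply/eqP; rewrite -normr_le0; apply/ler_addgt0Pl => del del0; rewrite addr0.
  pose p := Num.trunc del^-1.
  have hp : p.+1%:R^-1 < del.
    by rewrite -[ltRHS]invrK ltf_pV2 ?posrE ?invr_gt0// truncnS_gt.
  have [N _ [i iN [_ /=]]] := H p I; rewrite in_itv/= => hi.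
  apply: (le_trans (tmin (g N i) _)); last by rewrite ltW// (lt_trans hi).
  have i0 : 0 <= i%:R / N.+1%:R :> R by rewrite divr_ge0.
  have i1 : i%:R / N.+1%:R <= 1 :> R by rewrite ler_pdivrMr// mul1r ler_nat.
  rewrite in_itv/= /g; move: i0 i1; move: (i%:R / N.+1%:R) => q q0 q1.
  by apply/andP; split; nra.
apply: bigcap_measurable => [|p _]; first by exists 0%N.
apply: bigcup_measurable => N _; apply: bigcup_measurable => i _.
apply: measurableT_comp => //; exact: measurableT_comp.
Qed.

(** A half-open cell is a countable union of segments. *)
Lemma measurable_zero_cell (c e v : R) :
  measurable [set w | exists t, [/\ c <= t, t < e, t <= v & F w t = 0]].
Proof.
have -> : [set w | exists t, [/\ c <= t, t < e, t <= v & F w t = 0]] =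
  \bigcup_(m in [set m : nat | c <= Num.min v (e - m.+1%:R^-1)])
    [set w | exists t, c <= t <= Num.min v (e - m.+1%:R^-1) /\ F w t = 0].
  apply/seteqP; split => w.
    move=> [t [ct te tv Ft]].
    pose m := Num.trunc (e - t)^-1.
    have hm : m.+1%:R^-1 < e - t.
      by rewrite -[ltRHS]invrK ltf_pV2 ?posrE ?invr_gt0 ?subr_gt0// truncnS_gt.
    have h : t <= Num.min v (e - m.+1%:R^-1) by rewrite le_min tv/= lerBrDr -lerBrDl ltW.
    exists m; first exact: le_trans h.
    by exists t; rewrite ct h.
  move=> [m _ [t [/andP[ct]]]]; rewrite le_min => /andP[tv te] Ft.
  exists t; split=> //; apply: (le_lt_trans te); rewrite ltrBlDr ltrDl//.
by apply: bigcup_measurable => m /= cm; exact: measurable_zero_segment.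
Qed.

(** The event that the [j]-th cell of mesh [1/(k+1)] contains a zero. The cells are disjoint, so
    that no zero is counted twice. *)
Let hit (u v : R) (k j : nat) : set T :=
  [set w | exists t, [/\ u + j%:R / k.+1%:R <= t, t < u + j.+1%:R / k.+1%:R,
     t <= v & F w t = 0]].

Let ncells (u v : R) (k : nat) : nat := (k.+1 * (Num.trunc (v - u)).+1)%N.

Let hits u v k (w : T) : R := \sum_(j <- iota 0 (ncells u v k)) \1_(hit u v k j) w.

Let hitsE u v k w : hits u v k w =
  (size (seq.filter (fun j => `[< hit u v k j w >]) (iota 0 (ncells u v k))))%:R.
Proof.
rewrite /hits; elim: (iota _ _) => [|j l IH]; first by rewrite big_nil.
rewrite big_cons IH /= indicE; case: ifPn => [/asboolP h|/asboolP h].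
  by rewrite mem_set//= -[RHS]natr1 addrC.
by rewrite memNset//= add0r.
Qed.

Let separation (s : seq R) : exists2 del : R, 0 < del &
  forall x y, x \in s -> y \in s -> `|x - y| < del -> x = y.
Proof.
elim: s => [|z s [del d0 Hd]]; first by exists 1.
have [e e0 He] : exists2 e : R, 0 < e & forall y, y \in s -> `|z - y| < e -> z = y.
  elim: s {Hd} => [|a s [e e0 He]]; first by exists 1.
  have [za|za] := eqVneq z a.
    by exists e => // y; rewrite inE => /predU1P[->//|/He].
  exists (Num.min e `|z - a|); first by rewrite lt_min e0 normr_gt0 subr_eq0.
  move=> y; rewrite inE lt_min => /predU1P[->|/He H /andP[/H//]].
  by rewrite ltxx andbF.
exists (Num.min del e); first by rewrite lt_min d0.
move=> x y; rewrite !inE lt_min => /predU1P[->|xs] /predU1P[->|ys] /andP[h1 h2] //.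
- exact: He.
- by apply/esym/He => //; rewrite distrC.
- exact: Hd.
Qed.

(** The zeros of a finite list fall in distinct cells once the mesh is finer than their separation;
    conversely, one zero can be chosen in each cell that is hit. *)
Let num_zeros_sup u v w :
  num_zeros (F w) u v = esups (fun k => (hits u v k w)%:E) 0.
Proof.
rewrite /esups /num_zeros; apply/eqP; rewrite eq_le; apply/andP; split.
  apply: counting_le => s us Hs.
  have [del d0 Hd] := separation s.
  pose k := Num.trunc del^-1.
  have hk : k.+1%:R^-1 < del.
    by rewrite -[ltRHS]invrK ltf_pV2 ?posrE ?invr_gt0// truncnS_gt.
  pose J z := Num.trunc ((z - u) * k.+1%:R).
  have Jitv z : z \in s -> u + (J z)%:R / k.+1%:R <= z < u + (J z).+1%:R / k.+1%:R.
    move=> /Hs[/andP[uz _] _].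
    have /truncn_itv/andP[h1 h2] : 0 <= (z - u) * k.+1%:R by rewrite mulr_ge0// subr_ge0.
    by rewrite -lerBrDl -ltrBlDl ler_pdivrMr// ltr_pdivlMr// h1 h2.
  apply: (@le_trans _ _ (hits u v k w)%:E); last by apply: ereal_sup_ubound; exists k.
  rewrite lee_fin hitsE ler_nat -(size_map J); apply: uniq_leq_size.
    rewrite map_inj_in_uniq// => x y xs ys Jxy; apply: Hd => //.
    have := Jitv x xs; have := Jitv y ys; rewrite Jxy -(natr1 (J y)) mulrDl mul1r.
    move: hk; move: (k.+1%:R^-1) => r; move: ((J y)%:R * r) => q hr /andP[a1 a2] /andP[a3 a4].
    by rewrite ltr_norml; apply/andP; split; lra.
  move=> j /mapP[z zs ->]; have [/andP[uz zv] Fz] := Hs z zs.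
  rewrite mem_filter mem_iota leq0n add0n /=; apply/andP; split.
    by apply/asboolP; exists z; have /andP[-> ->] := Jitv z zs.
  rewrite -(ltr_nat R) (@le_lt_trans _ _ ((z - u) * k.+1%:R))//.
    by rewrite truncn_le mulr_ge0// subr_ge0.
  rewrite /ncells natrM mulrC ltr_pM2l//.
  by apply: le_lt_trans (truncnS_gt _); rewrite lerD2r.
apply: ge_ereal_sup => _ [k _ <-]; rewrite hitsE.
set js := seq.filter _ _.
have ujs : uniq js by rewrite filter_uniq// iota_uniq.
have /choice[f fP] : forall j, exists z, j \in js ->
    [/\ u + j%:R / k.+1%:R <= z, z < u + j.+1%:R / k.+1%:R, z <= v & F w z = 0].
  move=> j; have [|] := boolP (j \in js); last by exists 0.
  by rewrite mem_filter => /andP[/asboolP[z hz] _]; exists z.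
rewrite -(size_map f); apply: counting_ge; last first.
  move=> _ /mapP[j /fP[a1 a2 a3 a4] ->]; split=> //; rewrite a3 andbT.
  by apply: le_trans a1; rewrite lerDl divr_ge0.
rewrite map_inj_in_uniq// => i j /fP[i1 i2 _ _] /fP[j1 j2 _ _] fij.
rewrite fij in i1 i2.
have := le_lt_trans i1 j2; have := le_lt_trans j1 i2.
rewrite !ltrD2l !ltr_pM2r ?invr_gt0// !ltr_nat !ltnS => a b.
by apply/eqP; rewrite eqn_leq a b.
Qed.

Lemma measurable_num_zeros u v : measurable_fun setT (fun w => num_zeros (F w) u v).
Proof.
rewrite (_ : (fun w => _) = (fun w => esups (fun k => (hits u v k w)%:E) 0)); last first.
  by apply/funext => w; rewrite num_zeros_sup.
apply: measurable_fun_esups => k.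
apply/measurable_EFinP; apply: measurable_sum => j.
by apply: measurable_indic; exact: measurable_zero_cell.
Qed.

End MeasurableZeros.

(** * Roots of a trigonometric sum *)

Section RootBound.
Context {R : realType}.
Implicit Types (a b : nat -> R) (t : R).
Import complex.
Local Open Scope complex_scope.

Definition trig_sum a b (n : nat) t : R :=
  \sum_(1 <= k < n.+1) (a k * cos (k%:R * t) + b k * sin (k%:R * t)).

Definition cis t : R[i] := (cos t) +i* (sin t).

Lemma cisX t k : cis t ^+ k = cis (k%:R * t).
Proof.
elim: k => [|k IH]; first by rewrite expr0 /cis mul0r cos0 sin0.
rewrite exprS IH -natr1 mulrDl mul1r addrC /cis cosD sinD.
by apply/eqP; rewrite eq_complex /=; apply/andP; split; apply/eqP; ring.
Qed.

Lemma cisN t : cis t * cis (- t) = 1.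
Proof.
apply/eqP; rewrite /cis cosN sinN eq_complex /=; apply/andP; split; apply/eqP.
  by rewrite mulrN opprK -!expr2 cos2Dsin2.
by ring.
Qed.

(** Equal points give [cos (u - t) = 1], hence [sin ((u - t) / 2) = 0], whereas the sine is positive
    on []0, pi[]. *)
Lemma cis_inj t u : 0 <= t < 2 * pi -> 0 <= u < 2 * pi -> cis t = cis u -> t = u.
Proof.
wlog tu : t u / t <= u.
  move=> H t2 u2 e; have [tu|/ltW ut] := leP t u; first exact: H.
  by apply/esym; apply: H.
move=> /andP[t0 _] /andP[_ u2] [ec es].
have c1 : cos (u - t) = 1 by rewrite cosB ec es -!expr2 cos2Dsin2.
have s0 : sin ((u - t) / 2) = 0.
  apply/eqP; rewrite -sqrf_eq0 sin2cos2 subr_eq0 eq_sym; apply/eqP.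
  have := cos_mulr2n ((u - t) / 2).
  have -> : (u - t) / 2 *+ 2 = u - t by rewrite mulr2n; lra.
  by rewrite c1 mulr2n; move: (cos _ ^+ 2) => z; lra.
apply/eqP; rewrite eq_le tu /= leNgt; apply/negP => tu'.
have := @sin_gt0_pi R ((u - t) / 2); rewrite s0 ltxx => H.
suff : false by []; apply: H; apply/andP; split; lra.
Qed.

(** Multiplied by [2 cis t ^+ n], the trigonometric sum becomes an ordinary polynomial in [cis t] of
    degree at most [2 n]. *)
Definition trig_poly_C a b n : {poly R[i]} :=
  \sum_(1 <= k < n.+1) ((a k -i* b k) *: 'X^(n + k) + (a k +i* b k) *: 'X^(n - k)).

Lemma size_trig_poly_C a b n : (size (trig_poly_C a b n) <= (2 * n).+1)%N.
Proof.
rewrite /trig_poly_C big_nat (leq_trans (size_sum _ _ _))//.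
apply/bigmax_leqP_seq => k _ /andP[_ kn].
rewrite (leq_trans (size_polyD _ _))// geq_max; apply/andP; split;
  rewrite (leq_trans (size_scale_leq _ _))// size_polyXn ltnS; lia.
Qed.

(** Only the term [k = 1] contributes to degree [n + 1], and the real part of its coefficient is
    [a 1]. *)
Lemma trig_poly_C_neq0 a b n : (0 < n)%N -> a 1%N != 0 -> trig_poly_C a b n != 0.
Proof.
move=> n0 a1; apply: contraNneq a1 => /(congr1 (fun p : {poly R[i]} => p`_n.+1)).
rewrite coef0 /trig_poly_C coef_sum big_ltn// big1_seq ?addr0.
  rewrite coefD !coefZ !coefXn addn1 eqxx mulr1 gtn_eqF ?mulr0 ?addr0.
    by move=> /eqP; rewrite eq_complex /= => /andP[].
  by rewrite ltnS leq_subr.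
move=> k /andP[_]; rewrite mem_index_iota => /andP[k2 kn].
have e1 : (n.+1 == n + k)%N = false by clear -k2; apply/eqP; lia.
have e2 : (n.+1 == n - k)%N = false by clear -k2; apply/eqP; lia.
by rewrite coefD !coefZ !coefXn e1 e2 !mulr0 addr0.
Qed.

Lemma horner_trig_poly_C a b n t :
  (trig_poly_C a b n).[cis t] = cis t ^+ n * (2 * trig_sum a b n t)%:C.
Proof.
rewrite /trig_poly_C horner_sum /trig_sum mulr_sumr rmorph_sum/= mulr_sumr.
apply: eq_big_nat => k /andP[_ kn].
rewrite hornerD !hornerZ !hornerXn.
have -> : cis t ^+ (n + k) = cis t ^+ n * cis (k%:R * t) by rewrite exprD (cisX t k).
have -> : cis t ^+ (n - k) = cis t ^+ n * cis (- (k%:R * t)).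
  have kn' : (k <= n)%N by [].
  by rewrite -[in RHS](subnK kn') exprD -mulrA (cisX t k) cisN mulr1.
rewrite mulrCA [X in _ + X]mulrCA -mulrDr; congr (_ * _).
rewrite /cis cosN sinN.
by apply/eqP; rewrite eq_complex /=; apply/andP; split; apply/eqP; ring.
Qed.

(** Zeros in [[0, 2 pi[] give as many roots of a nonzero polynomial of degree at most [2 n]; the
    endpoint [2 pi] may add one. *)
Lemma trig_sum_zeros a b (n : nat) (s : seq R) : (0 < n)%N -> a 1%N != 0 ->
  uniq s -> (forall z, z \in s -> 0 <= z <= 2 * pi /\ trig_sum a b n z = 0) ->
  (size s <= 2 * n + 1)%N.
Proof.
move=> n0 a1 us Hs; pose lt2pi (z : R) := z < 2 * pi.
rewrite -(count_predC lt2pi s) leq_add//.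
  rewrite -size_filter -(size_map cis); set r := map _ _.
  rewrite -ltnS (leq_trans _ (size_trig_poly_C a b n))//.
  apply: max_poly_roots; first exact: trig_poly_C_neq0.
    apply/allP => y /mapP[z zs ->]; move: zs; rewrite mem_filter => /andP[_ /Hs[_ z0]].
    by rewrite rootE horner_trig_poly_C z0 mulr0 mulr0.
  rewrite map_inj_in_uniq ?filter_uniq// => x y.
  rewrite !mem_filter /lt2pi => /andP[x2 /Hs[/andP[x0 _] _]] /andP[y2 /Hs[/andP[y0 _] _]].
  by apply: cis_inj; rewrite ?x0 ?y0.
rewrite -size_filter; set s' := seq.filter _ _.
apply: (@uniq_leq_size _ s' [:: 2 * pi]); first exact: filter_uniq.
move=> z; rewrite mem_filter /= /lt2pi -leNgt => /andP[h /Hs[/andP[_ h'] _]].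
by rewrite inE eq_le h h'.
Qed.

End RootBound.

Import HBSimple HBNNSimple.
(** * Gaussian laws and independence through characteristic functions *)

Section Density.
Context {R : realType} {d : measure_display} {T : measurableType d}.
Implicit Types (mu nu : {measure set T -> \bar R}).
Local Open Scope ereal_scope.

Lemma density_measure mu (f : T -> R) : measurable_fun setT f ->
  (forall x, (0 <= f x)%R) ->
  exists nu : {measure set T -> \bar R},
    forall A, measurable A -> nu A = \int[mu]_(x in A) (f x)%:E.
Proof.
move=> mf f0.
pose nu A := \int[mu]_(x in A) (f x)%:E.
have nu0 : nu set0 = 0 by rewrite /nu integral_set0.
have nu_ge0 A : 0 <= nu A by apply: integral_ge0 => x _; rewrite lee_fin.
have nu_add : semi_sigma_additive nu.
  move=> /= A mA tA mUA; rewrite /nu/= ge0_integral_bigcup//.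
  - apply: is_cvg_ereal_nneg_natsum_cond => n _ _; exact: nu_ge0.
  - exact/measurable_funTS/measurable_EFinP.
  - by move=> x _; rewrite lee_fin.
pose M : {measure set T -> \bar R} := HB.pack nu (isMeasure.Build _ _ _ nu nu0 nu_ge0 nu_add).
by exists M.
Qed.

(** The formula for [nu] settles simple functions; monotone convergence extends it to [g]. *)
Lemma ge0_integral_density mu nu (f : T -> R) (g : T -> \bar R) :
  measurable_fun setT f -> (forall x, (0 <= f x)%R) ->
  (forall A, measurable A -> nu A = \int[mu]_(x in A) (f x)%:E) ->
  measurable_fun setT g -> (forall x, 0 <= g x) ->
  \int[nu]_x g x = \int[mu]_x (g x * (f x)%:E).
Proof.
move=> mf f0 nuE mg g0.
pose h := nnsfun_approx measurableT mg.
have hcv x : (h n x)%:E @[n --> \oo] --> g x by apply: cvg_nnsfun_approx.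
have hnd x : {homo (fun n => (h n x)%:E) : n m / (n <= m)%N >-> n <= m}.
  move=> n m nm; rewrite lee_fin; exact/lefP/nd_nnsfun_approx.
have mh n : measurable_fun setT (fun x => (h n x)%:E) by exact/measurable_EFinP.
have -> : \int[nu]_x g x = \int[nu]_x limn (fun n => (h n x)%:E).
  by apply: eq_integral => x _; apply/esym/cvg_lim.
have -> : \int[mu]_x (g x * (f x)%:E) = \int[mu]_x limn (fun n => (h n x)%:E * (f x)%:E).
  apply: eq_integral => x _; apply/esym/cvg_lim => //.
  by apply: cvgeZr => //; exact: hcv.
have mfE : measurable_fun setT (fun x => (f x)%:E) by exact/measurable_EFinP.
rewrite monotone_convergence//; last by move=> n x _; rewrite lee_fin.
rewrite monotone_convergence//; first last.
- by move=> x _ n m nm; rewrite lee_wpmul2r// ?lee_fin//; exact: hnd.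
- by move=> n x _; rewrite mule_ge0// lee_fin.
- by move=> n; apply: emeasurable_funM.
congr (limn _); apply/funext => n.
rewrite integralT_nnsfun sintegralE.
under eq_integral => x _.
  rewrite fimfunE -fsumEFin//= ge0_mule_fsuml; last first.
    by move=> y; rewrite EFinM; exact: nnfun_muleindic_ge0.
  over.
rewrite ge0_integral_fsum//; first last.
- move=> r x _; apply: mule_ge0; last by rewrite lee_fin.
  by rewrite EFinM; exact: nnfun_muleindic_ge0.
- move=> r; apply: emeasurable_funM => //.
  by apply/measurable_EFinP/measurable_funM => //; exact: measurable_indic.
apply: eq_fsbigr => r rin.
have r0 : (0 <= r)%R by move: rin; rewrite inE/= => -[x _ <-].
under eq_integral do rewrite EFinM -muleA.
rewrite ge0_integralZl//; first last.
- by move=> x _; rewrite mule_ge0 ?lee_fin//.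
- by apply: emeasurable_funM => //; apply/measurable_EFinP; exact: measurable_indic.
congr (_ * _); rewrite nuE// [LHS]integral_mkcond; apply: eq_integral => x _.
by rewrite patchE indicE; case: ifPn => _; rewrite ?mul1e ?mul0e.
Qed.

End Density.

Section Bounded.
Context {R : realType} {d : measure_display} {T : measurableType d}.
Variable P : probability T R.
Implicit Types f g : T -> R.

(** A class stable under sums and products and integrable for every finite measure, so that
    integrability goals reduce to closure properties. *)
Definition bounded_meas f := measurable_fun setT f /\ exists M, forall x, `|f x| <= M.

Lemma bm_integrable f : bounded_meas f -> P.-integrable setT (EFin \o f).
Proof.
move=> [mf [M fM]]; apply: measurable_bounded_integrable => //.
  by rewrite (le_lt_trans (probability_le1 _ _))// ltry.
exists M; split; first exact: num_real.
by move=> y My x _; exact: le_trans (fM x) (ltW My).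
Qed.

Lemma bm_cst (c : R) : bounded_meas (cst c).
Proof. by split; [exact: measurable_cst|exists `|c|]. Qed.

Lemma bmD f g : bounded_meas f -> bounded_meas g -> bounded_meas (fun x => f x + g x).
Proof.
move=> [mf [M fM]] [mg [N gN]]; split; first exact: measurable_funD.
by exists (M + N) => x; rewrite (le_trans (ler_normD _ _))// lerD.
Qed.

Lemma bmM f g : bounded_meas f -> bounded_meas g -> bounded_meas (fun x => f x * g x).
Proof.
move=> [mf [M fM]] [mg [N gN]]; split; first exact: measurable_funM.
by exists (M * N) => x; rewrite normrM ler_pM.
Qed.

Lemma bm_indic (A : set T) : measurable A -> bounded_meas (\1_A).
Proof.
move=> mA; split; first exact: measurable_indic.
by exists 1 => x; rewrite indicE; case: (x \in A); rewrite /= ?normr1 ?normr0.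
Qed.

Lemma bm_cos (h : T -> R) : measurable_fun setT h -> bounded_meas (fun x => cos (h x)).
Proof.
move=> mh; split; last by exists 1 => x; exact: cos_max.
by apply: measurableT_comp => //; apply: continuous_measurable_fun; exact: continuous_cos.
Qed.

Lemma bm_sin (h : T -> R) : measurable_fun setT h -> bounded_meas (fun x => sin (h x)).
Proof.
move=> mh; split; last by exists 1 => x; exact: sin_max.
by apply: measurableT_comp => //; apply: continuous_measurable_fun; exact: continuous_sin.
Qed.

End Bounded.

Section IntegralDerivative.
Context {R : realType}.
Local Notation mu := (@lebesgue_measure R).

(** The fundamental theorem of calculus on growing symmetric intervals, then dominated
    convergence. *)
Lemma integral_derive_eq0 (h dh : R -> R) :
  (forall x : R, is_derive x 1 h (dh x)) -> continuous dh ->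
  mu.-integrable setT (EFin \o dh) ->
  h n%:R @[n --> \oo] --> (0 : R) -> h (- n%:R) @[n --> \oo] --> (0 : R) ->
  (\int[mu]_x (dh x)%:E = 0)%E.
Proof.
move=> dhd cdh idh hp hn.
have ch := continuous_derivable dhd.
pose J (n : nat) : set R := `[- n.+1%:R, n.+1%:R]%classic.
have FTC n : (\int[mu]_(x in J n) (dh x)%:E = (h n.+1%:R)%:E - (h (- n.+1%:R))%:E)%E.
  apply: continuous_FTC2.
  - by rewrite gtrN.
  - exact: continuous_subspaceT.
  - split.
    + by move=> x _; exact: ex_derive.
    + exact: cvg_at_right_filter (ch _).
    + exact: cvg_at_left_filter (ch _).
  - by move=> x _; rewrite derive1E; have [_ ->] := dhd x.
have DCT : (\int[mu]_x ((EFin \o dh) \_ (J n)) x @[n --> \oo] --> \int[mu]_x (dh x)%:E)%E.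
  have [] := @dominated_convergence _ _ _ mu setT measurableT
    (fun n => (EFin \o dh) \_ (J n)) (EFin \o dh) (abse \o (EFin \o dh)) => //.
  - move=> n; apply/measurable_restrict => //; first exact: measurable_itv.
    by apply: (measurable_funS measurableT) => //; exact: measurable_int idh.
  - exact: measurable_int idh.
  - apply: aeW => x _; apply: cvg_near_cst; exists (Num.trunc `|x|) => // n /= nx.
    have hx : `|x| <= n.+1%:R by rewrite ltW// (lt_le_trans (truncnS_gt _))// ler_nat.
    by rewrite patchE mem_set//= /J/= in_itv/= -ler_norml.
  - exact: integrable_abse.
  - apply: aeW => x n _; rewrite patchE; case: ifPn => //= _; by rewrite lee_fin normr0.
have {}DCT : ((h n.+1%:R - h (- n.+1%:R))%:E @[n --> \oo] --> \int[mu]_x (dh x)%:E)%E.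
  by under eq_fun do rewrite EFinB -FTC integral_mkcond.
have lim0 : ((h n.+1%:R - h (- n.+1%:R))%:E @[n --> \oo] --> 0%:E)%E.
  apply: cvg_EFin; first by exists 0%N.
  rewrite /=(_ : fine \o _ = (fun n => h n.+1%:R - h (- n.+1%:R)))//.
  rewrite (@cvg_shiftS _ (fun n => h n%:R - h (- n%:R))).
  by have := cvgB hp hn; rewrite subr0; apply.
exact: cvg_unique DCT lim0.
Qed.

End IntegralDerivative.

(** * Standard normal law and Stein's identity *)

Section StdGauss.
Context {R : realType}.
Local Notation mu := (@lebesgue_measure R).
Implicit Types (x y : R).

Definition gam : probability (measurableTypeR R) R := normal_prob (0 : R) (1 : R).
Definition gpdf (x : R) : R := normal_pdf 0 1 x.

Lemma gpdfE x : gpdf x = (Num.sqrt (2 * pi))^-1 * expR (- (x ^+ 2) / 2).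
Proof.
rewrite /gpdf normal_pdfE ?oner_eq0// /normal_peak /normal_fun.
by rewrite expr1n mul1r subr0 -(mulr_natl pi 2).
Qed.

Lemma gpdf_ge0 x : 0 <= gpdf x.
Proof. exact: normal_pdf_ge0. Qed.

Lemma gpdfN x : gpdf (- x) = gpdf x.
Proof. by rewrite !gpdfE sqrrN. Qed.

Lemma measurable_gpdf : measurable_fun setT gpdf.
Proof. exact: measurable_normal_pdf. Qed.

Lemma is_derive_gpdf x : is_derive x 1 gpdf (- x * gpdf x).
Proof.
rewrite (_ : gpdf = fun x => (Num.sqrt (2 * pi))^-1 * expR (- (x ^+ 2) / 2)); last first.
  by apply/funext => y; rewrite gpdfE.
apply: is_derive_eq; rewrite /GRing.scale/=; move: (Num.sqrt _)^-1 => c; by field.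
Qed.

Lemma continuous_gpdf : continuous gpdf.
Proof. exact: continuous_derivable is_derive_gpdf. Qed.

Lemma ge0_integral_gam (f : R -> \bar R) : measurable_fun setT f ->
  (forall x, (0 <= f x)%E) ->
  (\int[gam]_x f x = \int[mu]_x (f x * (gpdf x)%:E))%E.
Proof.
move=> mf f0; apply: ge0_integral_density => //.
- exact: measurable_gpdf.
- exact: gpdf_ge0.
Qed.

(* x^2 <= 4 exp(x^2/4), which leaves a Gaussian of variance 2. *)
Lemma sqr_gpdf_le x : x ^+ 2 * gpdf x <= 4 * Num.sqrt 2 * normal_pdf 0 (Num.sqrt 2) x.
Proof.
have s2 : Num.sqrt 2 != 0 :> R by rewrite sqrtr_eq0 -ltNge.
rewrite gpdfE normal_pdfE// /normal_peak /normal_fun subr0 sqr_sqrtr//.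
have -> : (Num.sqrt (2 * pi *+ 2))^-1 = (Num.sqrt 2)^-1 * (Num.sqrt (2 * pi))^-1 :> R.
  by rewrite -mulr_natl sqrtrM// invfM.
have -> : 2 *+ 2 = 4 :> R by rewrite mulr2n; lra.
have e1 : expR (- x ^+ 2 / 2) = expR (- x ^+ 2 / 4) * expR (- x ^+ 2 / 4).
  by rewrite -expRD; congr expR; lra.
have e2 : x ^+ 2 / 4 * expR (- x ^+ 2 / 4) <= 1.
  rewrite mulNr expRN ler_pdivrMr ?expR_gt0// mul1r.
  by rewrite (le_trans _ (expR_ge1Dx _))// lerDr.
have p0 : 0 <= (Num.sqrt (2 * pi))^-1 :> R by rewrite invr_ge0 sqrtr_ge0.
have g0 : 0 <= expR (- x ^+ 2 / 4) by exact: expR_ge0.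
have -> : 4 * Num.sqrt 2 * ((Num.sqrt 2)^-1 * (Num.sqrt (2 * pi))^-1 * expR (- x ^+ 2 / 4)) =
   4 * ((Num.sqrt (2 * pi))^-1 * expR (- x ^+ 2 / 4)).
  by rewrite -!mulrA; congr (_ * _); rewrite !mulrA divff// mul1r.
rewrite e1; move: e2 p0 g0; move: (expR (- x ^+ 2 / 4)) => E.
move: ((Num.sqrt (2 * pi))^-1) => p; move: (x ^+ 2) => X e2 p0 E0.
have : 0 <= p * E * (4 - X * E) by rewrite mulr_ge0 ?mulr_ge0//; lra.
lra.
Qed.

Lemma integrable_lambda_sqr_gpdf : mu.-integrable setT (fun x => (x ^+ 2 * gpdf x)%:E).
Proof.
have i2 := @integrable_normal_pdf R 0 (Num.sqrt 2).
apply: (le_integrable measurableT _ _ (integrableZl measurableT (4 * Num.sqrt 2) i2)).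
  apply/measurable_EFinP/measurable_funM; last exact: measurable_gpdf.
  exact: measurable_funX.
move=> x _ /=; rewrite lee_fin !ger0_norm ?sqr_gpdf_le//.
  by rewrite (le_trans _ (sqr_gpdf_le x))// mulr_ge0 ?sqr_ge0// gpdf_ge0.
by rewrite mulr_ge0 ?sqr_ge0// gpdf_ge0.
Qed.

Lemma integrable_lambda_gpdf : mu.-integrable setT (fun x => (gpdf x)%:E).
Proof. exact: integrable_normal_pdf. Qed.

Lemma le_poly_gpdf (h : R -> R) (C : R) : measurable_fun setT h ->
  (forall x, `|h x| <= C * (1 + x ^+ 2)) ->
  mu.-integrable setT (fun x => (h x * gpdf x)%:E).
Proof.
move=> mh hC.
have i := integrableZl measurableT C (integrableD measurableT integrable_lambda_gpdf integrable_lambda_sqr_gpdf).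
apply: (le_integrable measurableT _ _ i).
  by apply/measurable_EFinP/measurable_funM => //; exact: measurable_gpdf.
move=> x _ /=; rewrite lee_fin normrM (ger0_norm (gpdf_ge0 x)).
have -> : C * (gpdf x + x ^+ 2 * gpdf x) = C * (1 + x ^+ 2) * gpdf x by ring.
by rewrite [leRHS]ger0_norm ?ler_wpM2r ?gpdf_ge0// mulr_ge0 ?gpdf_ge0// (le_trans _ (hC x)).
Qed.

(** Against linear growth, [exp (- x^2 / 2) <= 2 / x^2] leaves a multiple of [1 / x]. *)
Lemma gpdf_cvg0 (h : R -> R) (C : R) : (forall x, `|h x| <= C * (1 + `|x|)) ->
  h n%:R * gpdf n%:R @[n --> \oo] --> (0 : R).
Proof.
move=> hC.
have C0 : 0 <= C by rewrite -(mulr1 C) (le_trans _ (le_trans (hC 0) _))// normr0 addr0.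
pose p : R := (Num.sqrt (2 * pi))^-1.
have p0 : 0 <= p by rewrite invr_ge0 sqrtr_ge0.
have bd n : `|h n.+1%:R * gpdf n.+1%:R| <= 4 * C * p * n.+1%:R^-1.
  rewrite normrM (ger0_norm (gpdf_ge0 _)) gpdfE -/p.
  have N1 : 1 <= n.+1%:R :> R by rewrite ler1n.
  have := hC n.+1%:R; rewrite [in `|n.+1%:R|]ger0_norm//.
  move: N1; move: n.+1%:R => N N1 hN.
  have N0 : 0 < N by lra.
  have e : expR (- N ^+ 2 / 2) <= 2 / N ^+ 2.
    rewrite mulNr expRN -[leRHS]invrK lef_pV2 ?posrE ?expR_gt0 ?invr_gt0 ?divr_gt0 ?exprn_gt0//.
    by rewrite invf_div (le_trans _ (expR_ge1Dx _))// lerDr.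
  have h2 : `|h N| <= 2 * C * N by move: hN C0; nra.
  apply: (@le_trans _ _ (2 * C * N * (p * (2 / N ^+ 2)))).
    by rewrite ler_pM// ?mulr_ge0 ?expR_ge0// ler_wpM2l.
  by rewrite le_eqVlt; apply/orP; left; apply/eqP; field; lra.
have cv : 4 * C * p * n.+1%:R^-1 @[n --> \oo] --> (0 : R).
  rewrite -[X in _ --> X](mulr0 (4 * C * p)); apply: cvgM; first exact: cvg_cst.
  exact: cvg_harmonic.
rewrite -(@cvg_shiftS _ (fun n => h n%:R * gpdf n%:R)).
apply/cvgr0Pnorm_lt => e e0.
have /cvgr0Pnorm_lt/(_ e e0) := cv.
apply: filterS => n; apply: le_lt_trans => /=.
by apply: (le_trans (bd n)); exact: ler_norm.
Qed.

(** The integrand is the derivative of [f x * gpdf x], which vanishes at infinity: Gaussian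
    integration by parts. *)
Lemma integral_gam_stein (f df : R -> R) (C : R) : (forall x : R, is_derive x 1 f (df x)) ->
  continuous df -> (forall x, `|f x| <= C * (1 + `|x|)) -> (forall x, `|df x| <= C) ->
  (\int[mu]_x ((df x - x * f x) * gpdf x)%:E = 0)%E.
Proof.
move=> dfd cdf fC dfC.
have cf := continuous_derivable dfd.
have C0 : 0 <= C by rewrite (le_trans _ (dfC 0)).
have E x : (df x - x * f x) * gpdf x = df x * gpdf x + f x * (- x * gpdf x) by ring.
under eq_integral do rewrite E.
apply: (@integral_derive_eq0 R (fun x => f x * gpdf x)).
- move=> x; have ? := dfd x; have ? := is_derive_gpdf x.
  by apply: is_derive_eq; rewrite /GRing.scale/=; ring.
- move=> x; apply: cvgD.
    by apply: cvgM; [exact: cdf|exact: continuous_gpdf].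
  apply: cvgM; first exact: cf.
  apply: cvgM; last exact: continuous_gpdf.
  by apply: cvgN; exact: cvg_id.
- rewrite (_ : EFin \o _ = fun x => ((df x - x * f x) * gpdf x)%:E); last first.
    by apply/funext => x /=; rewrite E.
  apply: (@le_poly_gpdf _ (3 * C)).
    apply: measurable_funB; first exact: continuous_measurable_fun.
    by apply: measurable_funM => //; exact: continuous_measurable_fun.
  move=> x; rewrite (le_trans (ler_normB _ _))// normrM.
  have := dfC x; have := fC x; rewrite -[in x ^+ 2](real_normK (num_real x)).
  have := normr_ge0 x; have := normr_ge0 (f x); have := normr_ge0 (df x).
  move: (`|x|) (`|f x|) (`|df x|) => a b c c0 b0 a0 bC cC.
  have : a * b <= a * (C * (1 + a)) by rewrite ler_wpM2l.
  have : 0 <= C * (a - 1) ^+ 2 by rewrite mulr_ge0// sqr_ge0.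
  have : 0 <= C * a ^+ 2 by rewrite mulr_ge0// sqr_ge0.
  nra.
- exact: gpdf_cvg0 fC.
- have : (fun x => f (- x)) n%:R * gpdf n%:R @[n --> \oo] --> (0 : R).
    by apply: (@gpdf_cvg0 (fun x => f (- x)) C) => x; rewrite -[`|x|]normrN.
  by under eq_fun do rewrite -[gpdf _]gpdfN.
Qed.

End StdGauss.

Section GaussFourier.
Context {R : realType}.
Local Notation mu := (@lebesgue_measure R).
Local Notation gam := (@gam R).
Local Notation gpdf := (@gpdf R).
Implicit Types (x r c : R).

Lemma integral_gam_cst r : \int[gam]_x r = r.
Proof.
transitivity (\int[gam]_(x in setT) cst r x) => //.
by rewrite Rintegral_cst//= probability_setT mulr1.
Qed.

Lemma integrable_gam (h : R -> R) (C : R) : measurable_fun setT h ->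
  (forall x, `|h x| <= C * (1 + x ^+ 2)) -> gam.-integrable setT (EFin \o h).
Proof.
move=> mh hC; apply/integrableP; split; first exact/measurable_EFinP.
rewrite ge0_integral_gam//; last first.
  by apply: measurableT_comp => //; exact/measurable_EFinP.
have /integrableP[_] := le_poly_gpdf mh hC.
congr (_ < _)%E; apply: eq_integral => x _ /=.
by rewrite normrM (ger0_norm (gpdf_ge0 x)).
Qed.

Lemma integral_gam (h : R -> R) : measurable_fun setT h ->
  (\int[gam]_x (h x)%:E = \int[mu]_x (h x * gpdf x)%:E)%E.
Proof.
move=> mh; rewrite integralE [RHS]integralE; congr (_ - _)%E.
- rewrite ge0_integral_gam//; last exact/measurable_funepos/measurable_EFinP.
  apply: eq_integral => x _; rewrite !funeposE -!EFin_max -EFinM; congr _%:E.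
  by rewrite maxr_pMl ?gpdf_ge0// mul0r.
- rewrite ge0_integral_gam//; last exact/measurable_funeneg/measurable_EFinP.
  apply: eq_integral => x _; rewrite !funenegE -!EFinN -!EFin_max -EFinM; congr _%:E.
  by rewrite maxr_pMl ?gpdf_ge0// mul0r mulNr.
Qed.

Lemma stein (f df : R -> R) (C : R) : (forall x : R, is_derive x 1 f (df x)) ->
  continuous df -> (forall x, `|f x| <= C * (1 + `|x|)) -> (forall x, `|df x| <= C) ->
  \int[gam]_x df x = \int[gam]_x (x * f x).
Proof.
move=> dfd cdf fC dfC.
have C0 : 0 <= C by rewrite (le_trans _ (dfC 0)).
have cf := continuous_derivable dfd.
have mdf : measurable_fun setT df by exact: continuous_measurable_fun.
have mf : measurable_fun setT f by exact: continuous_measurable_fun.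
have mxf : measurable_fun setT (fun x => x * f x) by exact: measurable_funM.
have i1 : gam.-integrable setT (EFin \o df).
  apply: (integrable_gam mdf (C := C)) => x.
  by rewrite (le_trans (dfC x))// ler_peMr// lerDl sqr_ge0.
have i2 : gam.-integrable setT (EFin \o (fun x => x * f x)).
  apply: (integrable_gam mxf (C := 2 * C)) => x; rewrite normrM.
  have := fC x; rewrite -[in x ^+ 2](real_normK (num_real x)).
  have := normr_ge0 x; have := normr_ge0 (f x).
  move: (`|x|) (`|f x|) => a b b0 a0 bC.
  have : a * b <= a * (C * (1 + a)) by rewrite ler_wpM2l.
  have : 0 <= C * (a - 1) ^+ 2 by rewrite mulr_ge0// sqr_ge0.
  have : 0 <= C * a ^+ 2 by rewrite mulr_ge0// sqr_ge0.
  nra.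
apply/eqP; rewrite -subr_eq0 -RintegralB// /Rintegral.
rewrite (integral_gam (h := fun x => df x - x * f x)); last exact: measurable_funB.
by rewrite (integral_gam_stein dfd cdf fC dfC).
Qed.

(* By Stein's identity, the left-hand side [F] satisfies [F' r = - r * F r]. *)
Lemma integral_gam_cos r c : \int[gam]_x cos (r * x - c) = expR (- r ^+ 2 / 2) * cos c.
Proof.
have mlin s : measurable_fun setT (fun x => s * x - c).
  by apply: measurable_funB => //; exact: measurable_funM.
pose F s := \int[gam]_x cos (s * x - c).
have icos s : gam.-integrable setT (EFin \o (fun x => cos (s * x - c))).
  by apply: bm_integrable; apply: bm_cos; exact: mlin.
have dcos (s x : R) : is_derive s 1 (fun s => cos (s * x - c)) (- (x * sin (s * x - c))).
  by apply: is_derive_eq; rewrite /GRing.scale/=; ring.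
have iabs : gam.-integrable setT (EFin \o (fun x : R => `|x|)).
  apply: (integrable_gam (C := 1)); first exact: measurableT_comp.
  move=> x; rewrite normr_id mul1r -[in x ^+ 2](real_normK (num_real x)).
  have := sqr_ge0 (`|x| - 1); have := sqr_ge0 `|x|; nra.
have p1 (s x : R) : partial1of2 (fun s x => cos (s * x - c)) s x = - (x * sin (s * x - c)).
  by rewrite partial1of2E; have [_ ->] := dcos s x.
have sin1 (s x : R) : `|- (x * sin (s * x - c))| <= `|x|.
  by rewrite normrN normrM ler_piMr// sin_max.
have dF (s : R) : is_derive s 1 F (- s * F s).
  have s1 : `]s - 1, s + 1[%classic s by rewrite /= in_itv/= ltrBlDr ltrDl ltr01.
  have dr : derivable F s 1.
    apply: (@derivable_under_integral R _ _ gam (fun s x => cos (s * x - c)) setT measurableT s (s - 1) (s + 1) s1 _ _ (fun x : R => `|x|)) => //.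
    by move=> u x _ _; rewrite p1.
  apply: DeriveDef => //.
  rewrite -derive1E (@differentiation_under_integral R _ _ gam (fun s x => cos (s * x - c)) setT measurableT s (s - 1) (s + 1) s1 _ _ (fun x : R => `|x|)) //; last first.
    by move=> u x _ _; rewrite p1.
  under eq_Rintegral do rewrite p1.
  have dsin (x : R) : is_derive x 1 (fun x => sin (s * x - c)) (s * cos (s * x - c)).
    by apply: is_derive_eq; rewrite /GRing.scale/=; ring.
  have st := @stein _ (fun x => s * cos (s * x - c)) (1 + `|s|) dsin.
  have ixs : gam.-integrable setT (EFin \o (fun x => x * sin (s * x - c))).
    apply: (integrable_gam (C := 1)).
      apply: measurable_funM => //; apply: measurableT_comp => //.
      by apply: continuous_measurable_fun; exact: continuous_sin.
    move=> x; rewrite mul1r -normrN (le_trans (sin1 _ _))//.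
    rewrite -[in x ^+ 2](real_normK (num_real x)).
    have := sqr_ge0 (`|x| - 1); have := sqr_ge0 `|x|; nra.
  have -> : \int[gam]_x - (x * sin (s * x - c)) = - \int[gam]_x (x * sin (s * x - c)).
    by under eq_Rintegral do rewrite -mulN1r; rewrite RintegralZl// mulN1r.
  rewrite -st; first by rewrite RintegralZl// mulNr.
  - move=> x; apply: cvgM; first exact: cvg_cst.
    apply: continuous_comp; last exact: continuous_cos.
    by apply: cvgB; [apply: cvgM; [exact: cvg_cst|exact: cvg_id]|exact: cvg_cst].
  - move=> x; rewrite (le_trans (sin_max _))//.
    have := normr_ge0 s; have := normr_ge0 x; nra.
  - move=> x; rewrite normrM (@le_trans _ _ `|s|)//; last by rewrite lerDr.
    by rewrite ler_piMr// cos_max.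
have F0 : F 0 = cos c.
  rewrite /F; under eq_Rintegral do rewrite mul0r sub0r cosN.
  by rewrite integral_gam_cst.
pose H s := F s * expR (s ^+ 2 / 2).
have dH (s : R) : is_derive s (1 : R) H 0.
  have ? := dF s; apply: is_derive_eq; rewrite /GRing.scale/=.
  by field.
have := is_derive_0_is_cst r 0 dH; rewrite /H F0 expr0n mul0r expR0 mulr1 => <-.
rewrite -/(F r) mulNr expRN mulrCA [RHS]mulrC.
by rewrite mulVf ?mul1r// gt_eqF ?expR_gt0.
Qed.

Lemma integral_gam_id : \int[gam]_x x = 0.
Proof.
have := @stein (cst 1) (cst 0) 1; rewrite Rintegral_cst//= mul0r => H.
transitivity (\int[gam]_x (x * 1)); first by apply: eq_Rintegral => x _; rewrite mulr1.
rewrite -H//.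
- by move=> x; exact: cvg_cst.
- by move=> x; rewrite normr1 mul1r lerDl.
- by move=> x; rewrite normr0.
Qed.

Lemma integral_gam_sqr : \int[gam]_x (x ^+ 2) = 1.
Proof.
have := @stein id (cst 1) 1; rewrite Rintegral_cst//= probability_setT mulr1 => H.
transitivity (\int[gam]_x (x * x)); first by apply: eq_Rintegral => x _; rewrite expr2.
rewrite -H//.
- by move=> x; exact: cvg_cst.
- by move=> x; rewrite mul1r lerDr.
- by move=> x; rewrite normr1.
Qed.

End GaussFourier.

Section FiniteMeasure.
Context {R : realType}.
Local Open Scope ereal_scope.

Lemma bounded_integrable d (T : measurableType d) (nu : {finite_measure set T -> \bar R})
  (f : T -> R) : bounded_meas f -> nu.-integrable setT (EFin \o f).
Proof.
move=> [mf [M fM]]; apply: measurable_bounded_integrable => //.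
  by rewrite -ge0_fin_numE ?measure_ge0//; exact: fin_num_measure.
exists M; split; first exact: num_real.
by move=> y My x _; exact: le_trans (fM x) (ltW My).
Qed.

Lemma bounded_EFin_Rintegral d (T : measurableType d)
    (nu : {finite_measure set T -> \bar R}) (f : T -> R) : bounded_meas f ->
  \int[nu]_x (f x)%:E = (\int[nu]_x f x)%R%:E.
Proof.
move=> bf; rewrite /Rintegral fineK//.
exact: integrable_fin_num (bounded_integrable nu bf).
Qed.

Lemma bounded_Fubini d1 d2 (T1 : measurableType d1) (T2 : measurableType d2)
  (m1 : {finite_measure set T1 -> \bar R}) (m2 : {finite_measure set T2 -> \bar R})
  (f : T1 -> T2 -> R) : bounded_meas (fun z : T1 * T2 => f z.1 z.2) ->
  (\int[m1]_x \int[m2]_y f x y = \int[m2]_y \int[m1]_x f x y)%R.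
Proof.
move=> bf; have [mf [M fM]] := bf.
have b1 x : bounded_meas (f x).
  split; last by exists M => y; exact: (fM (x, y)).
  by have := measurableT_comp mf (pair1_measurable x).
have b2 y : bounded_meas (f ^~ y).
  split; last by exists M => x; exact: (fM (x, y)).
  by have := measurableT_comp mf (pair2_measurable y).
have i12 : (m1 \x m2).-integrable setT (fun z => (f z.1 z.2)%:E).
  apply: measurable_bounded_integrable => //.
    suff : m1 setT * m2 setT < +oo by rewrite -product_measure1E// setXTT.
    apply: lte_mul_pinfty => //.
      exact: fin_num_measure.
    by rewrite -ge0_fin_numE ?measure_ge0//; exact: fin_num_measure.
  exists M; split; first exact: num_real.
  by move=> y My x _; exact: le_trans (fM x) (ltW My).
have /= := Fubini i12.
under eq_integral do rewrite bounded_EFin_Rintegral//.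
move=> H; rewrite /Rintegral; congr fine.
under [RHS]eq_integral do rewrite -bounded_EFin_Rintegral//.
by rewrite -H.
Qed.

End FiniteMeasure.

Section Normal.
Context {R : realType}.
Local Notation mu := (@lebesgue_measure R).
Local Open Scope ereal_scope.
Implicit Types (m s x y : R).

Lemma ge0_integral_normal m s (f : R -> \bar R) : measurable_fun setT f ->
  (forall x, 0 <= f x) ->
  \int[normal_prob m s]_x f x = \int[mu]_x (f x * (normal_pdf m s x)%:E).
Proof.
move=> mf f0; apply: ge0_integral_density => //.
- exact: measurable_normal_pdf.
- exact: normal_pdf_ge0.
Qed.

Lemma normal_pdf_affine m s (z : R) : s != 0%R ->
  (normal_pdf m s (m + `|s| * z) * `|s| = gpdf z)%R.
Proof.
move=> s0; rewrite normal_pdfE//= /normal_peak /normal_fun gpdfE.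
have sp : (0 < `|s|)%R by rewrite normr_gt0.
rewrite addrAC subrr add0r exprMn real_normK ?num_real//.
have -> : (- (s ^+ 2 * z ^+ 2) / (s ^+ 2 *+ 2) = - z ^+ 2 / 2)%R.
  by rewrite -mulr_natl; field.
have -> : (Num.sqrt (s ^+ 2 * pi *+ 2) = `|s| * Num.sqrt (2 * pi) :> R)%R.
  by rewrite -mulr_natl mulrCA sqrtrM ?sqr_ge0// sqrtr_sqr.
rewrite invfM; move: (Num.sqrt (2 * pi))^-1%R (expR (- z ^+ 2 / 2)) => q E.
by field; rewrite gt_eqF.
Qed.

(** Substitution [x = m + |s| z]; the modulus appears because [s] may be any nonzero real. *)
Lemma integral_normal_affine m s (G : R -> R) : s != 0%R -> continuous G ->
  (forall x, (0 <= G x)%R) ->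
  \int[normal_prob m s]_x (G x)%:E = \int[gam]_z (G (m + `|s| * z))%:E.
Proof.
move=> s0 cG G0.
have sp : (0 < `|s|)%R by rewrite normr_gt0.
pose F (z : R) : R := (m + `|s| * z)%R.
have dF (z : R) : is_derive z (1%R : R) F `|s|%R.
  by apply: is_derive_eq; rewrite /GRing.scale/=; ring.
have F'E : (F^`())%classic = cst `|s|%R.
  by apply/funext => z; rewrite derive1E; have [_ ->] := dF z.
have cF := continuous_derivable dF.
have mG : measurable_fun setT G by exact: continuous_measurable_fun.
rewrite ge0_integral_normal//; last exact/measurable_EFinP.
rewrite ge0_integral_gam; first last.
- by move=> x; rewrite lee_fin.
- by apply/measurable_EFinP/measurableT_comp => //; exact: continuous_measurable_fun.
under eq_integral do rewrite -EFinM.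
rewrite (@increasing_ge0_integration_by_substitutionT R F (fun x => G x * normal_pdf m s x)%R).
- apply: eq_integral => z _; rewrite F'E -EFinM; congr _%:E.
  by rewrite -(normal_pdf_affine m z s0) mulrA.
- by move=> x y xy; rewrite ltrD2l ltr_pM2l.
- by rewrite F'E => z; exact: cvg_cst.
- by rewrite F'E; exact: is_cvg_cst.
- by rewrite F'E; exact: is_cvg_cst.
- by move=> z; exact: ex_derive.
- have -> : F = (fun z => (z + m / `|s|) * `|s|)%R.
    by apply/funext => z; rewrite /F; field; rewrite gt_eqF.
  by apply/gt0_cvgMlNy => //; exact: cvg_addrr_Ny.
- have -> : F = (fun z => (z + m / `|s|) * `|s|)%R.
    by apply/funext => z; rewrite /F; field; rewrite gt_eqF.
  by apply/gt0_cvgMly => //; exact: cvg_addrr.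
- move=> x; apply: cvgM; first exact: cG.
  by apply: continuous_normal_pdf.
- by move=> x; rewrite mulr_ge0// normal_pdf_ge0.
Qed.

Lemma normal_chebyshev m s (A : set R) (del : R) : s != 0%R -> measurable A ->
  (0 < del)%R -> (forall x, A x -> (del <= `|x - m|)%R) ->
  normal_prob m s A <= ((s / del) ^+ 2)%:E.
Proof.
move=> s0 mA d0 HA.
pose G (x : R) : R := (((x - m) / del) ^+ 2)%R.
have cG : continuous G.
  move=> x; apply: (@cvg_comp _ _ _ (fun x => (x - m) / del)%R (fun z => z ^+ 2)%R).
    by apply: cvgM; [apply: cvgB; [exact: cvg_id|exact: cvg_cst]|exact: cvg_cst].
  exact: exprn_continuous.
have mG : measurable_fun setT G by exact: continuous_measurable_fun.
have G0 x : (0 <= G x)%R by exact: sqr_ge0.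
have -> : normal_prob m s A = \int[normal_prob m s]_x (\1_A x)%:E.
  by rewrite integral_indic// setIT.
apply: (@le_trans _ _ (\int[normal_prob m s]_x (G x)%:E)).
  apply: ge0_le_integral => //.
  - by apply/measurable_EFinP/measurable_indic.
  - exact/measurable_EFinP.
  - move=> x _; rewrite lee_fin indicE; case: (boolP (x \in A)) => // /set_mem /HA h.
    rewrite /G -(real_normK (num_real _)) exprn_ege1// normrM normfV (gtr0_norm d0).
    by rewrite ler_pdivlMr// mul1r.
rewrite (integral_normal_affine m s0 cG G0)/=.
have -> : \int[gam]_z (G (m + `|s| * z))%:E = \int[gam]_z (((s / del) ^+ 2)%:E * (z ^+ 2)%:E).
  apply: eq_integral => z _; rewrite -EFinM; congr _%:E.
  by rewrite /G addrAC subrr add0r !exprMn real_normK ?num_real//; ring.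
rewrite ge0_integralZl//; last by rewrite lee_fin sqr_ge0.
- have i2 : gam.-integrable setT (EFin \o (fun z : R => z ^+ 2)%R).
    apply: (integrable_gam (C := 1%R)) => // x.
    by rewrite ger0_norm ?sqr_ge0// mul1r lerDr.
  have -> : \int[@gam R]_x (x ^+ 2)%:E = 1.
    rewrite -(@fineK _ (\int[@gam R]_x (x ^+ 2)%:E)); last exact: integrable_fin_num i2.
    by have := @integral_gam_sqr R; rewrite /Rintegral => ->.
  by rewrite mule1.
- exact/measurable_EFinP/measurable_funX.
- by move=> x _; rewrite lee_fin sqr_ge0.
Qed.

End Normal.

(** * A finite measure is determined by its cosine integrals *)

Section CharfunUnique.
Context {R : realType}.
Local Notation mu := (@lebesgue_measure R).
Local Notation T := (measurableTypeR R).

(* The normal density is its own Fourier transform, so measures with the same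
   characteristic function agree on all the mixtures of narrow normal laws. *)
Lemma normal_pdf_cos (s x y : R) : s != 0 ->
  normal_pdf x s y = normal_peak s * \int[gam]_z cos ((x - y) / s * z).
Proof.
move=> s0; rewrite normal_pdfE//=; congr (_ * _).
have := integral_gam_cos ((x - y) / s) 0; rewrite cos0 mulr1.
under eq_Rintegral do rewrite subr0.
move=> ->; rewrite /normal_fun; congr expR.
by rewrite -mulr_natl; field.
Qed.

Lemma measurable_normal_pdf2 (s : R) : s != 0 ->
  measurable_fun setT (fun z : T * T => normal_pdf z.1 s z.2).
Proof.
move=> s0; rewrite (_ : (fun z => _) =
   (fun z : T * T => normal_peak s * expR (- (z.2 - z.1) ^+ 2 / (s ^+ 2 *+ 2)))); last first.
  by apply/funext => z; rewrite normal_pdfE.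
apply: measurable_funM => //; apply: measurableT_comp => //.
apply: measurable_funM => //; apply: measurableT_comp => //.
by apply: measurable_funX; apply: measurable_funB.
Qed.

(** By Fubini, the density at [y] of [nu] smoothed by a normal law of scale [s] involves [nu] only
    through its cosine integrals. *)
Lemma integral_normal_pdf_cos (nu : {finite_measure set T -> \bar R}) (s y : R) : s != 0 ->
  \int[nu]_x normal_pdf x s y =
  normal_peak s * \int[gam]_z \int[nu]_x cos (z / s * x - z / s * y).
Proof.
move=> s0; under eq_Rintegral do rewrite normal_pdf_cos//.
have bm2 : bounded_meas (fun w : T * T => cos ((w.1 - y) / s * w.2)).
  apply: bm_cos; apply: measurable_funM => //; apply: measurable_funM => //.
  exact: measurable_funB.
have bm1 : bounded_meas (fun x : T => \int[gam]_z cos ((x - y) / s * z)).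
  rewrite (_ : (fun x => _) = fun x : T => expR (- ((x - y) / s) ^+ 2 / 2)).
    split.
      apply: measurableT_comp => //; apply: measurable_funM => //.
      apply: measurableT_comp => //; apply: measurable_funX => //.
      by apply: measurable_funM => //; exact: measurable_funB.
    exists 1 => x; rewrite ger0_norm ?expR_ge0// -expR0 ler_expR mulNr oppr_le0.
    by rewrite divr_ge0 ?sqr_ge0.
  apply/funext => x; have := integral_gam_cos ((x - y) / s) 0; rewrite cos0 mulr1 => <-.
  by apply: eq_Rintegral => z _; rewrite subr0.
rewrite RintegralZl//; last exact: bounded_integrable.
congr (_ * _).
rewrite (bounded_Fubini (f := fun x z => cos ((x - y) / s * z)) nu gam bm2).
apply: eq_Rintegral => z _; apply: eq_Rintegral => x _; congr cos.
by field.
Qed.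

Definition ray (q : R) : set T := `]q, +oo[%classic.

Lemma measurable_ray q : measurable (ray q).
Proof. exact: measurable_itv. Qed.

Section TwoMeasures.
Variables nu1 nu2 : {finite_measure set T -> \bar R}.
Hypothesis eq_cos : forall r c : R,
  \int[nu1]_x cos (r * x - c) = \int[nu2]_x cos (r * x - c).

Let eq_normal (s q : R) : s != 0 ->
  (\int[nu1]_x normal_prob x s (ray q) = \int[nu2]_x normal_prob x s (ray q))%E.
Proof.
move=> s0; pose A := ray q.
pose f (z : T * T) := ((normal_pdf z.1 s z.2) * \1_A z.2)%:E.
have mf : measurable_fun setT f.
  apply/measurable_EFinP; apply: measurable_funM; first exact: measurable_normal_pdf2.
  by apply: measurableT_comp => //; apply: measurable_indic; exact: measurable_ray.
have f0 z : (0 <= f z)%E by rewrite lee_fin mulr_ge0 ?normal_pdf_ge0// indicE.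
have E (nu : {finite_measure set T -> \bar R}) :
    (\int[nu]_x normal_prob x s A = \int[mu]_y ((\int[nu]_x normal_pdf x s y)%R * \1_A y)%:E)%E.
  transitivity (\int[nu]_x \int[mu]_y f (x, y))%E.
    apply: eq_integral => x _; rewrite /normal_prob integral_mkcond.
    apply: eq_integral => y _; rewrite /f patchE indicE/=.
    by case: (y \in A); rewrite ?mulr1 ?mulr0.
  rewrite fubini_tonelli//; apply: eq_integral => y _; rewrite /f/=.
  have bp : bounded_meas (fun x : T => normal_pdf x s y).
    split; first by have := measurableT_comp (measurable_normal_pdf2 s0) (pair2_measurable y).
    exists (normal_peak s) => x; rewrite ger0_norm ?normal_pdf_ge0//.
    exact: normal_pdf_ub.
  under eq_integral do rewrite EFinM.
  rewrite EFinM -bounded_EFin_Rintegral// ge0_integralZr//.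
  - by apply/measurable_EFinP; case: bp.
  - by move=> x _; rewrite lee_fin normal_pdf_ge0.
rewrite -/A !E; apply: eq_integral => y _.
rewrite !integral_normal_pdf_cos//.
congr (_ * _ * _)%:E.
by apply: eq_Rintegral => z _; exact: eq_cos.
Qed.

(** The scale [s_] is negligible against the shift [d_], so Chebyshev's bound [(s_ / d_)^2] tends to
    zero while the shifted rays still exhaust [ray q]. The shift makes the limit in [normal_cvg]
    right at the boundary point [x = q] too. *)
Let s_ (n : nat) : R := n.+1%:R^-1 ^+ 2.
Let d_ (n : nat) : R := n.+1%:R^-1.

Let normal_cvg (q x : R) : (normal_prob x (s_ n) (ray (q + d_ n)) @[n --> \oo]
   --> (\1_(ray q) x)%:E)%E.
Proof.
have s0 n : s_ n != 0 by rewrite expf_neq0// invr_eq0 pnatr_eq0.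
have d0 n : 0 < d_ n by rewrite invr_gt0.
have d1 n : d_ n <= 1 by rewrite invf_le1// ler1n.
pose r n := fine (normal_prob x (s_ n) (ray (q + d_ n))).
have rE n : normal_prob x (s_ n) (ray (q + d_ n)) = (r n)%:E.
  by rewrite /r fineK//; apply: fin_num_measure; exact: measurable_ray.
pose A := ray q.
suff [C [N HC]] : exists C N, forall n, (N <= n)%N -> `|\1_A x - r n| <= C * d_ n.
  under eq_fun do rewrite rE.
  apply: cvg_EFin; first by exists 0%N.
  rewrite (_ : fine \o _ = r)//.
  apply/cvgrPdist_le => e e0.
  have : C * d_ n @[n --> \oo] --> (0 : R).
    rewrite -[X in _ --> X](mulr0 C); apply: cvgM; first exact: cvg_cst.
    exact: cvg_harmonic.
  move=> /cvgr0Pnorm_le/(_ e e0)[N' _ h'].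
  exists (maxn N N') => // n /=; rewrite geq_max => /andP[n1 n2].
  by rewrite (le_trans (HC n n1))// (le_trans (ler_norm _))//; exact: h'.
have [xq|qx] := leP x q.
  exists 1, 0%N => n _; rewrite /A indicE memNset /=; last by rewrite /ray/= in_itv/= andbT; lra.
  rewrite sub0r normrN ger0_norm ?fine_ge0// -lee_fin -rE.
  have := @normal_chebyshev R x (s_ n) (ray (q + d_ n)) (d_ n) (s0 n) (measurable_ray _) (d0 n).
  move=> H; apply: (le_trans (H _)).
    move=> y; rewrite /ray/= in_itv/= andbT => h.
    by rewrite (le_trans _ (ler_norm _))//; lra.
  rewrite lee_fin mul1r /s_ -/(d_ n) expr2 mulfK ?gt_eqF//.
  by rewrite ler_piMl// ltW.
have del0 : 0 < (x - q) / 2 by lra.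
exists (((x - q) / 2)^-1 ^+ 2), (Num.trunc ((x - q) / 2)^-1) => n Nn.
have dn : d_ n < (x - q) / 2.
  rewrite /d_ -[ltRHS]invrK ltf_pV2 ?posrE ?invr_gt0//.
  by rewrite (lt_le_trans (truncnS_gt _))// ler_nat.
rewrite /A indicE mem_set/=; last by rewrite /ray/= in_itv/= andbT.
pose B : set T := `]-oo, (q + d_ n)%R]%classic.
have mB : measurable B by exact: measurable_itv.
have H : (normal_prob x (s_ n) B <= ((s_ n / ((x - q) / 2)) ^+ 2)%:E)%E.
  apply: normal_chebyshev => // y; rewrite /B /= in_itv/= => h.
  by rewrite distrC (le_trans _ (ler_norm _))//; lra.
have e1 : (normal_prob x (s_ n) B = (1 - r n)%:E)%E.
  have -> : B = ~` ray (q + d_ n) by rewrite /B /ray setCitvr.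
  rewrite (probability_setC (normal_prob x (s_ n))); last exact: measurable_ray.
  by rewrite EFinB; congr (_ - _)%E; exact: rE.
rewrite e1 lee_fin in H.
have r1 : 0 <= 1 - r n by rewrite -lee_fin -e1.
rewrite ger0_norm// (le_trans H)// exprMn mulrC ler_wpM2l ?sqr_ge0//.
rewrite /s_ -/(d_ n); have := d1 n; have := d0 n; move: (d_ n) => u u0 u1.
have h2 : u ^+ 2 <= u by rewrite expr2 ler_piMl// ltW.
by rewrite (le_trans _ h2)// expr2 ler_piMl ?sqr_ge0// (le_trans h2).
Qed.

(** Smoothed by narrow normal laws, the two measures agree on rays; dominated convergence removes
    the smoothing, and rays form a pi-system generating the Borel sets. *)
Lemma charfun_unique A : measurable A -> nu1 A = nu2 A.
Proof.
have halfline q : nu1 (ray q) = nu2 (ray q).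
  have L (nu : {finite_measure set T -> \bar R}) :
      (\int[nu]_x normal_prob x (s_ n) (ray (q + d_ n)) @[n --> \oo] --> nu (ray q))%E.
    have -> : nu (ray q) = (\int[nu]_x (\1_(ray q) x)%:E)%E.
      by rewrite integral_indic ?setIT//; exact: measurable_ray.
    have mN n : measurable_fun setT (fun x => normal_prob x (s_ n) (ray (q + d_ n))).
      have s0 : s_ n != 0 by rewrite expf_neq0// invr_eq0 pnatr_eq0.
      pose f (z : T * T) := ((normal_pdf z.1 (s_ n) z.2) * \1_(ray (q + d_ n)) z.2)%:E.
      have mf : measurable_fun setT f.
        apply/measurable_EFinP; apply: measurable_funM; first exact: measurable_normal_pdf2.
        by apply: measurableT_comp => //; apply: measurable_indic; exact: measurable_ray.
      have f0 z : (0 <= f z)%E by rewrite lee_fin mulr_ge0 ?normal_pdf_ge0// indicE.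
      have := @measurable_fun_fubini_tonelli_F _ _ _ _ _ mu f mf f0.
      rewrite /fubini_F; congr measurable_fun; apply/funext => x.
      rewrite /normal_prob [RHS]integral_mkcond.
      apply: eq_integral => y _; rewrite /f patchE indicE/=.
      by case: (y \in _); rewrite ?mulr1 ?mulr0.
    have [] := @dominated_convergence _ _ _ nu setT measurableT
      (fun n x => normal_prob x (s_ n) (ray (q + d_ n)))
      (fun x => (\1_(ray q) x)%:E) (cst 1%E) => //.
    - by apply/measurable_EFinP; apply: measurable_indic; exact: measurable_ray.
    - by apply: aeW => x _; exact: normal_cvg.
    - apply/integrableP; split => //.
      rewrite (eq_integral (cst 1%E)); last by move=> x _ /=; rewrite normr1.
      rewrite integral_cst// mul1e -ge0_fin_numE ?measure_ge0//; exact: fin_num_measure.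
    - by apply: aeW => x n _; rewrite gee0_abs ?measure_ge0//; apply: probability_le1; exact: measurable_ray.
  have L1 := L nu1; have := L nu2.
  under eq_fun do rewrite -eq_normal ?expf_neq0 ?invr_eq0 ?pnatr_eq0//.
  by move=> L2; exact: cvg_unique L1 L2.
pose G : set (set T) := [set A | exists q : R, A = ray q].
pose g (n : nat) := ray (- n%:R).
apply: (@measure_unique _ R T G g).
- rewrite RGenOInfty.measurableE; congr (<<s _ >>).
- move=> _ _ [x ->] [y ->]; exists (Num.max x y).
  apply/seteqP; split => z; rewrite /ray/= !in_itv/= !andbT gt_max.
    by move=> [-> ->].
  by move=> /andP.
- by move=> n; exists (- n%:R).
- apply/seteqP; split => // x _; exists (Num.trunc `|x|).+1 => //=.
  rewrite /g/ray/= in_itv/= andbT ltrNl (le_lt_trans _ (truncnS_gt _))//.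
  by rewrite -normrN ler_norm.
- by move=> _ [q ->]; exact: halfline.
- by move=> n; rewrite -ge0_fin_numE ?measure_ge0//; apply: fin_num_measure; exact: measurable_ray.
Qed.

End TwoMeasures.
End CharfunUnique.

(** * Laws under a weighted measure *)

Section WeightedLaw.
Context {R : realType} {d : measure_display} {T : measurableType d}.
Variable P : probability T R.
Implicit Types (X U : T -> R) (r : R).
Local Notation RT := (measurableTypeR R).

(** The image by [X] of the measure of density [U] with respect to [P]: finite, but in general not
    of mass one. The weight is meant to hold functions of other variables. *)
Lemma weighted_law X U : measurable_fun setT X -> bounded_meas U ->
  (forall w, 0 <= U w) ->
  exists nu : {finite_measure set RT -> \bar R},
    (forall A, measurable A -> nu A = (\int[P]_(w in X @^-1` A) (U w)%:E)%E) /\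
    (forall g : R -> R, bounded_meas g -> (forall x, 0 <= g x) ->
      \int[nu]_x g x = \int[P]_w (g (X w) * U w)).
Proof.
move=> mX bU U0; have [mU _] := bU.
have [nu0 nu0E] := density_measure P mU U0.
pose nu (A : set RT) := nu0 (X @^-1` A).
have nu_0 : nu set0 = 0%E by rewrite /nu preimage_set0 measure0.
have nu_ge0 A : (0 <= nu A)%E by exact: measure_ge0.
have mpre (A : set RT) : measurable A -> measurable (X @^-1` A).
  by move=> mA; rewrite -[X in measurable X]setTI; exact: mX.
have nu_add : @semi_sigma_additive _ RT R nu.
  move=> F mF tF mUF; rewrite /nu preimage_bigcup.
  apply: measure_semi_sigma_additive.
  - by move=> n; exact: (mpre _ (mF n)).
  - apply/trivIsetP => /= i j _ _ ij; rewrite -preimage_setI.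
    by move/trivIsetP : tF => /(_ _ _ _ _ ij) ->//; rewrite preimage_set0.
  - by rewrite -preimage_bigcup; exact: (mpre _ mUF).
pose M1 : {measure set RT -> \bar R} := HB.pack nu (isMeasure.Build _ _ _ nu nu_0 nu_ge0 nu_add).
have M1fin : fin_num_fun M1.
  move=> A mA; rewrite ge0_fin_numE ?measure_ge0//.
  have -> : M1 A = nu0 (X @^-1` A) by [].
  rewrite nu0E; last exact: mpre.
  rewrite (le_lt_trans _ (_ : \int[P]_w (U w)%:E < +oo)%E)//.
    apply: ge0_subset_integral => //.
    - exact: mpre.
    - exact/measurable_EFinP.
    - by move=> x _; rewrite lee_fin.
  have /integrableP[_] := bounded_integrable P bU.
  by under eq_integral do rewrite /= ger0_norm//.
pose M : {finite_measure set RT -> \bar R} := HB.pack (Measure.sort M1) (Measure_isFinite.Build _ _ _ M1 M1fin).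
exists M; split.
  by move=> A mA; rewrite -nu0E//; exact: mpre.
move=> g [mg [C gC]] g0; rewrite /Rintegral; congr fine.
have -> : (\int[M]_x (g x)%:E = \int[pushforward nu0 (X : T -> RT)]_x (g x)%:E)%E by [].
rewrite ge0_integral_pushforward//; last 2 first.
- exact/measurable_EFinP.
- by move=> x _; rewrite lee_fin.
rewrite preimage_setT (ge0_integral_density mU U0 nu0E)//.
- by apply/measurable_EFinP; exact: measurableT_comp.
- by move=> w; rewrite /= lee_fin.
Qed.

Lemma bm_comp (g : R -> R) X : bounded_meas g -> measurable_fun setT X ->
  bounded_meas (g \o X).
Proof.
move=> [mg [C gC]] mX; split; first exact: measurableT_comp.
by exists C => w; exact: gC.
Qed.

Lemma bm_Rintegral_cst r : \int[P]_w r = r.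
Proof.
transitivity (\int[P]_(x in setT) cst r x) => //.
by rewrite Rintegral_cst//= probability_setT mulr1.
Qed.

End WeightedLaw.

Section WeightedCharfun.
Context {R : realType} {d : measure_display} {T : measurableType d}.
Variable P : probability T R.
Implicit Types (X S U V : T -> R) (r c : R).

(** The weighted law of [X] and [K] times the normal law have the same cosine integrals, so they
    coincide. *)
Lemma weighted_charfun X U K : measurable_fun setT X -> bounded_meas U ->
  (forall w, 0 <= U w) ->
  (forall r c, \int[P]_w (cos (r * X w - c) * U w) = K * (expR (- r ^+ 2 / 2) * cos c)) ->
  forall B, measurable B -> \int[P]_w (\1_B (X w) * U w) = K * fine (gam B).
Proof.
move=> mX bU U0 HK.
have K0 : 0 <= K.
  have := HK 0 0; rewrite expr0n !oppr0 mul0r expR0 cos0 !mulr1 => <-.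
  apply: Rintegral_ge0 => w _; rewrite mul0r addr0 cos0 mul1r//.
have [nu [_ nuI]] := weighted_law P mX bU U0.
have [nu' [_ nuI']] := @weighted_law _ _ _ (@gam R) (fun x => x) (fun=> K)
   (@measurable_id _ _ _) (bm_cst K) (fun=> K0).
have U1 : \int[P]_w U w = K.
  have := HK 0 0; rewrite expr0n !oppr0 mul0r expR0 cos0 !mulr1 => <-.
  by apply: eq_Rintegral => w _; rewrite mul0r addr0 cos0 mul1r.
have bcos r c : bounded_meas (fun x : R => cos (r * x - c)).
  by apply: bm_cos; apply: measurable_funB => //; exact: measurable_funM.
(* [weighted_law] speaks of nonnegative functions: [1 + cos] is one, and the constant is subtracted
   afterwards. *)
have i1 r c : \int[nu]_x (1 + cos (r * x - c)) = K + K * (expR (- r ^+ 2 / 2) * cos c).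
  rewrite nuI; last 2 first.
  - by apply: bmD => //; exact: bm_cst.
  - by move=> x; rewrite -lerBlDl sub0r cos_geN1.
  under eq_Rintegral do rewrite mulrDl mul1r.
  rewrite RintegralD//; last 2 first.
  - exact: bounded_integrable.
  - apply: bounded_integrable; apply: bmM => //.
    exact: (bm_comp (bcos r c) mX).
  by rewrite HK U1.
have i2 r c : \int[nu']_x (1 + cos (r * x - c)) = K + K * (expR (- r ^+ 2 / 2) * cos c).
  rewrite nuI'; last 2 first.
  - by apply: bmD => //; exact: bm_cst.
  - by move=> x; rewrite -lerBlDl sub0r cos_geN1.
  rewrite RintegralZr//; last by apply: bounded_integrable; apply: bmD; [exact: bm_cst|exact: bcos].
  rewrite RintegralD//; last 2 first.
  - by apply: bounded_integrable; exact: bm_cst.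
  - by apply: bounded_integrable; exact: bcos.
  by rewrite integral_gam_cos integral_gam_cst mulrDl mul1r; ring.
have j1 : \int[nu]_x 1 = K.
  by rewrite nuI//; [under eq_Rintegral do rewrite mul1r | exact: bm_cst].
have j2 : \int[nu']_x 1 = K.
  rewrite nuI'//; last exact: bm_cst.
  by under eq_Rintegral do rewrite mul1r; exact: integral_gam_cst.
have E r c : \int[nu]_x cos (r * x - c) = \int[nu']_x cos (r * x - c).
  have := i1 r c; rewrite -(i2 r c) RintegralD//; last 2 first.
  - by apply: bounded_integrable; exact: bm_cst.
  - by apply: bounded_integrable; exact: bcos.
  rewrite RintegralD//; last 2 first.
  - by apply: bounded_integrable; exact: bm_cst.
  - by apply: bounded_integrable; exact: bcos.
  by rewrite j1 j2 => /addrI.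
move=> B mB.
have bB : bounded_meas (\1_B : R -> R) by exact: bm_indic.
have B0 x : (0 <= \1_B x :> R) by rewrite indicE.
rewrite -(nuI _ bB B0).
transitivity (\int[nu']_x \1_B x : R).
  rewrite /Rintegral !integral_indic ?setIT//; congr fine.
  exact: charfun_unique.
rewrite (nuI' _ bB B0) RintegralZr//; last exact: bounded_integrable.
by rewrite /Rintegral integral_indic// setIT mulrC.
Qed.

(* Trading cosines for indicator functions one variable at a time turns a joint
   characteristic function into the probability of a rectangle. *)
Lemma weighted_charfun_step X S V K K0 : measurable_fun setT X -> measurable_fun setT S ->
  bounded_meas V -> (forall w, 0 <= V w) ->
  (forall r c, \int[P]_w (cos (r * X w - c) * V w) = K0 * (expR (- r ^+ 2 / 2) * cos c)) ->
  (forall r c, \int[P]_w (cos (S w + r * X w - c) * V w) = K * (expR (- r ^+ 2 / 2) * cos c)) ->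
  forall B, measurable B -> forall c,
    \int[P]_w (cos (S w - c) * (\1_B (X w) * V w)) = K * fine (gam B) * cos c.
Proof.
move=> mX mS bV V0 H0 H B mB c.
have bSX (f : T -> R) : measurable_fun setT f -> bounded_meas (fun w => cos (f w) : R).
  by move=> mf; exact: bm_cos.
have mSc : measurable_fun setT (fun w => S w - c) by exact: measurable_funB.
have bS := bSX _ mSc.
(* This weight is nonnegative, and the product of its cosine with [cos (r X - c')] splits into
   cosines of [S + r X] and [S - r X], both known from [H]. *)
pose U w := (1 + cos (S w - c)) * V w.
have bU : bounded_meas U by apply: bmM => //; apply: bmD => //; exact: bm_cst.
have U0 w : 0 <= U w by rewrite mulr_ge0// -lerBlDl sub0r cos_geN1.
have mXr r c' : measurable_fun setT (fun w => r * X w - c').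
  by apply: measurable_funB => //; exact: measurable_funM.
have HU r c' : \int[P]_w (cos (r * X w - c') * U w) =
    (K0 + K * cos c) * (expR (- r ^+ 2 / 2) * cos c').
  have -> : \int[P]_w (cos (r * X w - c') * U w) =
     \int[P]_w (cos (r * X w - c') * V w +
       (2^-1 * (cos (S w + r * X w - (c' + c)) * V w) +
        2^-1 * (cos (S w + (- r) * X w - (c - c')) * V w))).
    apply: eq_Rintegral => w _.
    have -> : cos (S w + r * X w - (c' + c)) =
      cos (S w - c) * cos (r * X w - c') - sin (S w - c) * sin (r * X w - c').
      by rewrite -cosD; congr cos; ring.
    have -> : cos (S w + (- r) * X w - (c - c')) =
      cos (S w - c) * cos (r * X w - c') + sin (S w - c) * sin (r * X w - c').
      by rewrite -cosB; congr cos; ring.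
    by rewrite /U; field.
  have b1 : bounded_meas (fun w => cos (r * X w - c') * V w).
    by apply: bmM => //; exact: bSX.
  have b2 r' c'' : bounded_meas (fun w => cos (S w + r' * X w - c'') * V w).
    apply: bmM => //; apply: bSX; apply: measurable_funB => //.
    by apply: measurable_funD => //; exact: measurable_funM.
  have b3 r' c'' : bounded_meas (fun w => 2^-1 * (cos (S w + r' * X w - c'') * V w)).
    by apply: bmM => //; exact: bm_cst.
  rewrite RintegralD//; last 2 first.
  - exact: bounded_integrable.
  - by apply: bounded_integrable; exact: bmD.
  rewrite RintegralD//; last 2 first.
  - exact: bounded_integrable.
  - exact: bounded_integrable.
  rewrite !RintegralZl//; last 2 first.
  - exact: bounded_integrable.
  - exact: bounded_integrable.
  by rewrite H0 !H sqrrN cosD cosB; field.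
have bB : bounded_meas (fun w => \1_B (X w) : R).
  split; first by apply: measurableT_comp => //; exact: measurable_indic.
  by exists 1 => w; rewrite indicE ger0_norm//; case: (_ \in _).
have := weighted_charfun mX bU U0 HU mB.
have -> : \int[P]_w (\1_B (X w) * U w) =
   \int[P]_w (\1_B (X w) * V w + cos (S w - c) * (\1_B (X w) * V w)).
  by apply: eq_Rintegral => w _; rewrite /U; ring.
rewrite RintegralD//; last 2 first.
- by apply: bounded_integrable; exact: bmM.
- by apply: bounded_integrable; apply: bmM => //; exact: bmM.
rewrite (weighted_charfun mX bV V0 H0 mB) mulrDl => /addrI ->.
by ring.
Qed.

End WeightedCharfun.

(** * Joint laws from rectangles *)

Section JointLaw.
Context {R : realType} {d d1 d2 : measure_display} {T : measurableType d}
  {T1 : measurableType d1} {T2 : measurableType d2}.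
Variables (P : probability T R) (m1 : probability T1 R) (m2 : probability T2 R).
Variables (U : T -> T1) (V : T -> T2).
Hypotheses (mU : measurable_fun setT U) (mV : measurable_fun setT V).

(** Both sides are finite measures in [D] that agree on the pi-system of rectangles. The extra event
    [C] allows variables to be grouped one at a time. *)
Lemma joint_law (C : set T) (K : R) : measurable C -> 0 <= K ->
  (forall A B, measurable A -> measurable B ->
    P (C `&` (U @^-1` A `&` V @^-1` B)) = (K%:E * (m1 A * m2 B))%E) ->
  forall D, measurable D ->
    P (C `&` (fun w => (U w, V w)) @^-1` D) = (K%:E * (m1 \x m2)%E D)%E.
Proof.
move=> mC K0 H D mD.
have mUV : measurable_fun setT (fun w => (U w, V w)) by exact: measurable_fun_pair.
pose m0 : {measure set (T1 * T2) -> \bar R} := pushforward (mrestr P mC) (fun w => (U w, V w)).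
pose m' := m0 mUV.
pose m : {measure set (T1 * T2) -> \bar R} := mscale (NngNum K0) (m1 \x m2)%E.
suff : m' D = m D.
  by rewrite /m'/= /pushforward /mrestr setIC => ->.
pose G : set (set (T1 * T2)) :=
  [set C | exists A, measurable A /\ exists B, measurable B /\ C = A `*` B].
apply: (measure_unique G (fun=> setT)) => //.
- rewrite measurable_prod_measurableType //; congr (<<s _ >>).
  rewrite predeqE; split => [[A mA [B mB <-]]|[A [mA [B [mB ->]]]]].
    by exists A; split => //; exists B.
  by exists A => //; exists B.
- move=> /= _ _ [X1 [mX1 [X2 [mX2 ->]]]] [Y1 [mY1 [Y2 [mY2 ->]]]].
  rewrite -setXI; exists (X1 `&` Y1); split; first exact: measurableI.
  by exists (X2 `&` Y2); split => //; exact: measurableI.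
- by move=> _; exists setT; split => //; exists setT; split => //; rewrite setXTT.
- by rewrite bigcup_const//; exists 0%N.
- move=> _ [A [mA [B [mB ->]]]].
  rewrite /m' /m /= /pushforward /mrestr /mscale /= product_measure1E// -H//.
  by rewrite setIC.
- move=> _; rewrite /m' /= /pushforward /mrestr setIC.
  have mS : measurable (C `&` (fun w => (U w, V w)) @^-1` [set: T1 * T2]).
    by rewrite preimage_setT setIT.
  by rewrite (le_lt_trans (probability_le1 P mS))// ltry.
Qed.

Lemma integral_joint_law (f : T1 * T2 -> \bar R) :
  (forall A B, measurable A -> measurable B ->
    P (U @^-1` A `&` V @^-1` B) = (m1 A * m2 B)%E) ->
  measurable_fun setT f -> (forall z, (0 <= f z)%E) ->
  (\int[P]_w f (U w, V w) = \int[(m1 \x m2)%E]_z f z)%E.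
Proof.
move=> H mf f0.
have mUV : measurable_fun setT (fun w => (U w, V w)) by exact: measurable_fun_pair.
have -> : (\int[(m1 \x m2)%E]_z f z = \int[pushforward P (fun w => (U w, V w))]_z f z)%E.
  apply: eq_measure_integral => D mD _.
  have h : P ((fun w => (U w, V w)) @^-1` D) = (m1 \x m2)%E D.
    rewrite -[X in P X]setTI (joint_law measurableT ler01 _ mD) ?mul1e// => A B mA mB.
    by rewrite setTI mul1e H.
  exact: esym h.
by rewrite ge0_integral_pushforward.
Qed.

End JointLaw.

(** * Four independent standard normal variables *)

Section IID4.
Context {R : realType} {d : measure_display} {T : measurableType d}.
Variable P : probability T R.
Implicit Types X Y Z W : T -> R.
Local Notation RT := (measurableTypeR R).

(* Four independent standard normal variables, encoded by their joint characteristic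
   function so that invariance under rotations is immediate. *)
Definition iid4 X Y Z W :=
  [/\ measurable_fun setT X, measurable_fun setT Y,
      measurable_fun setT Z, measurable_fun setT W &
  forall a b c e r : R,
    \int[P]_w cos (a * X w + b * Y w + c * Z w + e * W w - r) =
    expR (- (a ^+ 2 + b ^+ 2 + c ^+ 2 + e ^+ 2) / 2) * cos r].

(** The four cosines are traded for indicators in turn; [V1], [V2], [V3] collect the indicators
    already obtained. *)
Lemma iid4_rect X Y Z W : iid4 X Y Z W ->
  forall A B C D : set RT, measurable A -> measurable B -> measurable C -> measurable D ->
  P (X @^-1` A `&` Y @^-1` B `&` Z @^-1` C `&` W @^-1` D) =
  (fine (gam A) * fine (gam B) * fine (gam C) * fine (gam D))%:E.
Proof.
move=> [mX mY mZ mW H] A B C D mA mB mC mD.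
have b0 : bounded_meas (fun _ : T => 1 : R) by exact: bm_cst.
have bmi (F : T -> R) (S : set RT) : measurable_fun setT F -> measurable S ->
    bounded_meas (fun w => \1_S (F w) : R).
  move=> mF mS; split; first by apply: measurableT_comp => //; exact: measurable_indic.
  by exists 1 => w; rewrite indicE ger0_norm//; case: (_ \in _).
have i0 (F : T -> R) (S : set RT) w : (0 <= \1_S (F w) :> R) by rewrite indicE.
pose gA : R := fine (gam A); pose gB : R := fine (gam B); pose gC : R := fine (gam C).
have s1 b c e r : \int[P]_w (cos ((b * Y w + c * Z w + e * W w) - r) * (\1_A (X w) * 1)) =
   expR (- (b ^+ 2 + c ^+ 2 + e ^+ 2) / 2) * gA * cos r.
  apply: (@weighted_charfun_step _ _ _ P X (fun w => b * Y w + c * Z w + e * W w) (fun=> 1) _ 1) => //.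
  - by apply: measurable_funD; [apply: measurable_funD|]; exact: measurable_funM.
  - move=> r' c'; have := H r' 0 0 0 c'; rewrite expr0n !addr0 mul1r => <-.
    by apply: eq_Rintegral => w _; rewrite !mul0r !addr0 mulr1.
  - move=> r' c'; rewrite mulrA -expRD.
    have -> : - (b ^+ 2 + c ^+ 2 + e ^+ 2) / 2 + - r' ^+ 2 / 2 =
              - (r' ^+ 2 + b ^+ 2 + c ^+ 2 + e ^+ 2) / 2 by field.
    rewrite -H; apply: eq_Rintegral => w _; rewrite mulr1; congr cos; ring.
pose V1 w : R := \1_A (X w) * 1.
have bV1 : bounded_meas V1 by apply: bmM => //; exact: bmi.
have V10 w : 0 <= V1 w by rewrite /V1 mulr1.
have s2 c e r : \int[P]_w (cos ((c * Z w + e * W w) - r) * (\1_B (Y w) * V1 w)) =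
   (expR (- (c ^+ 2 + e ^+ 2) / 2) * gA) * gB * cos r.
  apply: (@weighted_charfun_step _ _ _ P Y (fun w => c * Z w + e * W w) V1 _ gA) => //.
  - by apply: measurable_funD; exact: measurable_funM.
  - move=> r' c'; have := s1 r' 0 0 c'; rewrite expr0n !addr0 [X in X -> _](_ : _ = (\int[P]_w (cos (r' * Y w - c') * V1 w) = gA * (expR (- r' ^+ 2 / 2) * cos c')))//.
    congr (_ = _); last by ring.
    by apply: eq_Rintegral => w _; rewrite !mul0r !addr0.
  - move=> r' c'; transitivity (gA * (expR (- (c ^+ 2 + e ^+ 2) / 2) * expR (- r' ^+ 2 / 2)) * cos c'); last by ring.
    rewrite -expRD.
    have -> : - (c ^+ 2 + e ^+ 2) / 2 + - r' ^+ 2 / 2 =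
              - (r' ^+ 2 + c ^+ 2 + e ^+ 2) / 2 by field.
    rewrite [gA * _]mulrC -s1; apply: eq_Rintegral => w _; congr (cos _ * _); ring.
pose V2 w : R := \1_B (Y w) * V1 w.
have bV2 : bounded_meas V2 by apply: bmM => //; exact: bmi.
have V20 w : 0 <= V2 w by rewrite mulr_ge0.
have s3 e r : \int[P]_w (cos (e * W w - r) * (\1_C (Z w) * V2 w)) =
   (expR (- (e ^+ 2) / 2) * gA * gB) * gC * cos r.
  apply: (@weighted_charfun_step _ _ _ P Z (fun w => e * W w) V2 _ (gA * gB)) => //.
  - by exact: measurable_funM.
  - move=> r' c'; have := s2 r' 0 c'; rewrite expr0n !addr0 [X in X -> _](_ : _ = (\int[P]_w (cos (r' * Z w - c') * V2 w) = gA * gB * (expR (- r' ^+ 2 / 2) * cos c')))//.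
    congr (_ = _); last by ring.
    by apply: eq_Rintegral => w _; rewrite !mul0r !addr0.
  - move=> r' c'; transitivity (gA * gB * (expR (- (e ^+ 2) / 2) * expR (- r' ^+ 2 / 2)) * cos c'); last by ring.
    rewrite -expRD.
    have -> : - (e ^+ 2) / 2 + - r' ^+ 2 / 2 = - (r' ^+ 2 + e ^+ 2) / 2 by field.
    transitivity (expR (- (r' ^+ 2 + e ^+ 2) / 2) * gA * gB * cos c'); last by ring.
    rewrite -s2; apply: eq_Rintegral => w _; congr (cos _ * _); ring.
pose V3 w : R := \1_C (Z w) * V2 w.
have bV3 : bounded_meas V3 by apply: bmM => //; exact: bmi.
have V30 w : 0 <= V3 w by rewrite mulr_ge0.
have s4 : \int[P]_w (\1_D (W w) * V3 w) = (gA * gB * gC) * fine (gam D).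
  apply: (weighted_charfun mW bV3 V30) => // r c.
  transitivity (expR (- (r ^+ 2) / 2) * gA * gB * gC * cos c); last by ring.
  by rewrite -s3.
have mpre (F : T -> R) (S : set RT) : measurable_fun setT F -> measurable S -> measurable (F @^-1` S).
  by move=> mF mS; rewrite -[X in measurable X]setTI; exact: mF.
set E := (X in P X).
have mE : measurable E by do ! apply: measurableI; exact: mpre.
rewrite -s4 -[LHS]fineK; last exact: fin_num_measure.
congr _%:E.
have -> : P E = (\int[P]_w (\1_E w)%:E)%E by rewrite integral_indic// setIT.
apply: eq_Rintegral => w _.
rewrite /V3 /V2 /V1 mulr1 /E !indicI.
have e (F : T -> R) (S : set R) : \1_(F @^-1` S) w = \1_S (F w) :> R by rewrite !indicE.
by rewrite /= !e; ring.
Qed.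

(** The product law is built from the innermost pair outwards, the event on the variables not yet
    grouped playing the role of [C] in [joint_law]. *)
Lemma iid4_law (X Y Z W : T -> RT) : iid4 X Y Z W ->
  forall f : RT * (RT * (RT * RT)) -> \bar R,
  measurable_fun setT f -> (forall z, (0 <= f z)%E) ->
  (\int[P]_w f (X w, (Y w, (Z w, W w))) =
   \int[gam]_x \int[gam]_y \int[gam]_z \int[gam]_u f (x, (y, (z, u))))%E.
Proof.
move=> H f mf f0; have [mX mY mZ mW _] := H.
have mpre (F : T -> R) (S : set RT) : measurable_fun setT F -> measurable S -> measurable (F @^-1` S).
  by move=> mF mS; rewrite -[X in measurable X]setTI; exact: mF.
have gfin (S : set RT) : measurable S -> gam S = (fine (gam S))%:E.
  by move=> mS; rewrite fineK//; exact: fin_num_measure.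
have mZW : measurable_fun setT (fun w => (Z w, W w)) by exact: measurable_fun_pair.
have mYZW : measurable_fun setT (fun w => (Y w, (Z w, W w))) by exact: measurable_fun_pair.
have h2 (A B : set RT) (D : set (RT * RT)) : measurable A -> measurable B -> measurable D ->
    P (X @^-1` A `&` Y @^-1` B `&` (fun w => (Z w, W w)) @^-1` D) =
    ((fine (gam A) * fine (gam B))%:E * (gam \x gam)%E D)%E.
  move=> mA mB; apply: joint_law => //.
  - by apply: measurableI; exact: mpre.
  - by rewrite mulr_ge0// fine_ge0.
  - move=> C E mC mE; rewrite setIA iid4_rect// (gfin C)// (gfin E)// -!EFinM.
    by rewrite !mulrA.
have h3 (A : set RT) (D : set (RT * (RT * RT))) : measurable A -> measurable D ->
    P (X @^-1` A `&` (fun w => (Y w, (Z w, W w))) @^-1` D) =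
    ((fine (gam A))%:E * (gam \x (gam \x gam))%E D)%E.
  move=> mA; apply: joint_law => //.
  - exact: mpre.
  - by rewrite fine_ge0.
  - by move=> B D' mB mD'; rewrite setIA h2// (gfin B)// EFinM muleA.
rewrite (@integral_joint_law _ _ _ _ _ _ _ P gam (gam \x (gam \x gam))%E X
   (fun w => (Y w, (Z w, W w))))//; last first.
  by move=> A D mA mD; rewrite h3// -gfin.
rewrite fubini_tonelli1//.
apply: eq_integral => x _; rewrite /fubini_F.
have mfx : measurable_fun setT (fun z => f (x, z)) by exact: measurableT_comp mf (pair1_measurable x).
rewrite (fubini_tonelli1 _ mfx)//.
apply: eq_integral => y _; rewrite /fubini_F.
have mfy : measurable_fun setT (fun z => f (x, (y, z))) by exact: measurableT_comp mfx (pair1_measurable y).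
by rewrite (fubini_tonelli1 _ mfy).
Qed.

Lemma iid4_prob X Y Z W (A : set (RT * (RT * (RT * RT)))) : iid4 X Y Z W -> measurable A ->
  P [set w | A (X w, (Y w, (Z w, W w)))] =
  (\int[gam]_x \int[gam]_y \int[gam]_z \int[gam]_u (\1_A (x, (y, (z, u))))%:E)%E.
Proof.
move=> H mA; have [mX mY mZ mW _] := H.
have mA1 : measurable_fun setT (fun z => (\1_A z)%:E : \bar R).
  by apply/measurable_EFinP; exact: measurable_indic.
rewrite -(iid4_law H mA1)//.
have mF : measurable_fun setT (fun w => (X w, (Y w, (Z w, W w)))).
  by apply: measurable_fun_pair => //; apply: measurable_fun_pair => //; exact: measurable_fun_pair.
have mE : measurable [set w | A (X w, (Y w, (Z w, W w)))].
  by rewrite -[X in measurable X]setTI; exact: mF.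
transitivity (\int[P]_w (\1_[set w | A (X w, (Y w, (Z w, W w)))] w)%:E)%E.
  by rewrite integral_indic// setIT.
by apply: eq_integral => w _; rewrite !indicE.
Qed.

(** The last hypothesis says that the transposed linear map preserves the Euclidean norm; put on the
    coefficients, it is what the characteristic function consumes. *)
Lemma iid4_transform X Y Z W X' Y' Z' W' : iid4 X Y Z W ->
  measurable_fun setT X' -> measurable_fun setT Y' ->
  measurable_fun setT Z' -> measurable_fun setT W' ->
  (forall a b c e : R, exists a' b' c' e' : R,
    a' ^+ 2 + b' ^+ 2 + c' ^+ 2 + e' ^+ 2 = a ^+ 2 + b ^+ 2 + c ^+ 2 + e ^+ 2 /\
    forall w, a * X' w + b * Y' w + c * Z' w + e * W' w =
              a' * X w + b' * Y w + c' * Z w + e' * W w) ->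
  iid4 X' Y' Z' W'.
Proof.
move=> [mX mY mZ mW H] mX' mY' mZ' mW' h; split=> // a b c e r.
have [a' [b' [c' [e' [<- E]]]]] := h a b c e.
by rewrite -H; apply: eq_Rintegral => w _; rewrite E.
Qed.

End IID4.

(** * Coordinates of the processes *)

Section L2.
Context {R : realType} {d : measure_display} {T : measurableType d}.
Variable P : probability T R.
Implicit Types X Y Z : T -> R.
Local Notation RT := (measurableTypeR R).

Definition L2 X := measurable_fun setT X /\ P.-integrable setT (fun w => (X w ^+ 2)%:E).

Definition ip X Y : R := \int[P]_w (X w * Y w).

Lemma L2_mul X Y : L2 X -> L2 Y -> P.-integrable setT (fun w => (X w * Y w)%:E).
Proof.
move=> [mX iX] [mY iY].
apply: (@le_integrable _ _ _ P setT _ _ (fun w => (X w ^+ 2 + Y w ^+ 2)%:E)) => //.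
- by apply/measurable_EFinP; exact: measurable_funM.
- move=> w _; rewrite /= lee_fin normrM [leRHS]ger0_norm ?addr_ge0 ?sqr_ge0//.
  rewrite -(real_normK (num_real (X w))) -(real_normK (num_real (Y w))).
  have := sqr_ge0 (`|X w| - `|Y w|); have := sqr_ge0 (`|X w| + `|Y w|).
  by move: (`|X w|) (`|Y w|) => x y h1 h2; nra.
- by under eq_fun do rewrite EFinD; exact: integrableD.
Qed.

Lemma L2_cst r : L2 (fun=> r).
Proof. by split => //; apply: (bounded_integrable P); exact: bm_cst. Qed.

Lemma L2D X Y : L2 X -> L2 Y -> L2 (fun w => X w + Y w).
Proof.
move=> hX hY; split; first by case: hX => mX _; case: hY => mY _; exact: measurable_funD.
have -> : (fun w => ((X w + Y w) ^+ 2)%:E) =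
  (fun w => (X w ^+ 2)%:E + ((2 * (X w * Y w))%:E + (Y w ^+ 2)%:E))%E.
  by apply/funext => w; rewrite -!EFinD; congr EFin; ring.
apply: integrableD => //; first by case: hX.
apply: integrableD => //; last by case: hY.
under eq_fun do rewrite EFinM.
exact/integrableZl/L2_mul.
Qed.

Lemma L2Z r X : L2 X -> L2 (fun w => r * X w).
Proof.
move=> [mX iX]; split; first exact: measurable_funM.
under eq_fun do rewrite exprMn EFinM.
exact: integrableZl.
Qed.

Lemma ipC X Y : ip X Y = ip Y X.
Proof. by apply: eq_Rintegral => w _; rewrite mulrC. Qed.

Lemma ipDl X Y Z : L2 X -> L2 Y -> L2 Z -> ip (fun w => X w + Y w) Z = ip X Z + ip Y Z.
Proof.
move=> hX hY hZ; rewrite /ip -RintegralD//; last 2 first.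
- exact: L2_mul.
- exact: L2_mul.
by apply: eq_Rintegral => w _; rewrite mulrDl.
Qed.

Lemma ipZl r X Y : L2 X -> L2 Y -> ip (fun w => r * X w) Y = r * ip X Y.
Proof.
move=> hX hY; rewrite /ip -RintegralZl//; last exact: L2_mul.
by apply: eq_Rintegral => w _; rewrite mulrA.
Qed.

Lemma ipDr X Y Z : L2 X -> L2 Y -> L2 Z -> ip Z (fun w => X w + Y w) = ip Z X + ip Z Y.
Proof. by move=> *; rewrite ipC ipDl// (ipC X) (ipC Y). Qed.

Lemma ipZr r X Y : L2 X -> L2 Y -> ip Y (fun w => r * X w) = r * ip Y X.
Proof. by move=> *; rewrite ipC ipZl// ipC. Qed.

Lemma ip_EFin X Y : L2 X -> L2 Y -> (\int[P]_w (X w * Y w)%:E)%E = (ip X Y)%:E.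
Proof.
move=> hX hY; rewrite /ip /Rintegral fineK//.
by apply: integrable_fin_num => //; exact: L2_mul.
Qed.

Lemma ip_eq0 X : L2 X -> ip X X = 0 -> {ae P, forall w, X w = 0}.
Proof.
move=> hX h; have [mX _] := hX.
have mX2 : measurable_fun setT (fun w => (X w * X w)%:E).
  by apply/measurable_EFinP; exact: measurable_funM.
have := @ae_eq_integral_abs _ _ _ P setT measurableT _ mX2.
have -> : (\int[P]_(x in setT) `|(X x * X x)%:E| = 0)%E.
  rewrite -[RHS]/(0%:E) -h -ip_EFin//; apply: eq_integral => w _.
  by rewrite /= ger0_norm// -expr2 sqr_ge0.
case=> h1 _; have := h1 erefl; apply: filterS => w /= /(_ I) [].
by move/eqP; rewrite mulf_eq0 orbb => /eqP.
Qed.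

(** Dirac or normal, the law is that of [m + s z] for a standard normal [z], with [s = 0] in the
    degenerate case. *)
Lemma gaussian_law X : measurable_fun setT X -> gaussian_rv P X ->
  exists m s : R, forall G : R -> R, continuous G -> (forall x, 0 <= G x) ->
    (\int[P]_w (G (X w))%:E = \int[gam]_z (G (m + s * z))%:E)%E.
Proof.
move=> mX [m [s H]]; exists m, (`|s|) => G cG G0.
have mG : measurable_fun [set: RT] (EFin \o G).
  by apply/measurable_EFinP; exact: continuous_measurable_fun.
have mX' : measurable_fun setT (X : T -> RT) by [].
have -> : (\int[P]_w (G (X w))%:E = \int[pushforward P (X : T -> RT)]_x (G x)%:E)%E.
  by rewrite (ge0_integral_pushforward mX' P measurableT mG)// => x _; rewrite /= lee_fin.
have [s0|s0] := eqVneq s 0.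
  rewrite s0 normr0.
  under [RHS]eq_integral do rewrite mul0r addr0.
  rewrite (@eq_measure_integral _ _ _ _ (dirac (m : RT)))//; last first.
    by move=> A mA _; have := H A mA; rewrite s0 eqxx.
  rewrite integral_dirac// diracT mul1e.
  by rewrite integral_cst//= probability_setT mule1.
rewrite -integral_normal_affine//.
apply: eq_measure_integral => A mA _.
by have := H A mA; rewrite (negbTE s0).
Qed.

Lemma ip_shift X r : L2 X -> ip X (fun=> 1) = 0 ->
  \int[P]_w ((X w + r) ^+ 2) = ip X X + r ^+ 2.
Proof.
move=> hX X1.
transitivity (ip (fun w => X w + r) (fun w => X w + r)); first exact: eq_Rintegral.
have c1 : L2 (fun=> r : R) := L2_cst r.
have c2 : L2 (fun=> 1 : R) := L2_cst 1.
have hXr : L2 (fun w => X w + r) by exact: L2D.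
have Xr : ip X (fun=> r) = 0.
  have -> : (fun=> r) = (fun _ : T => r * (1 : R)) by apply/funext => w; rewrite mulr1.
  by rewrite ipZr// X1 mulr0.
rewrite ipDl// !ipDr// (ipC _ X) Xr /ip.
by rewrite bm_Rintegral_cst; ring.
Qed.

End L2.

(** * Characteristic functions of Gaussian variables and of independent sums *)

Section GaussianCharfun.
Context {R : realType} {d : measure_display} {T : measurableType d}.
Local Notation RT := (measurableTypeR R).
Variable P : probability T R.
Implicit Types X Y Z : T -> R.

Lemma L2_gam : L2 gam (fun z : R => z) /\ ip gam (fun z : R => z) (fun=> 1) = 0.
Proof.
split; last by rewrite -[RHS](@integral_gam_id R); apply: eq_Rintegral => z _; rewrite mulr1.
split; first exact: measurable_id.
apply: (@integrable_gam _ _ 1); first exact: measurable_funX.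
by move=> x; rewrite mul1r ger0_norm ?sqr_ge0// lerDr.
Qed.

Lemma gaussian_charfun X : L2 P X -> gaussian_rv P X -> ip P X (fun=> 1) = 0 ->
  forall c, \int[P]_w cos (X w - c) = expR (- ip P X X / 2) * cos c.
Proof.
move=> hX gX X1 c; have [mX _] := hX.
have [m [s H]] := gaussian_law mX gX.
have [hg g1] := L2_gam.
(* Only nonnegative functions pass through [gaussian_law], so the parameters are read off from the
   second moments of [X + r]: [r = 0] and [r = 1] give [m = 0], then [s^2]. *)
have sq r : \int[P]_w ((X w + r) ^+ 2) = \int[gam]_z ((m + s * z + r) ^+ 2).
  rewrite /Rintegral; congr fine; apply: (H (fun x => (x + r) ^+ 2)).
    move=> x; apply: (@continuous_comp _ _ _ (fun x => x + r) (fun y => y ^+ 2)).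
      by apply: cvgD; [exact: cvg_id|exact: cvg_cst].
    exact: exprn_continuous.
  by move=> x; rewrite sqr_ge0.
have sqg r : \int[gam]_z ((m + s * z + r) ^+ 2) = s ^+ 2 + (m + r) ^+ 2.
  transitivity (\int[gam]_z ((s * z + (m + r)) ^+ 2)).
    by apply: eq_Rintegral => z _; congr (_ ^+ 2); ring.
  rewrite (@ip_shift _ _ _ gam (fun z => s * z))//; last 2 first.
  - exact: L2Z.
  - by rewrite ipZl ?g1 ?mulr0//; exact: L2_cst.
  rewrite ipZl ?ipZr//; last exact: L2Z.
  have -> : ip gam (fun z : R => z) (fun z : R => z) = 1.
    by rewrite -(@integral_gam_sqr R); apply: eq_Rintegral => z _; rewrite expr2.
  by ring.
have E r : ip P X X + r ^+ 2 = s ^+ 2 + (m + r) ^+ 2 by rewrite -ip_shift// sq sqg.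
have m0 : m = 0 by have := E 1; have := E 0; lra.
have V : ip P X X = s ^+ 2 by have := E 0; rewrite m0; lra.
have bc (S : Type) d' (S' : measurableType d') (Q : probability S' R) (Y : S' -> R) : measurable_fun setT Y ->
   \int[Q]_w (1 + cos (Y w - c)) = 1 + \int[Q]_w cos (Y w - c).
  move=> mY; rewrite RintegralD//; last 2 first.
  - by apply: bounded_integrable; exact: bm_cst.
  - by apply: bounded_integrable; apply: bm_cos; exact: measurable_funB.
  by rewrite bm_Rintegral_cst.
have : \int[P]_w (1 + cos (X w - c)) = \int[gam]_z (1 + cos (s * z - c)).
  rewrite /Rintegral; congr fine.
  rewrite (H (fun x => 1 + cos (x - c))).
  - by apply: eq_integral => z _; rewrite m0 add0r.
  - move=> x; apply: cvgD; first exact: cvg_cst.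
    apply: (@continuous_comp _ _ _ (fun x => x - c) cos); last exact: continuous_cos.
    by apply: cvgB; [exact: cvg_id|exact: cvg_cst].
  - by move=> x; rewrite -lerBlDl sub0r cos_geN1.
rewrite (bc R)// (bc R); last exact: measurable_funM.
by rewrite integral_gam_cos => /addrI ->; rewrite V.
Qed.

(** That the integral is a multiple of [cos c] for every phase [c] means that the characteristic
    function is real; by Fubini the real factors multiply. *)
Lemma indep_charfun (X Y : T -> RT) (v1 v2 : R) : measurable_fun setT X -> measurable_fun setT Y ->
  (forall A B : set RT, measurable A -> measurable B ->
    P (X @^-1` A `&` Y @^-1` B) = (P (X @^-1` A) * P (Y @^-1` B))%E) ->
  (forall c, \int[P]_w cos (X w - c) = v1 * cos c) ->
  (forall c, \int[P]_w cos (Y w - c) = v2 * cos c) ->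
  forall c, \int[P]_w cos (X w + Y w - c) = v1 * v2 * cos c.
Proof.
move=> mX mY ind hX hY c.
have sX r : \int[P]_w cos (r - X w) = v1 * cos r.
  by rewrite -hX; apply: eq_Rintegral => w _; rewrite -cosN opprB.
pose Xr : {RV P >-> RT} := HB.pack X (isMeasurableFun.Build _ _ _ _ X mX).
pose Yr : {RV P >-> RT} := HB.pack Y (isMeasurableFun.Build _ _ _ _ Y mY).
have mc : measurable_fun setT (fun z : RT * RT => cos (z.1 + z.2 - c)).
  by have [] := @bm_cos _ _ _ (fun z : RT * RT => z.1 + z.2 - c) (measurable_funB (measurable_funD measurable_fst measurable_snd) (measurable_cst _)).
pose f (z : RT * RT) := (1 + cos (z.1 + z.2 - c))%:E.
have f0 z : (0 <= f z)%E by rewrite lee_fin -lerBlDl sub0r cos_geN1.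
have mf : measurable_fun setT f.
  by apply/measurable_EFinP; exact: measurable_funD.
have := @integral_joint_law _ _ _ _ _ _ _ P (distribution P Xr) (distribution P Yr) Xr Yr mX mY f ind mf f0.
rewrite fubini_tonelli1// /fubini_F.
have bc d' (S' : measurableType d') (Q : probability S' R) (Z : S' -> R) : measurable_fun setT Z ->
   (\int[Q]_w (1 + cos (Z w))%:E = (1 + \int[Q]_w cos (Z w))%:E)%E.
  move=> mZ; rewrite bounded_EFin_Rintegral//; last first.
    by apply: bmD; [exact: bm_cst|exact: bm_cos].
  rewrite RintegralD//; last 2 first.
  - by apply: bounded_integrable; exact: bm_cst.
  - by apply: bounded_integrable; exact: bm_cos.
  by rewrite bm_Rintegral_cst.
under [in RHS]eq_integral => x _.
  rewrite ge0_integral_distribution//; last first.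
    exact: (measurableT_comp mf (pair1_measurable x)).
  rewrite (_ : _ \o _ = (fun w => (1 + cos (Y w - (c - x)))%:E)); last first.
    by apply/funext => w; rewrite /f/=; congr (1 + cos _)%:E; ring.
  rewrite bc; last exact: measurable_funB.
  rewrite hY.
  over.
have mcx : measurable_fun [set: RT] (fun x : RT => c - x) by exact: measurable_funB.
have bcx : bounded_meas (fun x : RT => cos (c - x)) by exact: bm_cos.
have m2 : measurable_fun [set: RT] (fun x : RT => (1 + v2 * cos (c - x))%:E).
  apply/measurable_EFinP; apply: measurable_funD => //; apply: measurable_funM => //.
  by case: bcx.
have p2 x : (0 <= (1 + v2 * cos (c - x))%:E)%E.
  rewrite -hY -(bc _ _ P); last exact: measurable_funB.
  by apply: integral_ge0 => w _; rewrite lee_fin -lerBlDl sub0r cos_geN1.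
rewrite ge0_integral_distribution//.
have bX : bounded_meas (fun w => v2 * cos (c - X w)).
  apply: bmM; first exact: bm_cst.
  by apply: bm_cos; exact: measurable_funB.
have -> : (\int[P]_x ((fun x => (1 + v2 * cos (c - x))%:E) \o Xr) x = (1 + v2 * (v1 * cos c))%:E)%E.
  rewrite bounded_EFin_Rintegral//; last by apply: bmD => //; exact: bm_cst.
  rewrite RintegralD//; last 2 first.
  - by apply: bounded_integrable; exact: bm_cst.
  - exact: bounded_integrable.
  rewrite bm_Rintegral_cst RintegralZl ?sX//.
  by apply: bounded_integrable; apply: bm_cos; exact: measurable_funB.
rewrite [LHS](bc _ _ P (fun w => X w + Y w - c)); last first.
  by apply: measurable_funB => //; exact: measurable_funD.
by move=> [] /addrI ->; ring.
Qed.

End GaussianCharfun.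

(** * The two Gaussian coordinates of each process *)

Section ProcessCoordinates.
Context {R : realType} {d : measure_display} {T : measurableType d}.
Variables (P : probability T R) (alpha : R).
Hypothesis sal : sin alpha != 0.
Local Notation RT := (measurableTypeR R).

(** [ccoord] and [scoord] are Cramer's solution of the system that expresses [a 1] and [a 2] in the
    cosines and sines of [alpha] and [2 alpha]; its determinant is [sin alpha]. *)
Definition ccoord (a : nat -> T -> R) w : R :=
  (a 1%N w * sin (2 * alpha) - a 2%N w * sin alpha) / sin alpha.

Definition scoord (a : nat -> T -> R) w : R :=
  (a 2%N w * cos alpha - a 1%N w * cos (2 * alpha)) / sin alpha.

(** The quadratic form in [c1], [c2] is the variance of [c1 a 1 + c2 a 2], so its value states that
    the two coordinates are orthonormal. *)
Lemma coord_combination (a : nat -> T -> R) x y : exists c1 c2 : R,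
  [/\ (fun w => x * ccoord a w + y * scoord a w) = (fun w => c1 * a 1%N w + c2 * a 2%N w),
      c1 ^+ 2 + c2 ^+ 2 + 2 * c1 * c2 * cos alpha = x ^+ 2 + y ^+ 2 &
      c1 = (x * sin (2 * alpha) - y * cos (2 * alpha)) / sin alpha /\
      c2 = (y * cos alpha - x * sin alpha) / sin alpha].
Proof.
exists ((x * sin (2 * alpha) - y * cos (2 * alpha)) / sin alpha).
exists ((y * cos alpha - x * sin alpha) / sin alpha); split => //.
  by apply/funext => w; rewrite /ccoord /scoord; field.
have -> : 2 * alpha = alpha + alpha by ring.
rewrite sinD cosD; have := cos2Dsin2 alpha; move: (cos alpha) sal => c.
move: (sin alpha) => s s0 h.
have {}h : c ^+ 2 = 1 - s ^+ 2 by rewrite -h; ring.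
have -> : (x * (s * c + c * s) - y * (c * c - s * s)) / s =
  (2 * x * s * c - y * (c ^+ 2 - s ^+ 2)) / s by field.
rewrite h.
apply: (mulIf (expf_neq0 2 s0)).
transitivity ((2 * x * s * c - y * (1 - s ^+ 2 - s ^+ 2)) ^+ 2 + (y * c - x * s) ^+ 2 +
  2 * (2 * x * s * c - y * (1 - s ^+ 2 - s ^+ 2)) * (y * c - x * s) * c).
  by field.
transitivity (4 * x ^+ 2 * s ^+ 2 * c ^+ 2 - 4 * x * y * s * c * (1 - 2 * s ^+ 2) + y ^+ 2 * (1 - 2 * s ^+ 2) ^+ 2
   + y ^+ 2 * c ^+ 2 - 2 * x * y * s * c + x ^+ 2 * s ^+ 2
   + 2 * (2 * x * y * s * c * c ^+ 2 - 2 * x ^+ 2 * s ^+ 2 * c ^+ 2 - y ^+ 2 * (1 - 2 * s ^+ 2) * c ^+ 2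
     + x * y * s * c * (1 - 2 * s ^+ 2))).
  by ring.
by rewrite h; ring.
Qed.

Section OneProcess.
Variable a : nat -> {RV P >-> R}.
Hypothesis gauss_a : gaussian_process P a.
Hypothesis centered_a : centered_process P a.
Hypothesis cov_a : forall k l : nat, (0 < k)%N -> (0 < l)%N ->
  ('E_P[a k \* a l])%E = (cos ((k%:R - l%:R) * alpha))%:E.

Lemma process_L2 k : (0 < k)%N -> L2 P (a k).
Proof.
move=> k0; have mk : measurable_fun setT (a k) by exact: measurable_funPT.
split => //; apply/integrableP; split.
  by apply/measurable_EFinP; exact: measurable_funX.
have := cov_a k0 k0; rewrite subrr mul0r cos0 unlock => h.
under eq_integral do rewrite /= ger0_norm ?sqr_ge0// expr2.
by rewrite h ltry.
Qed.

Lemma process_ip k l : (0 < k)%N -> (0 < l)%N -> ip P (a k) (a l) = cos ((k%:R - l%:R) * alpha).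
Proof. by move=> k0 l0; have := cov_a k0 l0; rewrite unlock => h; rewrite /ip /Rintegral h. Qed.

Lemma process_mean k : (0 < k)%N -> ip P (a k) (fun=> 1) = 0.
Proof.
move=> k0; have := centered_a k0; rewrite unlock => h; rewrite /ip /Rintegral.
by under eq_integral do rewrite mulr1; rewrite h.
Qed.

Lemma combination_L2 c1 c2 : L2 P (fun w => c1 * a 1%N w + c2 * a 2%N w).
Proof. by apply: L2D; apply: L2Z; exact: process_L2. Qed.

Lemma process_charfun x y c :
  \int[P]_w cos (x * ccoord a w + y * scoord a w - c) =
  expR (- (x ^+ 2 + y ^+ 2) / 2) * cos c.
Proof.
have [c1 [c2 [E V _]]] := coord_combination a x y.
have h1 := process_L2 (isT : (0 < 1)%N); have h2 := process_L2 (isT : (0 < 2)%N).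
have k1 := L2Z c1 h1; have k2 := L2Z c2 h2.
have -> : x ^+ 2 + y ^+ 2 = ip P (fun w => c1 * a 1%N w + c2 * a 2%N w) (fun w => c1 * a 1%N w + c2 * a 2%N w).
  have := combination_L2 c1 c2 => hc.
  rewrite ipDl// !ipDr// !ipZl// !ipZr// !process_ip// -V !subrr mul0r cos0.
  have -> : (1%:R - 2%:R) * alpha = - alpha by ring.
  have -> : (2%:R - 1%:R) * alpha = alpha by ring.
  by rewrite cosN; ring.
rewrite -gaussian_charfun.
- by apply: eq_Rintegral => w _; have := congr1 (@^~ w) E => /= ->.
- exact: combination_L2.
- have := gauss_a 2 (fun k => if k == 1%N then c1 else c2).
  by congr (gaussian_rv P _); apply/funext => w; rewrite big_ltn// big_nat1.
- have h := @L2_cst _ _ _ P 1.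
  by rewrite ipDl// !ipZl// !process_mean// !mulr0 addr0.
Qed.

(* The covariance makes the second moment of the difference of both sides vanish. *)
Lemma process_repr : {ae P, forall w, forall k, (0 < k)%N ->
  a k w = ccoord a w * cos (k%:R * alpha) + scoord a w * sin (k%:R * alpha)}.
Proof.
apply/ae_foralln => k; have [->|k0] := posnP k; first by apply: aeW.
have [c1 [c2 [E _ [c1E c2E]]]] := coord_combination a (- cos (k%:R * alpha)) (- sin (k%:R * alpha)).
have h1 := process_L2 (isT : (0 < 1)%N); have h2 := process_L2 (isT : (0 < 2)%N).
have hk := process_L2 k0.
have k1 := L2Z c1 h1; have k2 := L2Z c2 h2.
have hc := combination_L2 c1 c2.
have hD : L2 P (fun w => a k w + (c1 * a 1%N w + c2 * a 2%N w)) by exact: L2D.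
have : ip P (fun w => a k w + (c1 * a 1%N w + c2 * a 2%N w)) (fun w => a k w + (c1 * a 1%N w + c2 * a 2%N w)) = 0.
  rewrite !(ipDl, ipDr)// !(ipZl, ipZr)// !process_ip// !subrr mul0r cos0.
  (* All the angles are now combinations of [th] and [alpha], and the vanishing of the variance
     becomes a polynomial identity modulo the two Pythagorean relations. *)
  pose th : R := (k%:R - 2%:R) * alpha.
  have -> : (1%:R - 2%:R) * alpha = - alpha by ring.
  have -> : (2%:R - 1%:R) * alpha = alpha by ring.
  have -> : (1%:R - k%:R) * alpha = - (th + alpha) by rewrite /th; ring.
  have -> : (k%:R - 1%:R) * alpha = th + alpha by rewrite /th; ring.
  have -> : (2%:R - k%:R) * alpha = - th by rewrite /th; ring.
  rewrite -/th !cosN.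
  have e1 : c1 = sin th / sin alpha.
    rewrite c1E; congr (_ / _).
    by rewrite (_ : th = k%:R * alpha - 2 * alpha) ?sinB; [ring|rewrite /th; ring].
  have e2 : c2 = - sin (th + alpha) / sin alpha.
    rewrite c2E; congr (_ / _).
    by rewrite (_ : th + alpha = k%:R * alpha - alpha) ?sinB; [ring|rewrite /th; ring].
  rewrite e1 e2 sinD cosD.
  have := cos2Dsin2 alpha; have := cos2Dsin2 th; move: (cos alpha) sal => c.
  move: (sin alpha) => s s0; move: (sin th) (cos th) => st ct h3 h4.
  have {}h4 : c ^+ 2 = 1 - s ^+ 2 by rewrite -h4; ring.
  have {}h3 : ct ^+ 2 = 1 - st ^+ 2 by rewrite -h3; ring.
  apply: (mulIf (expf_neq0 2 s0)); rewrite mul0r.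
  transitivity (s ^+ 2 + st ^+ 2 - st ^+ 2 * c ^+ 2 - s ^+ 2 * ct ^+ 2 - 2 * st ^+ 2 * s ^+ 2).
    by field.
  by rewrite h3 h4; ring.
move=> /(ip_eq0 hD); apply: filterS => w /= h _.
have /= := congr1 (@^~ w) E; lra.
Qed.

Lemma combination_sigma x y (A : set RT) : measurable A ->
  sigma_process a ((fun w => x * ccoord a w + y * scoord a w) @^-1` A).
Proof.
move=> mA; have [c1 [c2 [-> _ _]]] := coord_combination a x y.
pose G := \bigcup_(k in [set k | (0 < k)%N]) preimage_set_system setT (a k) (@measurable _ R).
(* The sample space with the sigma-algebra generated by the process, so that measurability of the
   combination for [TG] is membership in [sigma_process]. *)
pose TG := g_sigma_algebraType G.
have mk k : (0 < k)%N -> measurable_fun setT (a k : TG -> R).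
  move=> k0 _ B mB; apply: sub_sigma_algebra; exists k => //; exists B => //.
have m : measurable_fun setT ((fun w => c1 * a 1%N w + c2 * a 2%N w) : TG -> R).
  by apply: measurable_funD; apply: measurable_funM => //; exact: mk.
by have := m measurableT A mA; rewrite setTI.
Qed.

End OneProcess.

Section TwoProcesses.
Variables a b : nat -> {RV P >-> R}.
Hypotheses (gauss_a : gaussian_process P a) (gauss_b : gaussian_process P b).
Hypotheses (centered_a : centered_process P a) (centered_b : centered_process P b).
Hypothesis indep_ab : independent_processes P a b.
Hypothesis cov_a : forall k l : nat, (0 < k)%N -> (0 < l)%N ->
  ('E_P[a k \* a l])%E = (cos ((k%:R - l%:R) * alpha))%:E.
Hypothesis cov_b : forall k l : nat, (0 < k)%N -> (0 < l)%N ->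
  ('E_P[b k \* b l])%E = (cos ((k%:R - l%:R) * alpha))%:E.

Lemma measurable_ccoord (c : nat -> {RV P >-> R}) : measurable_fun setT (ccoord c).
Proof.
apply: measurable_funM => //; apply: measurable_funB; apply: measurable_funM => //;
  exact: measurable_funPT.
Qed.

Lemma measurable_scoord (c : nat -> {RV P >-> R}) : measurable_fun setT (scoord c).
Proof.
apply: measurable_funM => //; apply: measurable_funB; apply: measurable_funM => //;
  exact: measurable_funPT.
Qed.

(** The characteristic function splits over the two processes by independence, and over the
    coordinates of each by orthonormality. *)
Lemma iid4_coord : iid4 P (ccoord a) (scoord a) (ccoord b) (scoord b).
Proof.
split; [exact: measurable_ccoord|exact: measurable_scoord|
  exact: measurable_ccoord|exact: measurable_scoord|] => x y z v r.
have mab (c : nat -> {RV P >-> R}) s t : measurable_fun setT (fun w => s * ccoord c w + t * scoord c w).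
  by apply: measurable_funD; apply: measurable_funM => //;
    [exact: measurable_ccoord|exact: measurable_scoord].
transitivity (\int[P]_w cos ((x * ccoord a w + y * scoord a w) + (z * ccoord b w + v * scoord b w) - r)).
  by apply: eq_Rintegral => w _; congr cos; ring.
rewrite (@indep_charfun _ _ _ P _ _ (expR (- (x ^+ 2 + y ^+ 2) / 2)) (expR (- (z ^+ 2 + v ^+ 2) / 2)))//.
- by rewrite -expRD; congr (expR _ * _); field.
- exact: mab.
- exact: mab.
- by move=> A B mA mB; apply: indep_ab; exact: combination_sigma.
- exact: process_charfun.
- exact: process_charfun.
Qed.

(* Up to the factor [sqrt 2], the coefficients of the cosine and sine Dirichlet kernels
   at [t + alpha] (index 1) and [t - alpha] (index 2) in [2 * sum_k]. *)
Definition X1 w := (ccoord a w - scoord b w) / Num.sqrt 2.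
Definition Y1 w := (scoord a w + ccoord b w) / Num.sqrt 2.
Definition X2 w := (ccoord a w + scoord b w) / Num.sqrt 2.
Definition Y2 w := (ccoord b w - scoord a w) / Num.sqrt 2.

Lemma iid4_rotated : iid4 P X1 Y1 X2 Y2.
Proof.
have ma := measurable_ccoord a; have ma' := measurable_scoord a.
have mb := measurable_ccoord b; have mb' := measurable_scoord b.
apply: (iid4_transform iid4_coord).
- by rewrite /X1; apply: measurable_funM => //; exact: measurable_funB.
- by rewrite /Y1; apply: measurable_funM => //; exact: measurable_funD.
- by rewrite /X2; apply: measurable_funM => //; exact: measurable_funD.
- by rewrite /Y2; apply: measurable_funM => //; exact: measurable_funB.
move=> x y z v.
have s2 : (Num.sqrt 2 : R) != 0 by rewrite gt_eqF// sqrtr_gt0.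
have s22 : (Num.sqrt 2 : R) ^+ 2 = 2 by rewrite sqr_sqrtr.
exists ((x + z) / Num.sqrt 2), ((y - v) / Num.sqrt 2),
  ((y + v) / Num.sqrt 2), ((z - x) / Num.sqrt 2); split.
  by rewrite !expr_div_n s22; field.
by move=> w; rewrite /X1 /Y1 /X2 /Y2; field.
Qed.

End TwoProcesses.

End ProcessCoordinates.

(** * Probability of a quadratic cone *)

Section Sweep.
Context {R : realType}.
Local Notation mu := (@lebesgue_measure R).

Lemma continuous_antiderivative (h : R -> R) (M : R) : continuous h -> 0 < M ->
  exists H : R -> R, forall y, - M < y -> y < M -> is_derive y (1:R) H (h y).
Proof.
move=> ch M0; exists (fun y => \int[mu]_(t in `[- M, y]) h t) => y My yM.
have iM : mu.-integrable `[- M, M] (EFin \o h).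
  apply: continuous_compact_integrable; first exact: segment_compact.
  exact: continuous_subspaceT.
have [dF FE] := continuous_FTC1_closed yM iM My (ch y).
apply: DeriveDef; first exact: dF.
by move: FE; rewrite derive1E.
Qed.

Lemma FTC2_is_derive (f F : R -> R) (a b : R) : a <= b ->
  (forall x, a <= x -> x <= b -> is_derive x (1:R) F (f x)) -> {within `[a, b], continuous f} ->
  (\int[mu]_(x in `[a, b]) (f x)%:E = (F b - F a)%:E)%E.
Proof.
rewrite le_eqVlt => /predU1P[<- _ _|ab dF cf].
  by rewrite set_itv1 integral_set1 subrr.
have cF x : a <= x -> x <= b -> {for x, continuous F}.
  move=> ax xb; have dx := dF x ax xb.
  by apply: differentiable_continuous; apply/derivable1_diffP; exact: ex_derive.
rewrite EFinB; apply: continuous_FTC2 => //.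
- split.
  + move=> x; rewrite in_itv/= => /andP[ax xb]; have := dF x (ltW ax) (ltW xb) => dx.
    exact: ex_derive.
  + apply: cvg_at_right_filter; apply: cF => //; exact: ltW.
  + apply: cvg_at_left_filter; apply: cF => //; exact: ltW.
- move=> x; rewrite in_itv/= => /andP[ax xb]; have [_ <-] := dF x (ltW ax) (ltW xb).
  by rewrite derive1E.
Qed.

Lemma ge0_integral_itv_split (f : R -> R) (a b c : R) : a <= b -> b <= c ->
  measurable_fun setT f -> (forall x, 0 <= f x) ->
  (\int[mu]_(x in `[a, c]) (f x)%:E =
   \int[mu]_(x in `[a, b]) (f x)%:E + \int[mu]_(x in `[b, c]) (f x)%:E)%E.
Proof.
move=> ab bc mf f0.
have mfE (S : set R) : measurable_fun S (EFin \o f).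
  by apply: (measurable_funS measurableT) => //; exact/measurable_EFinP.
rewrite -[X in (_ + X)%E](integral_itv_obnd_cbnd (mfE _)).
rewrite -ge0_integral_setU//=.
- congr (integral _ _ _); apply/seteqP; split => x /=; rewrite !in_itv/=.
    by move=> /andP[ax xc]; have [xb|bx] := leP x b; [left|right]; apply/andP.
  move=> [] /andP[h1 h2]; apply/andP; split => //.
    exact: le_trans h2 bc.
  exact: le_trans ab (ltW h1).
- exact: mfE.
- by move=> x _; rewrite lee_fin.
- apply/disj_setPLR => x /=; rewrite !in_itv/= => /andP[_ xb] /andP[bx _].
  by move: (lt_le_trans bx xb); rewrite ltxx.
Qed.

(** On an arc where [phi] increases, the integrand is the derivative of [H] composed with [phi]. *)
Lemma arc_sweep (h H phi dphi : R -> R) (M a b : R) : a <= b -> continuous h -> continuous dphi ->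
  (forall y, - M < y -> y < M -> is_derive y (1:R) H (h y)) ->
  (forall u : R, is_derive u (1:R) phi (dphi u)) -> (forall u, - M < phi u /\ phi u < M) ->
  (forall u, a <= u -> u <= b -> 0 <= dphi u) ->
  (\int[mu]_(u in `[a, b]) (h (phi u) * `|dphi u|)%:E = (H (phi b) - H (phi a))%:E)%E.
Proof.
move=> ab ch cd dH dp pM d0.
have cphi : continuous phi := continuous_derivable dp.
transitivity (\int[mu]_(u in `[a, b]) (h (phi u) * dphi u)%:E)%E.
  apply: eq_integral => u; rewrite inE/= in_itv/= => /andP[au ub].
  by rewrite ger0_norm// d0.
apply: (@FTC2_is_derive _ (H \o phi)) => //.
- move=> u _ _; have [p1 p2] := pM u.
  have i1 := dH _ p1 p2; have i2 := dp u.
  by apply: is_derive_eq; rewrite /GRing.scale/= mulrC.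
- apply: continuous_subspaceT => u; apply: cvgM; last exact: cd.
  by apply: continuous_comp; [exact: cphi|exact: ch].
Qed.

(** A decreasing arc becomes an increasing one on replacing [phi] by its opposite and [h] by its
    reflection. *)
Lemma arc_sweep_abs (h H phi dphi : R -> R) (M a b : R) : a <= b -> continuous h -> continuous dphi ->
  (forall y, - M < y -> y < M -> is_derive y (1:R) H (h y)) ->
  (forall u : R, is_derive u (1:R) phi (dphi u)) -> (forall u, - M < phi u /\ phi u < M) ->
  (forall y, 0 <= h y) ->
  (forall u, a <= u -> u <= b -> 0 <= dphi u) \/ (forall u, a <= u -> u <= b -> dphi u <= 0) ->
  (\int[mu]_(u in `[a, b]) (h (phi u) * `|dphi u|)%:E = `|H (phi b) - H (phi a)|%:E)%E.
Proof.
move=> ab ch cd dH dp pM h0 hs.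
have I0 : (0 <= \int[mu]_(u in `[a, b]) (h (phi u) * `|dphi u|)%:E)%E.
  by apply: integral_ge0 => u _; rewrite lee_fin mulr_ge0.
case: hs => hs.
  have E := arc_sweep ab ch cd dH dp pM hs.
  by rewrite E ger0_norm// -lee_fin -E.
have ch' : continuous (h \o -%R).
  by move=> y; apply: continuous_comp; [exact: opp_continuous|exact: ch].
have E := @arc_sweep (h \o -%R) (fun y => - H (- y)) (fun u => - phi u) (fun u => - dphi u) M a b ab ch'.
have {E} : (\int[mu]_(u in `[a, b]) (h (phi u) * `|dphi u|)%:E = (- (H (phi b) - H (phi a)))%:E)%E.
  transitivity (\int[mu]_(u in `[a, b]) ((h \o -%R) (- phi u) * `|- dphi u|)%:E)%E.
    by apply: eq_integral => u _; rewrite /= opprK normrN.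
  transitivity (- H (- - phi b) - - H (- - phi a))%:E; last by rewrite !opprK; congr EFin; ring.
  apply: E.
  - by move=> u; apply: cvgN; exact: cd.
  - move=> y y1 y2; have dy : is_derive (- y) (1:R) H (h (- y)) by apply: dH; lra.
    have := @is_deriveN _ _ _ id y 1 1 _ => dN.
    by apply: is_derive_eq; rewrite /GRing.scale/=; ring.
  - by move=> u; have := pM u; lra.
  - by move=> u au ub; rewrite oppr_ge0; exact: hs.
move=> E; rewrite E distrC ger0_norm ?opprB// -opprB -lee_fin -E//.
Qed.

(** Reducing the phase modulo [pi] instead of [2 pi], at the price of a sign in [r'], keeps [0],
    [psi], [psi + pi], [2 pi] in this order. *)
Lemma phase (X Y r : R) : X ^+ 2 + Y ^+ 2 = r ^+ 2 -> 0 < r ->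
  exists psi r' : R, [/\ 0 <= psi, psi <= pi, `|r'| = r &
    forall u : R, X * sin u + Y * cos u = r' * cos (u - psi)].
Proof.
move=> XYr r0; have [b [Yb Xb]] : exists b, Y = r * cos b /\ X = r * sin b.
  by apply: polar => //; rewrite addrC.
pose k := Num.floor (b / pi); pose c := cos (k%:~R * pi : R).
have pi0 := @pi_gt0 R.
have sk : sin (k%:~R * pi) = 0 :> R.
  by apply/eqP; rewrite -normr_eq0 -[k%:~R * pi]add0r sinDpik sin0 normr0.
exists (b - k%:~R * pi), (r * c); split.
- by rewrite subr_ge0 -ler_pdivlMr// floor_le.
- by rewrite lerBlDr -{1}[pi]mul1r -mulrDl -ler_pdivrMr// addrC -[1]/(1%:~R) -intrD ltW// floorD1_gt.
- by rewrite normrM (gtr0_norm r0) /c -[k%:~R * pi]add0r cosDpik cos0 normr1 mulr1.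
- move=> u; rewrite Xb Yb opprB addrA [u + _]addrC -addrA cosD sk mul0r subr0 cosB.
  have c2 : c * c = 1 by have := cos2Dsin2 (k%:~R * pi : R); rewrite sk expr0n addr0 expr2.
  transitivity (r * (c * c) * (cos u * cos b + sin u * sin b)); last by rewrite /c; ring.
  by rewrite c2; ring.
Qed.

(* Over a period, [X sin u + Y cos u] runs through [[-r, r]] exactly twice. *)
Lemma sweep (h : R -> R) (X Y r : R) : continuous h -> (forall y, 0 <= h y) ->
  X ^+ 2 + Y ^+ 2 = r ^+ 2 -> 0 < r ->
  (\int[mu]_(u in `[0%R, (2 * pi)%R]) (h (- (X * sin u + Y * cos u)) * `|Y * sin u - X * cos u|)%:E =
   2%:E * \int[mu]_(y in `[(- r)%R, r]) (h y)%:E)%E.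
Proof.
move=> ch h0 XYr r0.
have [psi [r' [psi0 psipi rr' E]]] := phase XYr r0.
have pi0 := @pi_gt0 R.
pose M := r + 1.
have [H dH] : exists H : R -> R, forall y, - M < y -> y < M -> is_derive y (1:R) H (h y).
  by apply: continuous_antiderivative => //; rewrite /M; lra.
pose phi u : R := - (X * sin u + Y * cos u).
pose dphi u : R := Y * sin u - X * cos u.
have dp (u : R) : is_derive u (1:R) phi (dphi u).
  by rewrite /phi; apply: is_derive_eq; rewrite /GRing.scale/= /dphi; ring.
have phiE u : phi u = - r' * cos (u - psi) by rewrite /phi E mulNr.
have dphiE u : dphi u = r' * sin (u - psi).
  have d1 := dp u.
  have d2 : is_derive u (1:R) phi (r' * sin (u - psi)).
    rewrite (_ : phi = fun u => - r' * cos (u - psi)); last by apply/funext.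
    by apply: is_derive_eq; rewrite /GRing.scale/=; ring.
  by rewrite -(@derive_val _ _ _ _ _ _ _ d1) (@derive_val _ _ _ _ _ _ _ d2).
have cphi : continuous phi := continuous_derivable dp.
have cdphi : continuous dphi.
  move=> u; apply: cvgB; apply: cvgM; try exact: cvg_cst.
    exact: continuous_sin.
  exact: continuous_cos.
have pr u : `|phi u| <= r.
  by rewrite phiE normrM normrN rr' ler_piMr ?(ltW r0)// ler_norml cos_geN1 cos_le1.
have pM u : - M < phi u /\ phi u < M.
  by have := pr u; rewrite ler_norml /M => /andP[]; lra.
have mf : measurable_fun setT (fun u => h (phi u) * `|dphi u|).
  apply: measurable_funM.
    by apply: continuous_measurable_fun => u; apply: continuous_comp; [exact: cphi|exact: ch].
  apply: measurableT_comp => //.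
  exact: continuous_measurable_fun.
have f0 u : 0 <= h (phi u) * `|dphi u| by rewrite mulr_ge0.
have sgn a b (s : R) : a <= b -> (forall u, a <= u -> u <= b -> 0 <= s * sin (u - psi)) -> s != 0 ->
   (\int[mu]_(u in `[a, b]) (h (phi u) * `|dphi u|)%:E = `|H (phi b) - H (phi a)|%:E)%E.
  move=> ab hs s0; apply: arc_sweep_abs ab ch cdphi dH dp pM h0 _.
  have [r's|r's] := leP 0 (r' * s).
    left => u au ub; have := hs u au ub; rewrite dphiE.
    have [->|sn0] := eqVneq (sin (u - psi)) 0; first by rewrite !mulr0.
    by move: sn0 s0 r's; move: (sin _) => v; nra.
  right => u au ub; have := hs u au ub; rewrite dphiE.
  by move: (sin _) => v; nra.
have mono x y : x <= y -> - r <= x -> y <= r -> H x <= H y.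
  move=> xy rx yr; have E' : (\int[mu]_(x in `[x, y]) (h x)%:E = (H y - H x)%:E)%E.
    apply: FTC2_is_derive => //; last exact: continuous_subspaceT.
    by move=> u xu uy; apply: dH; rewrite /M; lra.
  rewrite -subr_ge0 -lee_fin -E'.
  by apply: integral_ge0 => u _; rewrite lee_fin.
have FI : (\int[mu]_(y in `[(- r)%R, r]) (h y)%:E = (H r - H (- r))%:E)%E.
  apply: FTC2_is_derive; first by lra.
  - by move=> u xu uy; apply: dH; rewrite /M; lra.
  - exact: continuous_subspaceT.
(* The period is cut at [psi] and [psi + pi], where the derivative [r' sin (u - psi)] changes
   sign. *)
rewrite (@ge0_integral_itv_split _ 0 psi) //; last by lra.
rewrite (@ge0_integral_itv_split _ psi (psi + pi)) //; [|lra|lra].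
have nz1 : (-1 : R) != 0 by rewrite oppr_eq0 oner_eq0.
rewrite (sgn 0 psi (-1) psi0 _ nz1); last first.
  by move=> u u0 up; rewrite mulN1r -sinN opprB; apply: sin_ge0_pi; lra.
rewrite (sgn psi (psi + pi) 1 _ _ (oner_neq0 _)); last 2 first.
- by lra.
- by move=> u u0 up; rewrite mul1r; apply: sin_ge0_pi; lra.
rewrite (sgn (psi + pi) (2 * pi) (-1) _ _ nz1); last 2 first.
- by lra.
- move=> u u0 up; rewrite mulN1r.
  have -> : u - psi = u - psi - pi + pi by ring.
  by rewrite sinDpi opprK; apply: sin_ge0_pi; lra.
have p1 : phi psi = - r' by rewrite phiE subrr cos0 mulr1.
have p2 : phi (psi + pi) = r'.
  by rewrite phiE addrAC subrr add0r cospi mulrN1 opprK.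
have p3 : phi (2 * pi) = phi 0.
  by rewrite /phi mulr_natl sin2pi cos2pi sin0 cos0.
rewrite p1 p2 p3 FI -!EFinD -EFinM; congr EFin.
have := pr 0; rewrite ler_norml => /andP[q1 q2].
have m1 := mono _ _ q1 (lexx _) q2; have m2 := mono _ _ q2 q1 (lexx _).
have m3 : H (- r) <= H r by apply: mono; lra.
(* The middle arc crosses [[-r, r]] once; the two outer ones share the endpoint value [phi 0] and
   make up the second crossing. *)
have tot (x y z : R) : x <= y -> y <= z ->
    `|x - y| + (`|z - x| + `|y - z|) = 2 * (z - x).
  move=> xy yz; rewrite (distrC x y) (distrC y z).
  by rewrite !ger0_norm ?subr_ge0 ?(le_trans xy)//; ring.
have [r'0|r'0] := ger0P r'.
  have -> : r' = r by rewrite -rr' ger0_norm.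
  exact: tot.
have -> : r' = - r by rewrite -rr' ltr0_norm// opprK.
rewrite opprK -(tot _ _ _ m1 m2) (distrC (H (- r)) (H r)).
by rewrite (distrC (H r) (H (phi 0))) (distrC (H (phi 0)) (H (- r))); ring.
Qed.

End Sweep.

(** * Explicit Gaussian integrals *)

Section GaussianIntegrals.
Context {R : realType}.
Local Notation mu := (@lebesgue_measure R).

Lemma expR_square_cvg0 (k : R) : 0 < k -> expR (- (k * x ^+ 2)) @[x --> +oo] --> (0 : R).
Proof.
move=> k0; apply: (@squeeze_cvgr _ _ _ _ (fun=> 0) (fun x : R => k^-1 * x^-1)).
- near=> x; have x1 : 1 <= x by near: x; apply: nbhs_pinfty_ge; exact: num_real.
  rewrite expR_ge0/= -invfM expRN lef_pV2 ?posrE ?expR_gt0//; last by rewrite mulr_gt0//; lra.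
  rewrite (le_trans _ (ltW (expR_gt1Dx _)))//; last by rewrite gt_eqF// mulr_gt0// exprn_gt0//; lra.
  have : 0 <= k * (x * (x - 1)) by rewrite !mulr_ge0//; lra.
  by rewrite expr2; nra.
- exact: cvg_cst.
- rewrite -[X in _ --> X](mulr0 k^-1); apply: cvgM; first exact: cvg_cst.
  apply/cvgr0Pnorm_le => e e0; near=> x.
  have xe : e^-1 <= x by near: x; apply: nbhs_pinfty_ge; exact: num_real.
  have ep : 0 < e^-1 by rewrite invr_gt0.
  have x0 : 0 < x by rewrite (lt_le_trans ep).
  rewrite ger0_norm; last by rewrite invr_ge0 ltW.
  have : x^-1 <= (e^-1)^-1 by rewrite lef_pV2 ?posrE.
  by rewrite invrK.
Unshelve. all: by end_near.
Qed.

Lemma continuous_abs_gauss (k : R) : continuous (fun v : R => `|v| * expR (- (k * v ^+ 2))).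
Proof.
move=> v; apply: cvgM; first exact: norm_continuous.
apply: continuous_comp; last exact: continuous_expR.
apply: cvgN; apply: cvgM; first exact: cvg_cst.
exact: exprn_continuous.
Qed.

Lemma integral_abs_gauss (k : R) : 0 < k ->
  (\int[mu]_v (`|v| * expR (- (k * v ^+ 2)))%:E = (k^-1)%:E)%E.
Proof.
move=> k0; have cf := @continuous_abs_gauss k.
rewrite ge0_symfun_integralT//; last first.
  by move=> v /=; rewrite normrN sqrrN.
have -> : [set x : R | 0 <= x] = `[0, +oo[%classic.
  by apply/seteqP; split => x/=; rewrite in_itv/= andbT.
have -> : (\int[mu]_(v in `[0%R, +oo[) (`|v| * expR (- (k * v ^+ 2)))%:E =
   \int[mu]_(v in `[0%R, +oo[) (v * expR (- (k * v ^+ 2)))%:E)%E.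
  by apply: eq_integral => v; rewrite inE/= in_itv/= andbT => v0; rewrite ger0_norm.
have dF (v : R) : is_derive v (1:R) (fun v => - (2 * k)^-1 * expR (- (k * v ^+ 2))) (v * expR (- (k * v ^+ 2))).
  apply: is_derive_eq; rewrite /GRing.scale/=; move: (expR _) => e.
  by field; rewrite gt_eqF.
rewrite (@ge0_continuous_FTC2y _ _ (fun v => - (2 * k)^-1 * expR (- (k * v ^+ 2))) _ 0).
- rewrite expr0n mulr0 oppr0 expR0 mulr1 sub0e -EFinN opprK -EFinM; congr EFin.
  by field; rewrite gt_eqF.
- by move=> v v0; rewrite mulr_ge0// expR_ge0.
- apply: continuous_subspaceT => v; apply: cvgM; first exact: cvg_id.
  apply: continuous_comp; last exact: continuous_expR.
  apply: cvgN; apply: cvgM; first exact: cvg_cst.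
  exact: exprn_continuous.
- rewrite -[X in _ --> X](mulr0 (- (2 * k)^-1)); apply: cvgM; first exact: cvg_cst.
  exact: expR_square_cvg0.
- by move=> v _; have := dF v => h; exact: ex_derive.
- by apply: cvg_at_right_filter; exact: continuous_derivable dF 0.
- by move=> v _; rewrite derive1E; have [_ ->] := dF v.
Qed.

Lemma integral_gam_abs (t : R) : 0 <= t ->
  (\int[gam]_v (`|v| * expR (- (t / 2 * v ^+ 2)))%:E = (2 / (Num.sqrt (2 * pi) * (1 + t)))%:E)%E.
Proof.
move=> t0; have s0 : 0 < (Num.sqrt (2 * pi))^-1 :> R.
  by rewrite invr_gt0 sqrtr_gt0 mulr_gt0// pi_gt0.
have mf : measurable_fun setT (fun v : R => `|v| * expR (- (t / 2 * v ^+ 2))).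
  by apply: continuous_measurable_fun; exact: continuous_abs_gauss.
rewrite ge0_integral_gam; last 2 first.
- exact/measurable_EFinP.
- by move=> v; rewrite lee_fin mulr_ge0// expR_ge0.
transitivity (\int[mu]_v ((Num.sqrt (2 * pi))^-1%:E * (`|v| * expR (- ((1 + t) / 2 * v ^+ 2)))%:E))%E.
  apply: eq_integral => v _; rewrite -!EFinM gpdfE; congr EFin.
  have -> : - ((1 + t) / 2 * v ^+ 2) = - (t / 2 * v ^+ 2) + - v ^+ 2 / 2 by field.
  by rewrite expRD; ring.
have mg : measurable_fun setT (fun x : R => (`|x| * expR (- ((1 + t) / 2 * x ^+ 2)))%:E).
  by apply/measurable_EFinP; apply: continuous_measurable_fun; exact: continuous_abs_gauss.
rewrite ge0_integralZl//.
rewrite integral_abs_gauss; last by rewrite divr_gt0//; lra.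
rewrite -EFinM; congr EFin; rewrite invf_div invfM.
by move: (Num.sqrt _)^-1 (1 + t)^-1 => a b; ring.
Qed.

Lemma integral_gam_gpdf (p q : R) :
  (\int[gam]_v (gpdf (p + q * v))%:E =
   (gpdf (p / Num.sqrt (1 + q ^+ 2)) / Num.sqrt (1 + q ^+ 2))%:E)%E.
Proof.
pose s := Num.sqrt (1 + q ^+ 2).
have q1 : 0 < 1 + q ^+ 2 by rewrite ltr_wpDr// sqr_ge0.
have s0 : 0 < s by rewrite sqrtr_gt0.
have s2 : s ^+ 2 = 1 + q ^+ 2 by rewrite sqr_sqrtr// ltW.
have mg : measurable_fun setT (fun v : R => gpdf (p + q * v)).
  apply: measurableT_comp; first exact: measurable_gpdf.
  by apply: measurable_funD => //; exact: measurable_funM.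
rewrite ge0_integral_gam; last 2 first.
- exact/measurable_EFinP.
- by move=> v; rewrite lee_fin gpdf_ge0.
(* Completing the square: the product of the two densities is a multiple of the normal density of
   mean [m] and scale [1 / s]. *)
pose m := - (p * q / s ^+ 2).
transitivity (\int[mu]_v ((gpdf (p / s) / s)%:E * (normal_pdf m (s^-1) v)%:E))%E.
  apply: eq_integral => v _; rewrite -!EFinM; congr EFin.
  rewrite !gpdfE normal_pdfE ?invr_eq0 ?gt_eqF// /normal_peak /normal_fun.
  have -> : Num.sqrt (s^-1 ^+ 2 * pi *+ 2) = s^-1 * Num.sqrt (2 * pi).
    by rewrite -mulr_natl mulrCA sqrtrM ?sqr_ge0// sqrtr_sqr gtr0_norm ?invr_gt0.
  have -> : - (v - m) ^+ 2 / (s^-1 ^+ 2 *+ 2) =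
     (- v ^+ 2 / 2 + - (p + q * v) ^+ 2 / 2) - (- (p / s) ^+ 2 / 2).
    rewrite /m !expr_div_n exprVn -[_^-1 *+ 2]mulr_natl s2.
    by field; rewrite gt_eqF.
  rewrite expRB expRD; have := expR_gt0 (- (p / s) ^+ 2 / 2).
  have : 0 < Num.sqrt (2 * pi) :> R by rewrite sqrtr_gt0 mulr_gt0// pi_gt0.
  move: (Num.sqrt _) (expR (- (p / s) ^+ 2 / 2)) => a b a0 b0.
  by field; rewrite !gt_eqF.
rewrite ge0_integralZl//; last 3 first.
- by apply/measurable_EFinP; exact: measurable_normal_pdf.
- by move=> v _; rewrite lee_fin normal_pdf_ge0.
- by rewrite lee_fin divr_ge0 ?gpdf_ge0// ltW.
by rewrite integral_normal_pdf mule1.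
Qed.

(** The integral over [v2] leaves a centred Gaussian function of [v1], whose first absolute moment
    is then taken. *)
Lemma integral_gam_pair (c D : R) :
  (\int[gam]_v1 \int[gam]_v2 (gpdf (c * v1 + D * v2) * `|v1|)%:E =
   (Num.sqrt (1 + D ^+ 2) / (pi * (1 + D ^+ 2 + c ^+ 2)))%:E)%E.
Proof.
pose s := Num.sqrt (1 + D ^+ 2).
have q1 : 0 < 1 + D ^+ 2 by rewrite ltr_wpDr// sqr_ge0.
have s0 : 0 < s by rewrite sqrtr_gt0.
have s2 : s ^+ 2 = 1 + D ^+ 2 by rewrite sqr_sqrtr// ltW.
pose t := (c / s) ^+ 2.
pose a : R := Num.sqrt (2 * pi).
have a0 : 0 < a by rewrite sqrtr_gt0 mulr_gt0// pi_gt0.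
have a2 : a ^+ 2 = 2 * pi by rewrite sqr_sqrtr// mulr_ge0// ltW// pi_gt0.
transitivity (\int[gam]_v1 ((a * s)^-1%:E * (`|v1| * expR (- (t / 2 * v1 ^+ 2)))%:E))%E.
  apply: eq_integral => v1 _.
  under eq_integral do rewrite EFinM.
  rewrite ge0_integralZr//; last 2 first.
  - apply/measurable_EFinP; apply: measurableT_comp; first exact: measurable_gpdf.
    by apply: measurable_funD => //; exact: measurable_funM.
  - by move=> v _; rewrite lee_fin gpdf_ge0.
  rewrite integral_gam_gpdf -!EFinM gpdfE -/s -/a; congr EFin.
  have -> : - (c * v1 / s) ^+ 2 / 2 = - (t / 2 * v1 ^+ 2).
    by rewrite /t; field; rewrite gt_eqF.
  by rewrite invfM; ring.
have mg : measurable_fun setT (fun x : R => (`|x| * expR (- (t / 2 * x ^+ 2)))%:E).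
  by apply/measurable_EFinP; apply: continuous_measurable_fun; exact: continuous_abs_gauss.
rewrite ge0_integralZl//; last by rewrite lee_fin invr_ge0 mulr_ge0// ltW.
rewrite integral_gam_abs ?sqr_ge0// -EFinM -/a; congr EFin.
have p0 := @pi_gt0 R.
rewrite /t expr_div_n s2.
have -> : pi = a ^+ 2 / 2 by rewrite a2; field.
have h : 0 < s ^+ 2 + c ^+ 2 by rewrite s2 ltr_wpDr// sqr_ge0.
rewrite -/s; move: h; rewrite -s2; move: (s) s0 => z z0 h.
field.
by rewrite !gt_eqF.
Qed.

End GaussianIntegrals.

(** * From a cone to an integral over a phase *)

Section ConeProbability.
Context {R : realType}.
Local Notation mu := (@lebesgue_measure R).
Local Notation RT := (measurableTypeR R).

Lemma gam_itv (a b : R) : (gam `]a, b[%classic = \int[mu]_(x in `[a, b]) (gpdf x)%:E)%E.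
Proof.
have mI : measurable (`]a, b[%classic : set RT) by exact: measurable_itv.
have -> : gam `]a, b[%classic = (\int[gam]_x (\1_(`]a, b[%classic) x)%:E)%E.
  by rewrite integral_indic// setIT.
have mg S : measurable_fun S (EFin \o (@gpdf R)).
  by apply: (measurable_funS measurableT) => //; apply/measurable_EFinP; exact: measurable_gpdf.
rewrite ge0_integral_gam; last 2 first.
- by apply/measurable_EFinP; exact: measurable_indic.
- by move=> x; rewrite lee_fin indicE.
rewrite -[RHS]integral_itv_bndo_bndc; last exact: mg.
rewrite -[RHS]integral_itv_obnd_cbnd; last exact: mg.
rewrite [RHS]integral_mkcond; apply: eq_integral => x _.
rewrite patchE indicE; case: (x \in _); rewrite ?mul1e// mul0e//.
Qed.

Lemma gam_itv_gt0 (a b : R) : a < b -> (0 < gam `]a, b[%classic)%E.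
Proof.
move=> ab; rewrite gam_itv.
have [c c0 cP] : exists2 c : R, 0 < c & forall x, x \in `[a, b] -> c <= gpdf x.
  have [c _ cP] := @EVT_min R gpdf a b (ltW ab) (continuous_subspaceT (@continuous_gpdf R)).
  exists (gpdf c) => //.
  by rewrite gpdfE mulr_gt0 ?expR_gt0// invr_gt0 sqrtr_gt0 mulr_gt0// pi_gt0.
apply: (@lt_le_trans _ _ (\int[mu]_(x in `[a, b]) c%:E)%E).
  rewrite integral_cst//= lebesgue_measure_itv/= lte_fin ab -EFinB -EFinM lte_fin.
  by rewrite mulr_gt0// subr_gt0.
apply: ge0_le_integral => //.
- by move=> x _; rewrite lee_fin ltW.
- by apply: (measurable_funS measurableT) => //; apply/measurable_EFinP; exact: measurable_gpdf.
Qed.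

(** The section is an interval of half length [r / s] about [m / s], where [r^2 = X^2 + Y^2]. By
    [sweep] its Gaussian mass is an integral over the phase; the double crossing and the scaling by
    [s] give the factor [1 / (2 s)]. *)
Lemma gam_cone_section (m s X Y : R) : 0 < s ->
  (\int[gam]_z (\1_[set z : RT | (m - s * z) ^+ 2 < X ^+ 2 + Y ^+ 2] z)%:E =
   ((2 * s)^-1)%:E * \int[mu]_(u in `[0%R, (2 * pi)%R])
     (gpdf ((m + (X * sin u + Y * cos u)) / s) * `|Y * sin u - X * cos u|)%:E)%E.
Proof.
move=> s0; pose r := Num.sqrt (X ^+ 2 + Y ^+ 2).
have r2 : X ^+ 2 + Y ^+ 2 = r ^+ 2 by rewrite sqr_sqrtr// addr_ge0// sqr_ge0.
have r0 : 0 <= r by rewrite sqrtr_ge0.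
have -> : [set z : RT | (m - s * z) ^+ 2 < X ^+ 2 + Y ^+ 2] = `](m - r) / s, (m + r) / s[%classic.
  have sq v : (v ^+ 2 < r ^+ 2) = (- r < v < r).
    by rewrite -ltr_norml -(real_normK (num_real v)) ltr_sqr ?nnegrE.
  apply/seteqP; split => z /=; rewrite r2 sq in_itv/= ltr_pdivrMr// ltr_pdivlMr//;
    by move=> /andP[h1 h2]; apply/andP; split; lra.
rewrite [LHS](_ : _ = gam `](m - r) / s, (m + r) / s[%classic); last by rewrite integral_indic// setIT.
rewrite gam_itv.
move: r0; rewrite le_eqVlt => /predU1P[r0|r0].
  have [X0 Y0] : X = 0 /\ Y = 0.
    move: r2; rewrite -r0 expr0n/= => /eqP; rewrite paddr_eq0 ?sqr_ge0// !sqrf_eq0.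
    by move=> /andP[/eqP-> /eqP->].
  rewrite -r0 subr0 addr0 set_itv1 integral_set1 X0 Y0.
  rewrite integral0_eq ?mule0// => u _; rewrite !mul0r subrr normr0 mulr0//.
pose h (y : R) : R := gpdf ((m - y) / s).
have ch : continuous h.
  move=> y; apply: (@continuous_comp _ _ _ (fun y => (m - y) / s)); last exact: continuous_gpdf.
  apply: cvgM; last exact: cvg_cst.
  by apply: cvgB; [exact: cvg_cst|exact: cvg_id].
transitivity (((2 * s)^-1)%:E * \int[mu]_(u in `[0%R, (2 * pi)%R])
     (h (- (X * sin u + Y * cos u)) * `|Y * sin u - X * cos u|)%:E)%E; last first.
  by congr (_ * _)%E; apply: eq_integral => u _; rewrite /h opprK.
rewrite (@sweep _ h X Y r)//; last by move=> y; exact: gpdf_ge0.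
pose M := (`|m| + r) / s + 1.
have M0 : 0 < M by rewrite /M ltr_wpDl// divr_ge0 ?addr_ge0// ltW.
have [G dG] := continuous_antiderivative (@continuous_gpdf R) M0.
have bd y : - r <= y -> y <= r -> - M < (m - y) / s /\ (m - y) / s < M.
  move=> y1 y2; have : `|(m - y) / s| < M.
    rewrite normrM (ger0_norm (_ : 0 <= s^-1)) ?invr_ge0 ?ltW//.
    rewrite /M (le_lt_trans (_ : _ <= (`|m| + r) / s))// ?ltrDl//.
    apply: ler_wpM2r; first by rewrite invr_ge0 ltW.
    by rewrite (le_trans (ler_normB _ _))// lerD2l ler_norml y1 y2.
  by rewrite ltr_norml => /andP.
have -> : (\int[mu]_(y in `[(- r)%R, r]) (h y)%:E =
   (- s * G ((m - r) / s) - (- s * G ((m - - r) / s)))%:E)%E.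
  apply: (@FTC2_is_derive _ h (fun y => - s * G ((m - y) / s))).
  - by lra.
  - move=> y y1 y2; have [b1 b2] := bd y y1 y2; have d1 := dG _ b1 b2.
    have d2 : is_derive y (1:R) (fun y => (m - y) / s) (- s^-1).
      by apply: is_derive_eq; rewrite /GRing.scale/=; ring.
    have d3 := @is_derive1_comp _ G (fun y => (m - y) / s) y _ _ d1 d2.
    by apply: is_derive_eq; rewrite /GRing.scale/= /h; field; rewrite gt_eqF.
  - exact: continuous_subspaceT.
have -> : (\int[mu]_(x in `[((m - r) / s)%R, ((m + r) / s)%R]) (gpdf x)%:E =
   (G ((m + r) / s) - G ((m - r) / s))%:E)%E.
  have le1 : (m - r) / s <= (m + r) / s by rewrite ler_pM2r ?invr_gt0//; lra.
  apply: FTC2_is_derive => //.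
    have [b1 _] := bd r (ltac:(lra)) (lexx r); have [_ b2] := bd (- r) (lexx _) (ltac:(lra)).
    rewrite opprK in b2.
    by move=> x x1 x2; apply: dG; [exact: lt_le_trans x1|exact: le_lt_trans b2].
  apply: continuous_subspaceT; exact: continuous_gpdf.
rewrite -!EFinM opprK; congr EFin.
by field; rewrite gt_eqF.
Qed.

Section Cone.
Context {d : measure_display} {T : measurableType d}.
Variable P : probability T R.

(** Writes the denominator as half a sum of squares, one of them [(l sin x)^2], hence its
    positivity; it also collapses the sum of squares produced by [integral_gam_pair]. *)
Lemma cone_denominator (k l x u : R) : k ^+ 2 + l ^+ 2 = 1 ->
  (1 - cos x * cos u + k * sin x * sin u) * 2 =
  (l * sin x) ^+ 2 + (1 - cos x * cos u + k * sin x * sin u) ^+ 2 +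
  (- (k * sin x * cos u + cos x * sin u)) ^+ 2.
Proof.
move=> kl; have h1 := cos2Dsin2 x; have h2 := cos2Dsin2 u.
have {}kl : l ^+ 2 = 1 - k ^+ 2 by rewrite -kl; ring.
move: (cos x) (sin x) (cos u) (sin u) h1 h2 => cx sx cu su h1 h2.
have {}h1 : sx ^+ 2 = 1 - cx ^+ 2 by rewrite -h1; ring.
have {}h2 : su ^+ 2 = 1 - cu ^+ 2 by rewrite -h2; ring.
transitivity (2 - 2 * cx * cu + 2 * k * sx * su) => //; first by ring.
transitivity (l ^+ 2 * sx ^+ 2 + 1 + cx ^+ 2 * cu ^+ 2 + k ^+ 2 * sx ^+ 2 * su ^+ 2 - 2 * cx * cu + 2 * k * sx * su
   + k ^+ 2 * sx ^+ 2 * cu ^+ 2 + cx ^+ 2 * su ^+ 2); last by ring.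
by rewrite kl h1 h2; ring.
Qed.

Lemma cone_denominator_gt0 (k l x u : R) : k ^+ 2 + l ^+ 2 = 1 -> l * sin x != 0 ->
  0 < 1 - cos x * cos u + k * sin x * sin u.
Proof.
move=> kl s0; rewrite -(pmulr_lgt0 _ (ltr0n _ 2)) (cone_denominator _ _ kl) -addrA.
by rewrite ltr_wpDr ?addr_ge0 ?sqr_ge0// exprn_even_gt0.
Qed.

Lemma continuous_cone_density (k l x s : R) : k ^+ 2 + l ^+ 2 = 1 -> l * sin x != 0 ->
  continuous (fun u : R => Num.sqrt (1 + (s / (1 - cos x * cos u + k * sin x * sin u)) ^+ 2)).
Proof.
move=> kl s0 u; apply: (@continuous_comp _ _ _ (fun u => 1 + (s / (1 - cos x * cos u + k * sin x * sin u)) ^+ 2)); last first.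
  exact: sqrt_continuous.
apply: cvgD; first exact: cvg_cst.
apply: (@continuous_comp _ _ _ (fun u => s / (1 - cos x * cos u + k * sin x * sin u)) (fun y => y ^+ 2)); last first.
  exact: exprn_continuous.
apply: cvgM; first exact: cvg_cst.
apply: cvgV; first by rewrite gt_eqF// (@cone_denominator_gt0 k l).
apply: cvgD.
  apply: cvgB; first exact: cvg_cst.
  by apply: cvgM; [exact: cvg_cst|exact: continuous_cos].
by apply: cvgM; [exact: cvg_cst|exact: continuous_sin].
Qed.

(** The orthogonal change from [(X, Y)] to [(V1, V2)] makes the weight [|V1|] and the argument of
    [gpdf] linear in [V1] and [V2], the situation of [integral_gam_pair]. *)
Lemma cone_expectation (X Y Z W : T -> R) (k l x u : R) : iid4 P X Y Z W ->
  k ^+ 2 + l ^+ 2 = 1 -> 0 < l * sin x ->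
  (\int[P]_w (gpdf ((k * sin x * X w - cos x * Y w + (X w * sin u + Y w * cos u)) / (l * sin x))
     * `|Y w * sin u - X w * cos u|)%:E =
  (l * sin x / (2 * pi) *
    Num.sqrt (1 + (l * sin x / (1 - cos x * cos u + k * sin x * sin u)) ^+ 2))%:E)%E.
Proof.
move=> H kl; set s := l * sin x => s0.
have [mX mY mZ mW _] := H.
pose V1 w := Y w * sin u - X w * cos u.
pose V2 w := X w * sin u + Y w * cos u.
have HV : iid4 P V1 V2 Z W.
  apply: (iid4_transform H) => //.
  - by rewrite /V1; apply: measurable_funB; exact: measurable_funM.
  - by rewrite /V2; apply: measurable_funD; exact: measurable_funM.
  move=> a b c e; exists (b * sin u - a * cos u), (a * sin u + b * cos u), c, e; split.
    transitivity ((a ^+ 2 + b ^+ 2) * (cos u ^+ 2 + sin u ^+ 2) + c ^+ 2 + e ^+ 2); first by ring.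
    by rewrite cos2Dsin2 mulr1.
  by move=> w; rewrite /V1 /V2; ring.
(* [c1] and [D] are the coordinates of the argument of [gpdf], up to the factor [1 / s], along [V1]
   and [V2]. *)
pose c1 := - (k * sin x * cos u + cos x * sin u).
pose D := 1 - cos x * cos u + k * sin x * sin u.
have D2 : D * 2 = s ^+ 2 + D ^+ 2 + c1 ^+ 2 by exact: cone_denominator.
have D0 : 0 < D by apply: (@cone_denominator_gt0 _ l) => //; rewrite gt_eqF.
pose f (z : RT * (RT * (RT * RT))) := (gpdf (c1 / s * z.1 + D / s * z.2.1) * `|z.1|)%:E.
have mf : measurable_fun setT f.
  apply/measurable_EFinP; apply: measurable_funM; last exact: measurableT_comp.
  apply: measurableT_comp; first exact: measurable_gpdf.
  apply: measurable_funD; apply: measurable_funM => //.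
  exact: measurableT_comp.
have f0 z : (0 <= f z)%E by rewrite lee_fin mulr_ge0// gpdf_ge0.
transitivity (\int[P]_w f (V1 w, (V2 w, (Z w, W w))))%E.
  apply: eq_integral => w _; rewrite /f /= -/(V1 w); congr (gpdf _ * _)%:E.
  have -> : c1 / s * V1 w + D / s * V2 w = (c1 * V1 w + D * V2 w) / s by field; rewrite gt_eqF.
  congr (_ / _); rewrite /c1 /D /V1 /V2.
  have h2 := cos2Dsin2 u.
  have h3 : sin u ^+ 2 = 1 - cos u ^+ 2 by rewrite -h2; ring.
  transitivity (X w * (sin u + k * sin x * (cos u ^+ 2 + sin u ^+ 2)) + Y w * (cos u - cos x * (cos u ^+ 2 + sin u ^+ 2))).
    by rewrite h2; ring.
  by ring.
rewrite (iid4_law HV mf f0) /f /=.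
transitivity (\int[gam]_v1 \int[gam]_v2 (gpdf (c1 / s * v1 + D / s * v2) * `|v1|)%:E)%E.
  apply: eq_integral => v1 _; apply: eq_integral => v2 _.
  have cst1 (r : R) : (\int[gam]_z r%:E = r%:E)%E.
    by rewrite integral_cst//= probability_setT mule1.
  by rewrite !cst1.
rewrite integral_gam_pair; congr EFin.
have -> : 1 + (D / s) ^+ 2 + (c1 / s) ^+ 2 = 2 * D / s ^+ 2.
  rewrite [2 * D]mulrC D2; field; by rewrite gt_eqF.
have -> : Num.sqrt (1 + (D / s) ^+ 2) = D / s * Num.sqrt (1 + (s / D) ^+ 2).
  rewrite -{2}(ger0_norm (ltW (divr_gt0 D0 s0))) -sqrtr_sqr -sqrtrM ?sqr_ge0//.
  by congr Num.sqrt; field; rewrite !gt_eqF.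
rewrite -/D; have p0 := @pi_gt0 R.
move: p0; move: (Num.sqrt _) (pi : R) => q p p0; field.
by rewrite !gt_eqF.
Qed.

(** The condition [|w| < sqrt (p^2 + q^2)] at a fixed time, squared and written in normalized
    coordinates. *)
Definition cone (k l x X Y Z : R) : Prop :=
  (sin x * (k * X - l * Z) - cos x * Y) ^+ 2 < X ^+ 2 + Y ^+ 2.

Lemma measurable_cone (k l x : R) :
  measurable [set z : RT * (RT * (RT * RT)) | cone k l x z.1 z.2.1 z.2.2.1].
Proof.
have m1 : measurable_fun setT (fun z : RT * (RT * (RT * RT)) => z.1) by exact: measurable_fst.
have m2 : measurable_fun setT (fun z : RT * (RT * (RT * RT)) => z.2.1).
  by apply: measurableT_comp; [exact: measurable_fst|exact: measurable_snd].
have m3 : measurable_fun setT (fun z : RT * (RT * (RT * RT)) => z.2.2.1).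
  apply: measurableT_comp; first exact: measurable_fst.
  by apply: measurableT_comp; exact: measurable_snd.
pose F (z : RT * (RT * (RT * RT))) : R := (sin x * (k * z.1 - l * z.2.2.1) - cos x * z.2.1) ^+ 2 - (z.1 ^+ 2 + z.2.1 ^+ 2).
rewrite (_ : [set z | _] = setT `&` F @^-1` `]-oo, 0%R[%classic); last first.
  by apply/seteqP; split => z; rewrite /cone/F/= in_itv/= subr_lt0 //; case.
suff mF : measurable_fun [set: RT * (RT * (RT * RT))] F by apply: mF => //; exact: measurable_itv.
apply: measurable_funB; last by apply: measurable_funD; exact: measurable_funX.
apply: measurable_funX; apply: measurable_funB; last exact: measurable_funM.
by apply: measurable_funM => //; apply: measurable_funB; exact: measurable_funM.
Qed.

(** The section in [Z] turns the indicator into an integral over [u]; Tonelli exchanges it with the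
    expectation, which [cone_expectation] evaluates at each [u]. *)
Lemma cone_probability_pos (X Y Z W : T -> R) (k l x : R) : iid4 P X Y Z W ->
  k ^+ 2 + l ^+ 2 = 1 -> 0 < l * sin x ->
  (P [set w | cone k l x (X w) (Y w) (Z w)] =
  ((4 * pi)^-1)%:E * \int[mu]_(u in `[0%R, (2 * pi)%R])
    (Num.sqrt (1 + (l * sin x / (1 - cos x * cos u + k * sin x * sin u)) ^+ 2))%:E)%E.
Proof.
move=> H kl; set s := l * sin x => s0.
have [mX mY mZ mW _] := H.
pose I : set R := `[0, 2 * pi]%classic.
(* The indicator of [I] is part of the kernel so that Tonelli can run over the whole line. *)
pose K (u p q : R) : R := gpdf ((k * sin x * p - cos x * q + (p * sin u + q * cos u)) / s) *
   `|q * sin u - p * cos u| * \1_I u.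
have K0 u p q : 0 <= K u p q by rewrite !mulr_ge0 ?gpdf_ge0// indicE.
have mK : measurable_fun setT (fun z : RT * (RT * RT) => K z.1 z.2.1 z.2.2).
  have m1 : measurable_fun setT (fun z : RT * (RT * RT) => z.1) by exact: measurable_fst.
  have m2 : measurable_fun setT (fun z : RT * (RT * RT) => z.2.1).
    by apply: measurableT_comp; [exact: measurable_fst|exact: measurable_snd].
  have m3 : measurable_fun setT (fun z : RT * (RT * RT) => z.2.2).
    by apply: measurableT_comp; exact: measurable_snd.
  have ms : measurable_fun setT (fun z : RT * (RT * RT) => sin z.1).
    by case: (bm_sin m1).
  have mc : measurable_fun setT (fun z : RT * (RT * RT) => cos z.1).
    by case: (bm_cos m1).
  apply: measurable_funM; first (apply: measurable_funM).
  - apply: measurableT_comp; first exact: measurable_gpdf.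
    apply: measurable_funM => //; apply: measurable_funD.
      by apply: measurable_funB; exact: measurable_funM.
    by apply: measurable_funD; exact: measurable_funM.
  - by apply: measurableT_comp => //; apply: measurable_funB; exact: measurable_funM.
  - by apply: measurableT_comp => //; apply: measurable_indic; exact: measurable_itv.
have IK p q : (\int[mu]_(u in `[0%R, (2 * pi)%R])
     (gpdf ((k * sin x * p - cos x * q + (p * sin u + q * cos u)) / s) * `|q * sin u - p * cos u|)%:E =
     \int[mu]_u (K u p q)%:E)%E.
  rewrite integral_mkcond; apply: eq_integral => u _.
  by rewrite patchE /K indicE; case: (u \in _); rewrite ?mulr1// mulr0.
rewrite (iid4_prob H (measurable_cone k l x)).
pose g (z : RT * (RT * (RT * RT))) := (((2 * s)^-1)%:E * \int[mu]_u (K u z.1 z.2.1)%:E)%E.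
have mg : measurable_fun setT g.
  apply: emeasurable_funM => //.
  have mz : measurable_fun setT (fun v : (RT * (RT * (RT * RT))) * RT => (v.2, (v.1.1, v.1.2.1))).
    apply: measurable_fun_pair; first exact: measurable_snd.
    apply: measurable_fun_pair; first by apply: measurableT_comp; [exact: measurable_fst|exact: measurable_fst].
    apply: measurableT_comp; first exact: measurable_fst.
    by apply: measurableT_comp; [exact: measurable_snd|exact: measurable_fst].
  have mf : measurable_fun setT (fun v : (RT * (RT * (RT * RT))) * RT => (K v.2 v.1.1 v.1.2.1)%:E).
    by apply/measurable_EFinP; exact: (measurableT_comp mK mz).
  have mf0 v : (0 <= (fun v : (RT * (RT * (RT * RT))) * RT => (K v.2 v.1.1 v.1.2.1)%:E) v)%E by rewrite lee_fin.
  exact: (@measurable_fun_fubini_tonelli_F _ _ _ _ _ mu _ mf mf0).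
have g0 z : (0 <= g z)%E.
  apply: mule_ge0; first by rewrite lee_fin invr_ge0 mulr_ge0// ltW.
  by apply: integral_ge0 => u _; rewrite lee_fin.
have cst1 (f : \bar R) : (\int[gam]_z f = f)%E.
  by rewrite integral_cst//= ?probability_setT ?mule1.
transitivity (\int[P]_w g (X w, (Y w, (Z w, W w))))%E.
  rewrite (iid4_law H mg g0).
  apply: eq_integral => p _; apply: eq_integral => q _.
  transitivity (g (p, (q, (0, 0)))); last by rewrite /g /= !cst1.
  rewrite /g /= -IK -gam_cone_section//.
  apply: eq_integral => z _; rewrite -[RHS]cst1; apply: eq_integral => u _.
  rewrite !indicE; congr (_%:R)%:E; congr nat_of_bool.
  have e : sin x * (k * p - l * z) - cos x * q = k * sin x * p - cos x * q - s * z.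
    by rewrite /s; ring.
  by apply/idP/idP; rewrite !inE /cone /= e.
rewrite /g /=.
have mKw : measurable_fun setT (fun v : T * RT => (K v.2 (X v.1) (Y v.1))%:E).
  apply/measurable_EFinP.
  have mz : measurable_fun setT (fun v : T * RT => (v.2, (X v.1, Y v.1))).
    apply: measurable_fun_pair; first exact: measurable_snd.
    by apply: measurable_fun_pair; apply: measurableT_comp => //; exact: measurable_fst.
  exact: (measurableT_comp mK mz).
rewrite ge0_integralZl//; last 3 first.
- by apply: (@measurable_fun_fubini_tonelli_F _ _ _ _ _ mu _ mKw) => v; rewrite lee_fin.
- by move=> w _; apply: integral_ge0 => u _; rewrite lee_fin.
- by rewrite lee_fin invr_ge0 mulr_ge0// ltW.
have mK0 (v : T * RT) : (0 <= (K v.2 (X v.1) (Y v.1))%:E)%E by rewrite lee_fin.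
have /= -> := @fubini_tonelli _ _ _ _ _ P mu _ mKw mK0.
transitivity (((2 * s)^-1)%:E * \int[mu]_(u in I) ((s / (2 * pi))%:E * (Num.sqrt (1 + (s / (1 - cos x * cos u + k * sin x * sin u)) ^+ 2))%:E))%E.
  congr (_ * _)%E; rewrite [RHS]integral_mkcond; apply: eq_integral => u _.
  rewrite patchE /K indicE; case: (u \in _) => /=.
    under eq_integral do rewrite mulr1.
    by rewrite (cone_expectation _ H kl s0) EFinM.
  by under eq_integral do rewrite mulr0; rewrite integral0.
have p0 := @pi_gt0 R.
rewrite ge0_integralZl//; last 3 first.
- exact: measurable_itv.
- apply: (measurable_funS measurableT) => //; apply/measurable_EFinP.
  by apply: continuous_measurable_fun; apply: (@continuous_cone_density _ l) => //; rewrite gt_eqF.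
- by rewrite lee_fin; apply: divr_ge0; apply: ltW; rewrite // mulr_gt0.
rewrite muleA -EFinM; congr (_%:E * _)%E.
by move: p0; move: (pi : R) => p p0; field; rewrite !gt_eqF.
Qed.

(** Replacing [Z] by [- Z] changes the sign of [l] and reduces to the positive case. *)
Lemma cone_probability (X Y Z W : T -> R) (k l x : R) : iid4 P X Y Z W ->
  k ^+ 2 + l ^+ 2 = 1 -> l * sin x != 0 ->
  (P [set w | cone k l x (X w) (Y w) (Z w)] =
  ((4 * pi)^-1)%:E * \int[mu]_(u in `[0%R, (2 * pi)%R])
    (Num.sqrt (1 + (l * sin x / (1 - cos x * cos u + k * sin x * sin u)) ^+ 2))%:E)%E.
Proof.
move=> H kl; rewrite neq_lt => /orP[s0|]; last exact: (cone_probability_pos H kl).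
have H' : iid4 P X Y (fun w => - Z w) W.
  have [mX mY mZ mW _] := H; apply: (iid4_transform H) => //; first exact: measurableT_comp.
  by move=> a b c e; exists a, b, (- c), e; split=> [|w]; [rewrite sqrrN|rewrite mulrN mulNr].
have := @cone_probability_pos X Y (fun w => - Z w) W k (- l) x H'.
rewrite sqrrN mulNr oppr_gt0 => /(_ kl s0).
under eq_integral do rewrite mulNr sqrrN.
move=> <-; congr (P _); apply/seteqP; split => w;
  by rewrite /cone /= !mulNr !mulrN !opprK.
Qed.

Lemma cone_probability_lt1 (X Y Z W : T -> R) (k l x : R) : iid4 P X Y Z W ->
  l * sin x != 0 -> (P [set w | cone k l x (X w) (Y w) (Z w)] < 1)%E.
Proof.
move=> H s0; have [mX mY mZ mW _] := H.
(* For [|X|, |Y| < 1] and [Z > M], the linear form in the cone has modulus at least 2, so its square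
   is at least 4 and exceeds [X^2 + Y^2]: this box of positive probability avoids the cone. *)
pose M := (`|sin x * k| + `|cos x| + 2) / `|l * sin x|.
pose A : set RT := `]-1, 1[%classic; pose C : set RT := `]M, M + 1[%classic.
have mA : measurable A by exact: measurable_itv.
have mC : measurable C by exact: measurable_itv.
have mpre (F : T -> R) (S : set RT) : measurable_fun setT F -> measurable S -> measurable (F @^-1` S).
  by move=> mF mS; rewrite -[X in measurable X]setTI; exact: mF.
pose E := X @^-1` A `&` Y @^-1` A `&` Z @^-1` C `&` W @^-1` setT.
have mE : measurable E by do ! apply: measurableI; exact: mpre.
have pos (S : set RT) : measurable S -> (0 < gam S)%E -> 0 < fine (gam S).
  move=> mS; rewrite -lte_fin fineK//; exact: fin_num_measure.
have PE : (0 < P E)%E.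
  rewrite (iid4_rect H)// lte_fin probability_setT mulr1.
  by rewrite !mulr_gt0// pos// gam_itv_gt0//; lra.
have mcone : measurable [set w | cone k l x (X w) (Y w) (Z w)].
  have mF : measurable_fun setT (fun w => (X w, (Y w, (Z w, W w)))).
    by apply: measurable_fun_pair => //; apply: measurable_fun_pair => //; exact: measurable_fun_pair.
  by rewrite -[X in measurable X]setTI; exact: mF (measurable_cone k l x).
have sub : [set w | cone k l x (X w) (Y w) (Z w)] `<=` ~` E.
  move=> w; rewrite /cone /E /A /C /= !in_itv/= => h [[[/andP[x1 x2] /andP[y1 y2]] /andP[z1 z2]] _].
  move: h; apply/negP; rewrite -leNgt.
  have X1 : `|X w| <= 1 by rewrite ler_norml !ltW.
  have Y1 : `|Y w| <= 1 by rewrite ler_norml !ltW.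
  have lb : 2 <= `|sin x * (k * X w - l * Z w) - cos x * Y w|.
    have -> : sin x * (k * X w - l * Z w) - cos x * Y w =
       - (l * sin x * Z w - (sin x * k * X w - cos x * Y w)) by ring.
    rewrite normrN (le_trans _ (lerB_dist _ _))//.
    have s1 : 0 < `|l * sin x| by rewrite normr_gt0.
    have : `|sin x * k| + `|cos x| + 2 <= `|l * sin x * Z w|.
      by rewrite (normrM _ (Z w)) [leRHS]mulrC -ler_pdivrMr// -/M (le_trans (ltW z1))// ler_norm.
    have := ler_normB (sin x * k * X w) (cos x * Y w); rewrite !normrM.
    have : `|sin x| * `|k| * `|X w| <= `|sin x| * `|k| by rewrite ler_piMr.
    have : `|cos x| * `|Y w| <= `|cos x| by rewrite ler_piMr.
    lra.
  have : 4 <= (sin x * (k * X w - l * Z w) - cos x * Y w) ^+ 2.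
    rewrite -(real_normK (num_real (_ - _))); move: lb; move: `|_| => v; nra.
  have := real_normK (num_real (X w)); have := real_normK (num_real (Y w)).
  have := normr_ge0 (X w); have := normr_ge0 (Y w).
  by move: X1 Y1; move: (`|X w|) (`|Y w|) => a b; nra.
apply: (@le_lt_trans _ _ (P (~` E))).
  by apply: le_measure => //; rewrite inE//; exact: measurableC.
rewrite probability_setC//; move: PE.
have : P E \is a fin_num by exact: fin_num_measure.
by case: (P E) => // r _; rewrite lte_fin => r0; rewrite -EFinB lte_fin; lra.
Qed.

End Cone.
End ConeProbability.

(** * The zeros along a residue class *)

Section Coefficients.
Context {R : realType}.
Variables (alpha x : R).

(* Multiplying the Dirichlet kernels at [t + alpha] and [t - alpha] by [cos alpha - cos t]
   cancels both denominators: see [trig_sum_oscil]. There the phase [n alpha] enters only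
   modulo [pi], through [x] and a sign in front of [wcoef]. *)
Definition pcoef (x1 y1 x2 y2 : R) : R * R * R :=
  (cos (x + alpha) * (x1 + x2) + sin (x + alpha) * (y1 - y2),
   - (x1 + x2) * cos x - (y1 - y2) * sin x,
   (x1 - x2) * sin x - (y1 + y2) * cos x).

Definition qcoef (x1 y1 x2 y2 : R) : R * R * R :=
  (sin (x + alpha) * (x2 - x1) + cos (x + alpha) * (y1 + y2),
   (x1 - x2) * sin x - (y1 + y2) * cos x,
   (x1 + x2) * cos x + (y1 - y2) * sin x).

Definition wcoef (x1 y1 x2 y2 : R) : R * R * R :=
  ((y2 - y1) * sin alpha - (x1 + x2) * cos alpha, x1 + x2, y1 + y2).

(** [sinp] and [sinm] are the denominators of the Dirichlet kernels at [t + alpha] and [t - alpha].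
    Added to [n t], [angp] and [angm] are the phases of their numerators once [n alpha] is replaced
    by [x]. *)
Definition sinp (t : R) := sin ((t + alpha) / 2).
Definition sinm (t : R) := sin ((t - alpha) / 2).
Definition angp (t : R) := x + (t + alpha) / 2.
Definition angm (t : R) := (t - alpha) / 2 - x.

Lemma sin_mul_cos (u v : R) : 2 * (sin u * cos v) = sin (u + v) + sin (u - v).
Proof. by rewrite sinD sinB; ring. Qed.

Lemma sin_mul_sin (u v : R) : 2 * (sin u * sin v) = cos (u - v) - cos (u + v).
Proof. by rewrite cosB cosD; ring. Qed.

Lemma sinm_sin_angp t : 2 * (sinm t * sin (angp t)) = cos (x + alpha) - cos (t + x).
Proof.
rewrite sin_mul_sin /angp; congr (_ - cos _); last by field.
by rewrite -cosN; congr cos; field.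
Qed.

Lemma sinm_cos_angp t : 2 * (sinm t * cos (angp t)) = sin (t + x) - sin (x + alpha).
Proof.
rewrite sin_mul_cos /angp; congr (sin _ + _); first by field.
by rewrite -sinN; congr sin; field.
Qed.

Lemma sinp_sin_angm t : 2 * (sinp t * sin (angm t)) = cos (x + alpha) - cos (t - x).
Proof. by rewrite sin_mul_sin /angm; congr (cos _ - cos _); field. Qed.

Lemma sinp_cos_angm t : 2 * (sinp t * cos (angm t)) = sin (t - x) + sin (x + alpha).
Proof. by rewrite sin_mul_cos /angm; congr (sin _ + sin _); field. Qed.

Lemma sinp_sinm t : 2 * (sinp t * sinm t) = cos alpha - cos t.
Proof. by rewrite sin_mul_sin; congr (cos _ - cos _); field. Qed.

(** [p1] and [q1] are the coefficients of [cos (n t)] and [sin (n t)] in [x1 sin (n t + angp) - y1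
    cos (n t + angp)]; [p2] and [q2] likewise with [angm]. At fixed [t] each pair is an orthogonal
    image of its [(x, y)]. *)
Definition q1 (x1 y1 t : R) := x1 * cos (angp t) + y1 * sin (angp t).
Definition p1 (x1 y1 t : R) := x1 * sin (angp t) - y1 * cos (angp t).
Definition q2 (x2 y2 t : R) := x2 * cos (angm t) + y2 * sin (angm t).
Definition p2 (x2 y2 t : R) := x2 * sin (angm t) - y2 * cos (angm t).

Lemma tp_pcoef x1 y1 x2 y2 t : tp (pcoef x1 y1 x2 y2) t =
  2 * (sinm t * p1 x1 y1 t + sinp t * p2 x2 y2 t).
Proof.
transitivity (x1 * (2 * (sinm t * sin (angp t))) - y1 * (2 * (sinm t * cos (angp t)))
  + x2 * (2 * (sinp t * sin (angm t))) - y2 * (2 * (sinp t * cos (angm t)))); last first.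
  by rewrite /p1 /p2; ring.
rewrite sinm_sin_angp sinm_cos_angp sinp_sin_angm sinp_cos_angm.
by rewrite /tp/= !(sinD t) !(cosD t) !sinN !cosN; ring.
Qed.

Lemma tp_qcoef x1 y1 x2 y2 t : tp (qcoef x1 y1 x2 y2) t =
  2 * (sinm t * q1 x1 y1 t + sinp t * q2 x2 y2 t).
Proof.
transitivity (x1 * (2 * (sinm t * cos (angp t))) + y1 * (2 * (sinm t * sin (angp t)))
  + x2 * (2 * (sinp t * cos (angm t))) + y2 * (2 * (sinp t * sin (angm t)))); last first.
  by rewrite /q1 /q2; ring.
rewrite sinm_sin_angp sinm_cos_angp sinp_sin_angm sinp_cos_angm.
by rewrite /tp/= !(sinD t) !(cosD t) !sinN !cosN; ring.
Qed.

(** The slow term too depends only on [p1], [q1], [p2], [q2] at [t], so that one set of normal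
    coordinates serves all three coefficients. *)
Lemma tp_wcoef x1 y1 x2 y2 t : tp (wcoef x1 y1 x2 y2) t =
  2 * (sin x * (sinm t * q1 x1 y1 t - sinp t * q2 x2 y2 t)
     - cos x * (sinm t * p1 x1 y1 t + sinp t * p2 x2 y2 t)).
Proof.
transitivity (x1 * (sin x * (2 * (sinm t * cos (angp t))) - cos x * (2 * (sinm t * sin (angp t))))
  + y1 * (sin x * (2 * (sinm t * sin (angp t))) + cos x * (2 * (sinm t * cos (angp t))))
  - x2 * (sin x * (2 * (sinp t * cos (angm t))) + cos x * (2 * (sinp t * sin (angm t))))
  - y2 * (sin x * (2 * (sinp t * sin (angm t))) - cos x * (2 * (sinp t * cos (angm t))))); last first.
  by rewrite /q1 /q2 /p1 /p2; ring.
rewrite sinm_sin_angp sinm_cos_angp sinp_sin_angm sinp_cos_angm.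
have h := cos2Dsin2 x; have {}h : sin x ^+ 2 = 1 - cos x ^+ 2 by rewrite -h; ring.
rewrite /tp/= !(sinD t) !(cosD t) !sinN !cosN (sinD x) (cosD x).
transitivity ((y2 - y1) * sin alpha * (cos x ^+ 2 + sin x ^+ 2) - (x1 + x2) * cos alpha * (cos x ^+ 2 + sin x ^+ 2)
   + (x1 + x2) * cos t * (cos x ^+ 2 + sin x ^+ 2) + (y1 + y2) * sin t * (cos x ^+ 2 + sin x ^+ 2)).
  by rewrite cos2Dsin2 !mulr1.
by ring.
Qed.

(* [pcoef] and [qcoef] vanish together at some [t] only if [cdet] is zero. *)
Definition cdet (x1 y1 x2 y2 : R) :=
  cos (2 * x + alpha) * (y1 * x2 - x1 * y2) - sin (2 * x + alpha) * (x1 * x2 + y1 * y2).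

(** The determinant involves only the difference [angp - angm = 2 x + alpha], in which [t]
    cancels. *)
Lemma cdetE x1 y1 x2 y2 t :
  q1 x1 y1 t * p2 x2 y2 t - p1 x1 y1 t * q2 x2 y2 t = cdet x1 y1 x2 y2.
Proof.
have e : 2 * x + alpha = angp t - angm t by rewrite /angp /angm; field.
by rewrite /cdet e sinB cosB /q1 /q2 /p1 /p2; ring.
Qed.

(** The two half angles differ by [alpha], so their sines cannot both vanish. *)
Lemma rho_gt0 t : sin alpha != 0 -> 0 < sinp t ^+ 2 + sinm t ^+ 2.
Proof.
move=> sa; rewrite lt0r addr_ge0 ?sqr_ge0// andbT paddr_eq0 ?sqr_ge0// !sqrf_eq0.
apply: contra sa => /andP[/eqP a0 /eqP b0].
have e : alpha = (t + alpha) / 2 - (t - alpha) / 2 by field.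
by rewrite e sinB -/(sinp t) -/(sinm t) a0 b0 mul0r mulr0 subrr.
Qed.

(** If both coefficients vanish at [t], then [(sinm, sinp)] solves a homogeneous system whose
    determinant is [cdet] up to sign, and it is not zero by [rho_gt0]. *)
Lemma amp_coef_gt0 x1 y1 x2 y2 t : sin alpha != 0 -> cdet x1 y1 x2 y2 != 0 ->
  0 < amp (pcoef x1 y1 x2 y2) (qcoef x1 y1 x2 y2) t.
Proof.
move=> sa; apply: contraNT; rewrite /amp sqrtr_gt0 -leNgt => h.
have : (tp (pcoef x1 y1 x2 y2) t ^+ 2 + tp (qcoef x1 y1 x2 y2) t ^+ 2) == 0.
  by rewrite eq_le h addr_ge0 ?sqr_ge0.
rewrite paddr_eq0 ?sqr_ge0// !sqrf_eq0 tp_pcoef tp_qcoef.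
rewrite !mulf_eq0 (_ : (2 == 0 :> R) = false) ?pnatr_eq0//= => /andP[/eqP hp /eqP hq].
have r0 := rho_gt0 t sa.
rewrite -(cdetE _ _ _ _ t).
have ha : sinp t * (q1 x1 y1 t * p2 x2 y2 t - p1 x1 y1 t * q2 x2 y2 t) = 0.
  transitivity (q1 x1 y1 t * (sinm t * p1 x1 y1 t + sinp t * p2 x2 y2 t)
     - p1 x1 y1 t * (sinm t * q1 x1 y1 t + sinp t * q2 x2 y2 t)); first by ring.
  by rewrite hp hq !mulr0 subrr.
have hb : sinm t * (q1 x1 y1 t * p2 x2 y2 t - p1 x1 y1 t * q2 x2 y2 t) = 0.
  transitivity (p2 x2 y2 t * (sinm t * q1 x1 y1 t + sinp t * q2 x2 y2 t)
     - q2 x2 y2 t * (sinm t * p1 x1 y1 t + sinp t * p2 x2 y2 t)); first by ring.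
  by rewrite hp hq !mulr0 subrr.
move: ha hb => /eqP; rewrite mulf_eq0 => /orP[/eqP a0|->//] /eqP.
by rewrite mulf_eq0 => /orP[/eqP b0|->//]; move: r0; rewrite a0 b0 expr0n addr0 ltxx.
Qed.

Section FixedTime.
Variable t : R.
Hypothesis sa : sin alpha != 0.
Let r := Num.sqrt (sinp t ^+ 2 + sinm t ^+ 2).
Let r0 : 0 < r. Proof. by rewrite sqrtr_gt0 rho_gt0. Qed.
Let r2 : r ^+ 2 = sinp t ^+ 2 + sinm t ^+ 2.
Proof. by rewrite sqr_sqrtr// ltW// rho_gt0. Qed.

(** Writing [(sinm, sinp)] as [r (cos phi, sin phi)], [kpar] and [lpar] are the cosine and sine of
    [2 phi]. *)
Definition kpar := (sinm t ^+ 2 - sinp t ^+ 2) / (sinp t ^+ 2 + sinm t ^+ 2).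
Definition lpar := 2 * (sinp t * sinm t) / (sinp t ^+ 2 + sinm t ^+ 2).

Lemma kpar_lpar_unit : kpar ^+ 2 + lpar ^+ 2 = 1.
Proof. by rewrite /kpar /lpar; field; rewrite gt_eqF// rho_gt0. Qed.

(** The pairs [(q1, q2)] and [(p1, p2)] turned by the angle [phi]: [coneX] and [coneY] are the
    values of [q] and [p] up to the factor [2 r], and [coneZ], [coneW] complete them
    orthonormally. *)
Definition coneX x1 y1 x2 y2 := (sinm t * q1 x1 y1 t + sinp t * q2 x2 y2 t) / r.
Definition coneY x1 y1 x2 y2 := (sinm t * p1 x1 y1 t + sinp t * p2 x2 y2 t) / r.
Definition coneZ x1 y1 x2 y2 := (sinm t * q2 x2 y2 t - sinp t * q1 x1 y1 t) / r.
Definition coneW x1 y1 x2 y2 := (sinm t * p2 x2 y2 t - sinp t * p1 x1 y1 t) / r.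

Lemma tp_wcoef_cone x1 y1 x2 y2 : tp (wcoef x1 y1 x2 y2) t =
  2 * r * (sin x * (kpar * coneX x1 y1 x2 y2 - lpar * coneZ x1 y1 x2 y2) - cos x * coneY x1 y1 x2 y2).
Proof.
rewrite tp_wcoef /kpar /lpar /coneX /coneY /coneZ -r2.
have h : r ^+ 2 = sinp t ^+ 2 + sinm t ^+ 2 := r2.
move: (q1 _ _ _) (q2 _ _ _) (p1 _ _ _) (p2 _ _ _) => Q1 Q2 P1 P2.
move: (sinp t) (sinm t) (r) h r0 => a b z h z0.
have e : (b ^+ 2 - a ^+ 2) / z ^+ 2 * ((b * Q1 + a * Q2) / z)
  - 2 * (a * b) / z ^+ 2 * ((b * Q2 - a * Q1) / z) = (b * Q1 - a * Q2) / z.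
  transitivity ((a ^+ 2 + b ^+ 2) / z ^+ 2 * ((b * Q1 - a * Q2) / z)).
    by field; rewrite gt_eqF.
  by rewrite -h divff ?mul1r// expf_neq0// gt_eqF.
by rewrite e; field; rewrite gt_eqF.
Qed.

Lemma tp_pcoef_cone x1 y1 x2 y2 : tp (pcoef x1 y1 x2 y2) t = 2 * r * coneY x1 y1 x2 y2.
Proof. by rewrite tp_pcoef /coneY; field; rewrite gt_eqF. Qed.

Lemma tp_qcoef_cone x1 y1 x2 y2 : tp (qcoef x1 y1 x2 y2) t = 2 * r * coneX x1 y1 x2 y2.
Proof. by rewrite tp_qcoef /coneX; field; rewrite gt_eqF. Qed.

Lemma gap_coef x1 y1 x2 y2 : exists2 c : R, 0 < c &
  gap (pcoef x1 y1 x2 y2) (qcoef x1 y1 x2 y2) (wcoef x1 y1 x2 y2) t =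
  c * (`|sin x * (kpar * coneX x1 y1 x2 y2 - lpar * coneZ x1 y1 x2 y2) - cos x * coneY x1 y1 x2 y2|
    - Num.sqrt (coneX x1 y1 x2 y2 ^+ 2 + coneY x1 y1 x2 y2 ^+ 2)).
Proof.
exists (2 * r); first by rewrite mulr_gt0.
rewrite /gap /amp tp_wcoef_cone tp_pcoef_cone tp_qcoef_cone normrM ger0_norm ?mulr_ge0 ?ltW//.
rewrite (_ : (2 * r * _) ^+ 2 + _ = (2 * r) ^+ 2 * (coneX x1 y1 x2 y2 ^+ 2 + coneY x1 y1 x2 y2 ^+ 2)); last by ring.
have q : 0 <= 2 * r by rewrite mulr_ge0// ltW.
by rewrite (sqrtrM _ (sqr_ge0 _)) sqrtr_sqr (ger0_norm q) [RHS]mulrBr.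
Qed.

Lemma gap_lt0_cone x1 y1 x2 y2 :
  gap (pcoef x1 y1 x2 y2) (qcoef x1 y1 x2 y2) (wcoef x1 y1 x2 y2) t < 0 <->
  cone kpar lpar x (coneX x1 y1 x2 y2) (coneY x1 y1 x2 y2) (coneZ x1 y1 x2 y2).
Proof.
have [c c0 ->] := gap_coef x1 y1 x2 y2.
rewrite pmulr_rlt0// subr_lt0 /cone.
set u := (X in `|X|); set v := (X in Num.sqrt X).
by rewrite -ltr_sqr ?nnegrE ?sqrtr_ge0// real_normK ?num_real// sqr_sqrtr// addr_ge0 ?sqr_ge0.
Qed.

Lemma gap_eq0_cone x1 y1 x2 y2 :
  gap (pcoef x1 y1 x2 y2) (qcoef x1 y1 x2 y2) (wcoef x1 y1 x2 y2) t = 0 <->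
  (sin x * (kpar * coneX x1 y1 x2 y2 - lpar * coneZ x1 y1 x2 y2) - cos x * coneY x1 y1 x2 y2) ^+ 2 =
  coneX x1 y1 x2 y2 ^+ 2 + coneY x1 y1 x2 y2 ^+ 2.
Proof.
have [c c0 ->] := gap_coef x1 y1 x2 y2.
set u := (X in `|X|); set v := (X in Num.sqrt X).
have v0 : 0 <= v by rewrite addr_ge0 ?sqr_ge0.
split.
  move=> /eqP; rewrite mulf_eq0 gt_eqF//= subr_eq0 => /eqP h.
  by rewrite -(real_normK (num_real u)) h sqr_sqrtr.
by move=> h; rewrite -sqrtr_sqr h subrr mulr0.
Qed.

Lemma iid4_cone d (T : measurableType d) (P : probability T R) (X1 Y1 X2 Y2 : T -> R) :
  iid4 P X1 Y1 X2 Y2 ->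
  iid4 P (fun w => coneX (X1 w) (Y1 w) (X2 w) (Y2 w))
         (fun w => coneY (X1 w) (Y1 w) (X2 w) (Y2 w))
         (fun w => coneZ (X1 w) (Y1 w) (X2 w) (Y2 w))
         (fun w => coneW (X1 w) (Y1 w) (X2 w) (Y2 w)).
Proof.
move=> H; have [m1 m2 m3 m4 _] := H.
have mq1 : measurable_fun setT (fun w => q1 (X1 w) (Y1 w) t).
  by apply: measurable_funD; exact: measurable_funM.
have mp1 : measurable_fun setT (fun w => p1 (X1 w) (Y1 w) t).
  by apply: measurable_funB; exact: measurable_funM.
have mq2 : measurable_fun setT (fun w => q2 (X2 w) (Y2 w) t).
  by apply: measurable_funD; exact: measurable_funM.
have mp2 : measurable_fun setT (fun w => p2 (X2 w) (Y2 w) t).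
  by apply: measurable_funB; exact: measurable_funM.
apply: (iid4_transform H).
- by apply: measurable_funM => //; apply: measurable_funD; exact: measurable_funM.
- by apply: measurable_funM => //; apply: measurable_funD; exact: measurable_funM.
- by apply: measurable_funM => //; apply: measurable_funB; exact: measurable_funM.
- by apply: measurable_funM => //; apply: measurable_funB; exact: measurable_funM.
move=> a b c e.
(* Coefficients for the transposed map: the rotation by [phi] is undone here, then the orthogonal
   maps of angles [angp] and [angm] below. *)
pose u1 := (a * sinm t - c * sinp t) / r; pose v1 := (b * sinm t - e * sinp t) / r.
pose u2 := (a * sinp t + c * sinm t) / r; pose v2 := (b * sinp t + e * sinm t) / r.
exists (u1 * cos (angp t) + v1 * sin (angp t)), (u1 * sin (angp t) - v1 * cos (angp t)),
  (u2 * cos (angm t) + v2 * sin (angm t)), (u2 * sin (angm t) - v2 * cos (angm t)); split.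
  have h1 := cos2Dsin2 (angp t); have h2 := cos2Dsin2 (angm t).
  transitivity ((u1 ^+ 2 + v1 ^+ 2) * (cos (angp t) ^+ 2 + sin (angp t) ^+ 2) +
     (u2 ^+ 2 + v2 ^+ 2) * (cos (angm t) ^+ 2 + sin (angm t) ^+ 2)); first by ring.
  rewrite h1 h2 !mulr1 /u1 /v1 /u2 /v2.
  have h : r ^+ 2 = sinp t ^+ 2 + sinm t ^+ 2 := r2.
  move: (sinp t) (sinm t) (r) h r0 => a' b' z h z0.
  transitivity ((a ^+ 2 + b ^+ 2 + c ^+ 2 + e ^+ 2) * ((a' ^+ 2 + b' ^+ 2) / z ^+ 2)).
    by field; rewrite gt_eqF.
  by rewrite -h divff ?mulr1// expf_neq0// gt_eqF.
move=> w; rewrite /coneX /coneY /coneZ /coneW /q1 /q2 /p1 /p2 /u1 /v1 /u2 /v2.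
by move: (r)^-1 => z; ring.
Qed.

(** Half angle formulas turn the denominator of [gfun] into [(sinp^2 + sinm^2) / 2] times the one on
    the left, and the same factor relates the numerators. *)
Lemma gfun_cone u : lpar * sin x / (1 - cos x * cos u + kpar * sin x * sin u) = gfun alpha x t u.
Proof.
have rho := rho_gt0 t sa.
have half (y : R) : sin (y / 2) ^+ 2 = (1 - cos y) / 2.
  have {2}-> : y = y / 2 + y / 2 by field.
  have h := cos2Dsin2 (y / 2); rewrite cosD -!expr2.
  by lra.
rewrite /gfun !half (cosB u) (cosD u) -/(sinp t) -/(sinm t).
rewrite -[(1 - cos (t + alpha)) / 2]half -[(1 - cos (t - alpha)) / 2]half -/(sinp t) -/(sinm t).
have -> : (1 - (cos u * cos x + sin u * sin x)) / 2 * sinp t ^+ 2 +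
   (1 - (cos u * cos x - sin u * sin x)) / 2 * sinm t ^+ 2 =
   (sinp t ^+ 2 + sinm t ^+ 2) / 2 * (1 - cos x * cos u + kpar * sin x * sin u).
  by rewrite /kpar; field; rewrite gt_eqF.
rewrite /lpar; move: (1 - _ + _) => D.
rewrite invfM; move: (D^-1) => D'.
by field; rewrite gt_eqF.
Qed.

End FixedTime.
End Coefficients.

(** * Null events and the probability of a negative gap *)

Section NullEvents.
Context {R : realType} {d : measure_display} {T : measurableType d}.
Variable P : probability T R.
Local Notation mu := (@lebesgue_measure R).
Local Notation RT := (measurableTypeR R).
Implicit Types X Y Z W : T -> R.

Lemma gam_null (A : set RT) : measurable A -> mu A = 0%E -> gam A = 0%E.
Proof.
move=> mA A0; have -> : gam A = (\int[gam]_x (\1_A x)%:E)%E.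
  by rewrite integral_indic// setIT.
rewrite ge0_integral_gam; last 2 first.
- by apply/measurable_EFinP; exact: measurable_indic.
- by move=> x; rewrite lee_fin indicE.
transitivity (\int[mu]_(x in A) (gpdf x)%:E)%E.
  rewrite [RHS]integral_mkcond; apply: eq_integral => x _.
  by rewrite patchE indicE; case: (x \in A); rewrite ?mul1e ?mul0e.
apply: null_set_integral => //.
apply: (measurable_funS measurableT) => //.
by apply/measurable_EFinP; exact: measurable_gpdf.
Qed.

Lemma measureU_null d' (S : measurableType d') (m : {measure set S -> \bar R}) (A B : set S) :
  measurable A -> measurable B -> m A = 0%E -> m B = 0%E -> m (A `|` B) = 0%E.
Proof.
move=> mA mB A0 B0; apply/eqP; rewrite eq_le measure_ge0 andbT.
have h : (m A + m B <= 0)%E by rewrite A0 B0 adde0.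
exact: le_trans (measureU2 _ mA mB) h.
Qed.

Lemma gam_set2 (a b : R) (A : set RT) : measurable A -> A `<=` [set a; b] -> gam A = 0%E.
Proof.
move=> mA Aab; apply: gam_null => //; apply/eqP; rewrite eq_le measure_ge0 andbT.
apply: (@le_trans _ _ (mu [set a; b])).
  by apply: le_measure => //; rewrite inE//; apply: measurableU; exact: measurable_set1.
by rewrite measureU_null//; exact: lebesgue_measure_set1.
Qed.

Lemma iid4_eq0_null X Y Z W : iid4 P X Y Z W -> P [set w | X w = 0] = 0%E.
Proof.
move=> H; have := iid4_rect H (measurable_set1 (0 : RT)) measurableT measurableT measurableT.
rewrite !preimage_setT !setIT => ->.
have -> : gam [set (0 : RT)] = 0%E by apply: (@gam_set2 0 0); [exact: measurable_set1|move=> y; left].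
by rewrite !mul0r.
Qed.

(** Given the first three variables, the last is confined to at most two values, which the normal
    law does not charge. *)
Lemma iid4_last_null X Y Z W (A : set (RT * (RT * (RT * RT)))) : iid4 P X Y Z W -> measurable A ->
  (forall x y z, exists a b : R, forall u, A (x, (y, (z, u))) -> u = a \/ u = b) ->
  P [set w | A (X w, (Y w, (Z w, W w)))] = 0%E.
Proof.
move=> H mA h; rewrite (iid4_prob H mA).
rewrite integral0_eq// => x _; rewrite integral0_eq// => y _; rewrite integral0_eq// => z _.
have mS : measurable [set u : RT | A (x, (y, (z, u)))].
  have m : measurable_fun setT (fun u : RT => (x, (y, (z, u))) : RT * (RT * (RT * RT))).
    by do !(apply: measurable_fun_pair => //).
  by rewrite -[X in measurable X]setTI; exact: m.
transitivity (gam [set u : RT | A (x, (y, (z, u)))]).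
  transitivity (\int[gam]_u (\1_[set u : RT | A (x, (y, (z, u)))] u)%:E)%E.
    by apply: eq_integral => u _; rewrite !indicE.
  by rewrite integral_indic// setIT.
have [a [b ab]] := h x y z.
exact: (@gam_set2 a b).
Qed.

(** Turning [(X1, Y1)] by [2 x + alpha] changes the determinant into [V X2 - U Y2], which for
    [U <> 0] vanishes at a single value of [Y2]. *)
Lemma cdet_null (alpha x : R) X1 Y1 X2 Y2 : iid4 P X1 Y1 X2 Y2 ->
  P [set w | cdet alpha x (X1 w) (Y1 w) (X2 w) (Y2 w) = 0] = 0%E.
Proof.
move=> H; have [m1 m2 m3 m4 _] := H.
pose c := cos (2 * x + alpha); pose s := sin (2 * x + alpha).
pose U w := c * X1 w + s * Y1 w; pose V w := c * Y1 w - s * X1 w.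
have H' : iid4 P U V X2 Y2.
  apply: (iid4_transform H) => //.
  - by apply: measurable_funD; exact: measurable_funM.
  - by apply: measurable_funB; exact: measurable_funM.
  move=> a b e r; exists (c * a - s * b), (s * a + c * b), e, r; split.
    transitivity ((a ^+ 2 + b ^+ 2) * (c ^+ 2 + s ^+ 2) + e ^+ 2 + r ^+ 2); first by ring.
    by rewrite cos2Dsin2 mulr1.
  by move=> w; rewrite /U /V; ring.
pose A : set (RT * (RT * (RT * RT))) :=
  [set z | z.2.1 * z.2.2.1 - z.1 * z.2.2.2 = 0 /\ z.1 <> 0].
have mz1 : measurable_fun setT (fun z : RT * (RT * (RT * RT)) => z.1) by exact: measurable_fst.
have mz2 : measurable_fun setT (fun z : RT * (RT * (RT * RT)) => z.2.1).
  by apply: measurableT_comp; [exact: measurable_fst|exact: measurable_snd].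
have mz3 : measurable_fun setT (fun z : RT * (RT * (RT * RT)) => z.2.2.1).
  apply: measurableT_comp; first exact: measurable_fst.
  by apply: measurableT_comp; exact: measurable_snd.
have mz4 : measurable_fun setT (fun z : RT * (RT * (RT * RT)) => z.2.2.2).
  apply: measurableT_comp; first exact: measurable_snd.
  by apply: measurableT_comp; exact: measurable_snd.
have mA : measurable A.
  have mF : measurable_fun setT (fun z : RT * (RT * (RT * RT)) => z.2.1 * z.2.2.1 - z.1 * z.2.2.2).
    by apply: measurable_funB; exact: measurable_funM.
  have -> : A = (setT `&` (fun z : RT * (RT * (RT * RT)) => z.2.1 * z.2.2.1 - z.1 * z.2.2.2) @^-1` [set 0])
    `&` (setT `&` (fun z : RT * (RT * (RT * RT)) => z.1) @^-1` (~` [set 0])).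
    by apply/seteqP; split => z; rewrite /A/= => -[]; [move=> ? ?|move=> [_ ?] [_ ?]].
  apply: measurableI; first by apply: mF => //; exact: measurable_set1.
  by apply: mz1 => //; apply: measurableC; exact: measurable_set1.
have nA : P [set w | A (U w, (V w, (X2 w, Y2 w)))] = 0%E.
  apply: (iid4_last_null H') => // a b e; exists (b * e / a), (b * e / a) => u; rewrite /A/= => -[h a0].
  by left; move/eqP: a0 => a0; apply: (canRL (mulfK a0)); lra.
have mU0 : measurable [set w | U w = 0].
  rewrite -[X in measurable X]setTI; have [mU _ _ _ _] := H'.
  by apply: (mU measurableT [set 0]); exact: measurable_set1.
have mAw : measurable [set w | A (U w, (V w, (X2 w, Y2 w)))].
  have [mU mV _ _ _] := H'.
  have m : measurable_fun setT (fun w => (U w, (V w, (X2 w, Y2 w))) : RT * (RT * (RT * RT))).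
    by do !(apply: measurable_fun_pair => //).
  by rewrite -[X in measurable X]setTI; exact: m.
have mD : measurable [set w | cdet alpha x (X1 w) (Y1 w) (X2 w) (Y2 w) = 0].
  have m : measurable_fun setT (fun w => cdet alpha x (X1 w) (Y1 w) (X2 w) (Y2 w)).
    apply: measurable_funB; apply: measurable_funM => //.
      by apply: measurable_funB; exact: measurable_funM.
    by apply: measurable_funD; exact: measurable_funM.
  rewrite -[X in measurable X]setTI.
  by apply: (m measurableT [set 0]); exact: measurable_set1.
apply/eqP; rewrite eq_le measure_ge0 andbT.
apply: (@le_trans _ _ (P ([set w | A (U w, (V w, (X2 w, Y2 w)))] `|` [set w | U w = 0]))).
  apply: le_measure; rewrite ?inE//; first exact: measurableU.
  move=> w /= h; have [U0|U0] := pselect (U w = 0); [by right|left].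
  split => //=; rewrite -h /cdet -/c -/s /U /V; ring.
by rewrite measureU_null//; exact: (iid4_eq0_null H').
Qed.

(** As [l sin x] is nonzero, the boundary equation has at most two roots in [Z], which is moved to
    the last place. *)
Lemma cone_boundary_null (k l x : R) X Y Z W : iid4 P X Y Z W -> l * sin x != 0 ->
  P [set w | (sin x * (k * X w - l * Z w) - cos x * Y w) ^+ 2 = X w ^+ 2 + Y w ^+ 2] = 0%E.
Proof.
move=> H s0; have [mX mY mZ mW _] := H.
have H' : iid4 P X Y W Z.
  apply: (iid4_transform H) => // a b c e; exists a, b, e, c; split=> [|w]; ring.
pose F (z : RT * (RT * (RT * RT))) : R :=
  (sin x * (k * z.1 - l * z.2.2.2) - cos x * z.2.1) ^+ 2 - (z.1 ^+ 2 + z.2.1 ^+ 2).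
pose A := [set z | F z = 0].
have mz1 : measurable_fun setT (fun z : RT * (RT * (RT * RT)) => z.1) by exact: measurable_fst.
have mz2 : measurable_fun setT (fun z : RT * (RT * (RT * RT)) => z.2.1).
  by apply: measurableT_comp; [exact: measurable_fst|exact: measurable_snd].
have mz4 : measurable_fun setT (fun z : RT * (RT * (RT * RT)) => z.2.2.2).
  apply: measurableT_comp; first exact: measurable_snd.
  by apply: measurableT_comp; exact: measurable_snd.
have mA : measurable A.
  have mF : measurable_fun setT F.
    apply: measurable_funB; last by apply: measurable_funD; exact: measurable_funX.
    apply: measurable_funX; apply: measurable_funB; last exact: measurable_funM.
    by apply: measurable_funM => //; apply: measurable_funB; exact: measurable_funM.
  rewrite -[X in measurable X]setTI.
  by apply: (mF measurableT [set 0]); exact: measurable_set1.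
have -> : [set w | (sin x * (k * X w - l * Z w) - cos x * Y w) ^+ 2 = X w ^+ 2 + Y w ^+ 2] =
  [set w | A (X w, (Y w, (W w, Z w)))].
  by apply/seteqP; split => w; rewrite /A/F/= => h; lra.
apply: (iid4_last_null H' mA) => a b e.
pose m := sin x * (k * a) - cos x * b; pose r := Num.sqrt (a ^+ 2 + b ^+ 2).
exists ((m - r) / (l * sin x)), ((m + r) / (l * sin x)) => u; rewrite /A/F/= => /eqP.
have r2 : r ^+ 2 = a ^+ 2 + b ^+ 2 by rewrite sqr_sqrtr// addr_ge0 ?sqr_ge0.
rewrite subr_eq0 -r2 eqf_sqr => /orP[]/eqP h; [left|right];
  by apply: (mulIf s0); rewrite divfK// /m; lra.
Qed.

Section Gap.
Variables (alpha x : R) (X1 Y1 X2 Y2 : T -> R).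
Hypotheses (sa : sin alpha != 0) (H : iid4 P X1 Y1 X2 Y2).

Definition gapw w t := gap (pcoef alpha x (X1 w) (Y1 w) (X2 w) (Y2 w))
  (qcoef alpha x (X1 w) (Y1 w) (X2 w) (Y2 w)) (wcoef alpha (X1 w) (Y1 w) (X2 w) (Y2 w)) t.

Lemma lpar_neq0 t : cos t != cos alpha -> lpar alpha t != 0.
Proof.
move=> ct; rewrite /lpar sinp_sinm mulf_neq0//; first by rewrite subr_eq0 eq_sym.
by rewrite invr_eq0 gt_eqF// rho_gt0.
Qed.

Lemma prob_gap_lt0 t : sin x != 0 -> cos t != cos alpha ->
  P [set w | gapw w t < 0] = ((4 * pi)^-1%:E * \int[mu]_(u in `[0%R, (2 * pi)%R])
    (Num.sqrt (1 + `|gfun alpha x t u| ^+ 2))%:E)%E.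
Proof.
move=> sx ct.
under eq_integral do rewrite -gfun_cone// real_normK ?num_real//.
rewrite -(cone_probability (iid4_cone x t sa H)) ?kpar_lpar_unit//; last by rewrite mulf_neq0// lpar_neq0.
by congr (P _); apply/seteqP; split => w /=; rewrite /gapw gap_lt0_cone.
Qed.

Lemma prob_gap_lt0_lt1 t : sin x != 0 -> cos t != cos alpha -> (P [set w | (gapw w t < 0)%R] < 1)%E.
Proof.
move=> sx ct.
have -> : [set w | gapw w t < 0] = [set w | cone (kpar alpha t) (lpar alpha t) x
  (coneX alpha x t (X1 w) (Y1 w) (X2 w) (Y2 w)) (coneY alpha x t (X1 w) (Y1 w) (X2 w) (Y2 w))
  (coneZ alpha x t (X1 w) (Y1 w) (X2 w) (Y2 w))].
  by apply/seteqP; split => w /=; rewrite /gapw gap_lt0_cone.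
have s0 : lpar alpha t * sin x != 0 by rewrite mulf_neq0// lpar_neq0.
exact: (cone_probability_lt1 (kpar alpha t) (iid4_cone x t sa H) s0).
Qed.

Lemma prob_gap_eq0 t : cos t != cos alpha -> P [set w | gapw w t = 0] = 0%E.
Proof.
move=> ct; have HC := iid4_cone x t sa H.
(* When [sin x = 0], [cos x] is a sign and the boundary equation reads [Y^2 = X^2 + Y^2], that is
   [X = 0]. *)
have [sx|sx] := eqVneq (sin x) 0.
  rewrite -(iid4_eq0_null HC); congr (P _); apply/seteqP; split => w /=; rewrite /gapw gap_eq0_cone//.
    have := cos2Dsin2 x; rewrite sx expr0n addr0 mul0r sub0r sqrrN exprMn => ->.
    by rewrite mul1r => /eqP; rewrite eq_sym -subr_eq0 addrK sqrf_eq0 => /eqP.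
  have := cos2Dsin2 x; rewrite sx expr0n addr0 mul0r sub0r sqrrN exprMn => -> ->.
  by rewrite expr0n add0r mul1r.
rewrite -(cone_boundary_null (kpar alpha t) HC (mulf_neq0 (lpar_neq0 ct) sx)).
by congr (P _); apply/seteqP; split => w /=; rewrite /gapw gap_eq0_cone.
Qed.

(** The cone condition reduces to [Y^2 < X^2 + Y^2], hence to [X <> 0]. *)
Lemma prob_gap_lt0_sin0 t : sin x = 0 -> P [set w | gapw w t < 0] = 1%E.
Proof.
move=> sx; have HC := iid4_cone x t sa H.
have [mC _ _ _ _] := HC.
have mE : measurable [set w | coneX alpha x t (X1 w) (Y1 w) (X2 w) (Y2 w) = 0].
  rewrite -[X in measurable X]setTI.
  by apply: (mC measurableT [set 0]); exact: measurable_set1.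
have -> : [set w | gapw w t < 0] = ~` [set w | coneX alpha x t (X1 w) (Y1 w) (X2 w) (Y2 w) = 0].
  apply/seteqP; split => w /=; rewrite /gapw gap_lt0_cone// /cone;
  have := cos2Dsin2 x; rewrite sx expr0n addr0 mul0r sub0r sqrrN exprMn => ->; rewrite mul1r.
    by move=> h h0; move: h; rewrite h0 expr0n add0r ltxx.
  by move=> /eqP h; rewrite ltrDr exprn_even_gt0.
by rewrite probability_setC// (iid4_eq0_null HC) sube0.
Qed.

End Gap.
End NullEvents.

(** * The random sums as oscillations, path by path *)

Section Representation.
Context {R : realType}.
Implicit Types (t th : R).

Lemma dirichlet_cos n th :
  2 * sin (th / 2) * (\sum_(1 <= k < n.+1) cos (k%:R * th)) = sin (n%:R * th + th / 2) - sin (th / 2).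
Proof.
elim: n => [|n IH]; first by rewrite big_nil mulr0 mul0r add0r subrr.
rewrite big_nat_recr//= mulrDr IH -mulrA sin_mul_cos -(natr1 n).
have -> : th / 2 - (n%:R + 1) * th = - (n%:R * th + th / 2) by field.
have -> : th / 2 + (n%:R + 1) * th = (n%:R + 1) * th + th / 2 by ring.
by rewrite sinN; ring.
Qed.

Lemma dirichlet_sin n th :
  2 * sin (th / 2) * (\sum_(1 <= k < n.+1) sin (k%:R * th)) = cos (th / 2) - cos (n%:R * th + th / 2).
Proof.
elim: n => [|n IH]; first by rewrite big_nil mulr0 mul0r add0r subrr.
rewrite big_nat_recr//= mulrDr IH -mulrA sin_mul_sin -(natr1 n).
have -> : th / 2 - (n%:R + 1) * th = - (n%:R * th + th / 2) by field.
have -> : th / 2 + (n%:R + 1) * th = (n%:R + 1) * th + th / 2 by ring.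
by rewrite cosN; ring.
Qed.

Section Identity.
Variables (alpha x : R) (a b : nat -> R) (A A' B B' : R).
Hypothesis aE : forall k, (0 < k)%N -> a k = A * cos (k%:R * alpha) + A' * sin (k%:R * alpha).
Hypothesis bE : forall k, (0 < k)%N -> b k = B * cos (k%:R * alpha) + B' * sin (k%:R * alpha).

(** Product formulas regroup the double frequencies into the kernels at [t + alpha] and
    [t - alpha]. *)
Lemma trig_sum_split n t : 2 * trig_sum a b n t =
  (A - B') * (\sum_(1 <= k < n.+1) cos (k%:R * (t + alpha))) +
  (A' + B) * (\sum_(1 <= k < n.+1) sin (k%:R * (t + alpha))) +
  (A + B') * (\sum_(1 <= k < n.+1) cos (k%:R * (t - alpha))) +
  (B - A') * (\sum_(1 <= k < n.+1) sin (k%:R * (t - alpha))).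
Proof.
rewrite /trig_sum !mulr_sumr -!big_split/=; apply: eq_big_nat => k /andP[k0 _].
by rewrite aE// bE// !mulrDr !mulrN !(sinD (k%:R * t)) !(cosD (k%:R * t)) !sinN !cosN; ring.
Qed.

(** The fast terms are linear in [cos (n alpha)] and [sin (n alpha)], so the sign [e] comes out of
    them. The slow term stems from the constant parts of the Dirichlet numerators and has no such
    sign; as [e^2 = 1], factoring [e] out leaves it with [e]. The scalar [c] absorbs a normalization
    of the coefficients. *)
Lemma trig_sum_oscil (c x1 y1 x2 y2 e : R) n t :
  A - B' = c * x1 -> A' + B = c * y1 -> A + B' = c * x2 -> B - A' = c * y2 ->
  e ^+ 2 = 1 -> cos (n%:R * alpha) = e * cos x -> sin (n%:R * alpha) = e * sin x ->
  4 * (cos alpha - cos t) * trig_sum a b n t =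
  c * e * oscil (pcoef alpha x x1 y1 x2 y2) (qcoef alpha x x1 y1 x2 y2)
    (e *: wcoef alpha x1 y1 x2 y2) n%:R t.
Proof.
move=> e1 e2 e3 e4 ee ec es.
have hp : sin (n%:R * (t + alpha) + (t + alpha) / 2) = e * sin (n%:R * t + angp alpha x t).
  have -> : n%:R * (t + alpha) + (t + alpha) / 2 = n%:R * alpha + (n%:R * t + (t + alpha) / 2) by ring.
  have -> : n%:R * t + angp alpha x t = x + (n%:R * t + (t + alpha) / 2) by rewrite /angp; ring.
  by rewrite (sinD (n%:R * alpha)) ec es (sinD x); ring.
have hp' : cos (n%:R * (t + alpha) + (t + alpha) / 2) = e * cos (n%:R * t + angp alpha x t).
  have -> : n%:R * (t + alpha) + (t + alpha) / 2 = n%:R * alpha + (n%:R * t + (t + alpha) / 2) by ring.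
  have -> : n%:R * t + angp alpha x t = x + (n%:R * t + (t + alpha) / 2) by rewrite /angp; ring.
  by rewrite (cosD (n%:R * alpha)) ec es (cosD x); ring.
have hm : sin (n%:R * (t - alpha) + (t - alpha) / 2) = e * sin (n%:R * t + angm alpha x t).
  have -> : n%:R * (t - alpha) + (t - alpha) / 2 = (n%:R * t + (t - alpha) / 2) - n%:R * alpha by ring.
  have -> : n%:R * t + angm alpha x t = (n%:R * t + (t - alpha) / 2) - x by rewrite /angm; ring.
  by rewrite (sinB _ (n%:R * alpha)) ec es (sinB _ x); ring.
have hm' : cos (n%:R * (t - alpha) + (t - alpha) / 2) = e * cos (n%:R * t + angm alpha x t).
  have -> : n%:R * (t - alpha) + (t - alpha) / 2 = (n%:R * t + (t - alpha) / 2) - n%:R * alpha by ring.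
  have -> : n%:R * t + angm alpha x t = (n%:R * t + (t - alpha) / 2) - x by rewrite /angm; ring.
  by rewrite (cosB _ (n%:R * alpha)) ec es (cosB _ x); ring.
have cp := dirichlet_cos n (t + alpha); have sp := dirichlet_sin n (t + alpha).
have cm := dirichlet_cos n (t - alpha); have sm := dirichlet_sin n (t - alpha).
rewrite hp -/(sinp alpha t) in cp; rewrite hp' -/(sinp alpha t) in sp.
rewrite hm -/(sinm alpha t) in cm; rewrite hm' -/(sinm alpha t) in sm.
have w1 : sin t - sin alpha = 2 * (sinm alpha t * cos ((t + alpha) / 2)).
  rewrite sin_mul_cos; have -> : (t - alpha) / 2 + (t + alpha) / 2 = t by field.
  have -> : (t - alpha) / 2 - (t + alpha) / 2 = - alpha by field.
  by rewrite sinN.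
have w2 : sin t + sin alpha = 2 * (sinp alpha t * cos ((t - alpha) / 2)).
  by rewrite sin_mul_cos; congr (sin _ + sin _); field.
have W : tp (wcoef alpha x1 y1 x2 y2) t =
  2 * (sinm alpha t * (y1 * cos ((t + alpha) / 2) - x1 * sinp alpha t) +
       sinp alpha t * (y2 * cos ((t - alpha) / 2) - x2 * sinm alpha t)).
  transitivity (y1 * (sin t - sin alpha) + y2 * (sin t + sin alpha) - (x1 + x2) * (cos alpha - cos t)).
    by rewrite /tp /=; ring.
  by rewrite w1 w2 -(sinp_sinm alpha t); ring.
have -> : 4 * (cos alpha - cos t) * trig_sum a b n t =
  (2 * (sinp alpha t * sinm alpha t)) * 2 * (2 * trig_sum a b n t).
  by rewrite sinp_sinm; ring.
rewrite trig_sum_split e1 e2 e3 e4.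
move: cp sp cm sm; move: (\sum_(_ <= _ < _) _) (\sum_(_ <= _ < _) _) (\sum_(_ <= _ < _) _) (\sum_(_ <= _ < _) _).
move=> S' C' S C cp sp cm sm.
transitivity (2 * c * (sinm alpha t * (x1 * (2 * sinp alpha t * C) + y1 * (2 * sinp alpha t * S)) +
   sinp alpha t * (x2 * (2 * sinm alpha t * C') + y2 * (2 * sinm alpha t * S')))).
  by ring.
rewrite cp sp cm sm /oscil tpZ W tp_pcoef tp_qcoef /p1 /p2 /q1 /q2.
rewrite !(sinD (n%:R * t)) !(cosD (n%:R * t)) -/(sinp alpha t) -/(sinm alpha t).
move: (cos (n%:R * t)) (sin (n%:R * t)) (cos (angp _ _ _)) (sin (angp _ _ _)) => N1 N2 P1 P2.
move: (cos (angm _ _ _)) (sin (angm _ _ _)) (cos ((t + alpha) / 2)) (cos ((t - alpha) / 2)) => M1 M2 K1 K2.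
move: (sinp _ _) (sinm _ _) => u v.
pose w := 2 * (v * (y1 * K1 - x1 * u) + u * (y2 * K2 - x2 * v)).
rewrite -/w.
transitivity (c * e * (2 * (v * (x1 * P2 - y1 * P1) + u * (x2 * M2 - y2 * M1)) * N1 +
  2 * (v * (x1 * P1 + y1 * P2) + u * (x2 * M1 + y2 * M2)) * N2) + c * e ^+ 2 * w); last by ring.
by rewrite ee /w; ring.
Qed.

End Identity.

(** Locates the times where the factor [cos alpha - cos t] vanishes: at most two in a period. *)
Lemma cos_eq_cases (alpha : R) t : 0 <= t -> t <= 2 * pi -> cos t = cos alpha ->
  t = acos (cos alpha) \/ t = 2 * pi - acos (cos alpha).
Proof.
move=> t0 t2 <-; have [tpi|pit] := leP t pi; first by left; rewrite cosK// in_itv/= t0.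
right; have e : cos t = cos (2 * pi - t).
  by rewrite cosB mulr_natl cos2pi sin2pi mul1r mul0r addr0.
by rewrite e cosK ?in_itv/=; lra.
Qed.

Lemma uniq_size_filter (s : seq R) (r1 r2 : R) (Q : pred R) : uniq s ->
  (forall z, z \in s -> ~~ Q z -> z = r1 \/ z = r2) ->
  (size s <= size (seq.filter Q s) + 2)%N.
Proof.
move=> us h; rewrite -(count_predC Q) size_filter leq_add2l -size_filter.
rewrite (@leq_trans (size [:: r1; r2]))// uniq_leq_size ?filter_uniq// => z.
by rewrite mem_filter !inE => /andP[/= Qz zs]; case: (h z zs Qz) => ->; rewrite eqxx ?orbT.
Qed.

Lemma in_piZ_sign (y x : R) : in_piZ (y - x) ->
  exists2 e : R, e = 1 \/ e = -1 & cos y = e * cos x /\ sin y = e * sin x.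
Proof.
move=> [m ym]; have {ym} -> : y = x + m%:~R * pi by rewrite mulrC -ym; ring.
have s0 : sin (m%:~R * pi : R) = 0.
  by apply/eqP; rewrite -normr_eq0 -[m%:~R * pi]add0r sinDpik sin0 normr0.
exists (cos (m%:~R * pi)); last by rewrite cosD sinD s0; split; ring.
have := cos2Dsin2 (m%:~R * pi : R); rewrite s0 expr0n addr0 => /eqP.
by rewrite sqrf_eq1 => /orP[]/eqP ->; [left|right].
Qed.

Section Pathwise.
Variables (alpha x : R) (a b : nat -> R) (A A' B B' c x1 y1 x2 y2 : R).
Hypothesis sa : sin alpha != 0.
Hypothesis aE : forall k, (0 < k)%N -> a k = A * cos (k%:R * alpha) + A' * sin (k%:R * alpha).
Hypothesis bE : forall k, (0 < k)%N -> b k = B * cos (k%:R * alpha) + B' * sin (k%:R * alpha).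
Hypothesis c0 : c != 0.
Hypotheses (e1 : A - B' = c * x1) (e2 : A' + B = c * y1)
  (e3 : A + B' = c * x2) (e4 : B - A' = c * y2).
Hypothesis det0 : cdet alpha x x1 y1 x2 y2 != 0.
Local Notation mu := (@lebesgue_measure R).
Let p := pcoef alpha x x1 y1 x2 y2.
Let q := qcoef alpha x x1 y1 x2 y2.
Let w := wcoef alpha x1 y1 x2 y2.
Hypothesis null : mu ([set t | gap p q w t = 0] `&` `[0, 2 * pi[) = 0%E.
Let l := len [set t | gap p q w t < 0] 0 (2 * pi) / pi.

Let f n t := (Num.sqrt n%:R)^-1 * trig_sum a b n t.

Let gapZ e : e = 1 \/ e = -1 -> gap p q (e *: w) = gap p q w.
Proof.
move=> he; apply/funext => t; rewrite /gap tpZ normrM.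
by case: he => ->; rewrite ?normrN normr1 mul1r.
Qed.

(** Every zero of [f n] is one of the oscillation; the converse can fail only where
    [cos t = cos alpha], which costs 2 in the lower bound alone. *)
Lemma num_zeros_pathwise (e : R) : 0 < e -> exists N : nat, forall n, (N <= n)%N ->
  in_piZ (n%:R * alpha - x) ->
  ((n%:R * (l - e) - 2)%:E <= num_zeros (f n) 0 (2 * pi))%E /\
  (num_zeros (f n) 0 (2 * pi) <= (n%:R * (l + e))%:E)%E.
Proof.
move=> e0; have amp0 t : 0 < amp p q t by exact: amp_coef_gt0.
have key s : s = 1 \/ s = -1 -> exists N : nat, forall n : nat, (N <= n)%N ->
    (forall z : seq R, uniq z ->
      (forall y, y \in z -> 0 <= y <= 2 * pi /\ oscil p q (s *: w) n%:R y = 0) ->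
      (size z)%:R <= n%:R * (l + e)) /\
    (exists z : seq R, [/\ uniq z,
      forall y, y \in z -> 0 <= y <= 2 * pi /\ oscil p q (s *: w) n%:R y = 0 &
      n%:R * (l - e) <= (size z)%:R]).
  move=> hs; have := @zeros_asymptotics _ p q (s *: w) amp0 e e0.
  by rewrite gapZ//; apply.
(* The sign of the slow term varies with [n] inside the class, so a rank valid for both signs is
   needed; [gap] is the same for both. *)
have [N1 h1] := key 1 (or_introl erefl); have [N2 h2] := key (-1) (or_intror erefl).
exists (maxn (maxn N1 N2) 1) => n; rewrite !geq_max => /andP[/andP[n1 n2] n0] hn.
have [s hs [cs ss]] := in_piZ_sign hn.
have {h1 h2} [up [z [uz hz lz]]] :
    (forall z : seq R, uniq z ->
      (forall y, y \in z -> 0 <= y <= 2 * pi /\ oscil p q (s *: w) n%:R y = 0) ->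
      (size z)%:R <= n%:R * (l + e)) /\
    (exists z : seq R, [/\ uniq z,
      forall y, y \in z -> 0 <= y <= 2 * pi /\ oscil p q (s *: w) n%:R y = 0 &
      n%:R * (l - e) <= (size z)%:R]).
  by case: hs => ->; [exact: h1|exact: h2].
have s2 : s ^+ 2 = 1 by case: hs => ->; rewrite ?sqrrN expr1n.
have s0 : s != 0 by case: hs => ->; rewrite ?oppr_eq0 oner_eq0.
have sq0 : (Num.sqrt n%:R)^-1 != 0 :> R.
  by rewrite invr_eq0 gt_eqF// sqrtr_gt0 ltr0n.
have id t := trig_sum_oscil aE bE t e1 e2 e3 e4 s2 cs ss.
split.
  apply: (@le_trans _ _ ((size (seq.filter (fun t => cos t != cos alpha) z))%:R%:E)).
    rewrite lee_fin lerBlDr (le_trans lz)// -natrD ler_nat.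
    apply: (@uniq_size_filter _ (acos (cos alpha)) (2 * pi - acos (cos alpha))) => // t tz.
    rewrite negbK => /eqP; apply: cos_eq_cases;
      by have [/andP[]] := hz t tz.
  apply: counting_ge; first exact: filter_uniq.
  move=> t; rewrite mem_filter => /andP[ct tz] /=; have [tI o0] := hz t tz; split => //.
  have := id t; rewrite o0 mulr0 => /eqP.
  rewrite !mulf_eq0 pnatr_eq0/= subr_eq0 eq_sym (negbTE ct)/= => /eqP ts.
  by rewrite /f ts mulr0.
apply: counting_le => z' uz' hz'; rewrite lee_fin; apply: up => // t tz.
have [tI ft] := hz' t tz; split => //.
have := id t; move/eqP: ft; rewrite /f mulf_eq0 (negbTE sq0)/= => /eqP ->.
by rewrite mulr0 => /esym/eqP; rewrite !mulf_eq0 (negbTE c0) (negbTE s0)/= => /eqP.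
Qed.

Lemma num_zeros_ub n : (0 < n)%N -> a 1%N != 0 ->
  (num_zeros (f n) 0 (2 * pi) <= (2 * n + 1)%:R%:E)%E.
Proof.
move=> n0 a1; apply: counting_le => z uz hz; rewrite lee_fin ler_nat.
apply: (@trig_sum_zeros R a b n z n0 a1 uz) => t tz; have [tI ft] := hz t tz; split => //.
move/eqP: ft; rewrite /f mulf_eq0 invr_eq0 sqrtr_eq0 lern0 -leqn0 leqNgt n0/= => /eqP ->//.
Qed.

End Pathwise.
End Representation.

(** * Random sets of times and their sections *)

Section Tonelli.
Context {R : realType} {d : measure_display} {T : measurableType d}.
Variable P : probability T R.
Local Notation mu := (@lebesgue_measure R).
Local Notation RT := (measurableTypeR R).

Lemma measure0_ae (A : set T) : measurable A -> P A = 0%E -> {ae P, forall w, ~ A w}.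
Proof.
by move=> mA A0; exists A; split => // w /= /contrapT.
Qed.

Lemma prob_sections (E : set (T * RT)) (I : set RT) : measurable E -> measurable I ->
  [/\ measurable_fun setT (fun w => mu ([set t | E (w, t)] `&` I)),
      measurable_fun setT (fun t : RT => P [set w | E (w, t)]) &
      (\int[P]_w mu ([set t | E (w, t)] `&` I) = \int[mu]_(t in I) P [set w | E (w, t)])%E].
Proof.
move=> mE mI.
have mEt w : measurable [set t | E (w, t)].
  by rewrite -[X in measurable X]setTI; exact: (pair1_measurable w).
have mEw (t : RT) : measurable [set w | E (w, t)].
  by rewrite -[X in measurable X]setTI; exact: (pair2_measurable t).
pose f (z : T * RT) : \bar R := (\1_E z * \1_I z.2)%:E.
have mIz : measurable_fun setT (fun z : T * RT => \1_I z.2 : R).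
  by apply: measurableT_comp; [exact: measurable_indic|exact: measurable_snd].
have mf : measurable_fun setT f.
  by apply/measurable_EFinP; apply: measurable_funM => //; exact: measurable_indic.
have f0 z : (0 <= f z)%E by rewrite lee_fin mulr_ge0 ?indicE.
have F w : (\int[mu]_t f (w, t) = mu ([set t | E (w, t)] `&` I))%E.
  transitivity (\int[mu]_t (\1_([set t | E (w, t)] `&` I) t)%:E)%E.
    by apply: eq_integral => t _; rewrite indicI /= /f /= !indicE.
  by rewrite integral_indic ?setIT//; exact: measurableI.
pose g (z : T * RT) : \bar R := (\1_E z)%:E.
have mg : measurable_fun setT g by apply/measurable_EFinP; exact: measurable_indic.
have g0 z : (0 <= g z)%E by rewrite lee_fin indicE.
have G (t : RT) : (\int[P]_w g (w, t) = P [set w | E (w, t)])%E.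
  transitivity (\int[P]_w (\1_[set w | E (w, t)] w)%:E)%E.
    by apply: eq_integral => w _; rewrite /g !indicE.
  by rewrite integral_indic ?setIT//; exact: mEw.
split.
- have := @measurable_fun_fubini_tonelli_F _ _ _ _ _ mu f mf f0.
  by rewrite /fubini_F; congr measurable_fun; apply/funext => w; rewrite F.
- have := @measurable_fun_fubini_tonelli_G _ _ _ _ _ P g mg g0.
  by rewrite /fubini_G; congr measurable_fun; apply/funext => w; rewrite G.
have /= := @fubini_tonelli _ _ _ _ _ P mu f mf f0.
under eq_integral do rewrite F.
move=> ->; rewrite [RHS]integral_mkcond; apply: eq_integral => t _.
rewrite patchE -G; have [tI|tI] := boolP (t \in I).
  by apply: eq_integral => w _; rewrite /f /g [\1_I _]indicE/= tI mulr1.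
by rewrite integral0_eq// => w _; rewrite /f [\1_I _]indicE/= (negbTE tI) mulr0.
Qed.

(** Inversion is continuous away from zero, and what remains is a single point. *)
Lemma measurable_inv : measurable_fun setT (@GRing.inv R).
Proof.
rewrite -(setvU [set (0 : R)]); apply/measurable_funU.
- by apply: measurableC; exact: measurable_set1.
- exact: measurable_set1.
split; last exact: measurable_fun_set1.
apply: open_continuous_measurable_fun; first by apply: closed_openC; exact: closed_eq.
by move=> r; rewrite inE/= => /eqP r0; exact: inv_continuous.
Qed.

End Tonelli.

(** * The limiting density of zeros *)

Section Expectation.
Context {R : realType} {d : measure_display} {T : measurableType d}.
Variable P : probability T R.
Local Notation mu := (@lebesgue_measure R).
Local Notation RT := (measurableTypeR R).
Variables (alpha x : R) (X1 Y1 X2 Y2 : T -> R).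
Hypotheses (sa : sin alpha != 0) (H : iid4 P X1 Y1 X2 Y2).
Let gw := gapw alpha x X1 Y1 X2 Y2.
Let I : set RT := `[0, 2 * pi[%classic.
Let mI : measurable I. Proof. exact: measurable_itv. Qed.

Lemma measurable_gapw : measurable_fun setT (fun z : T * RT => gw z.1 z.2).
Proof.
have [m1 m2 m3 m4 _] := H.
have n1 : measurable_fun setT (fun z : T * RT => X1 z.1) by exact: measurableT_comp m1 measurable_fst.
have n2 : measurable_fun setT (fun z : T * RT => Y1 z.1) by exact: measurableT_comp m2 measurable_fst.
have n3 : measurable_fun setT (fun z : T * RT => X2 z.1) by exact: measurableT_comp m3 measurable_fst.
have n4 : measurable_fun setT (fun z : T * RT => Y2 z.1) by exact: measurableT_comp m4 measurable_fst.
have mt : measurable_fun setT (fun z : T * RT => z.2) by exact: measurable_snd.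
have [mc _] := bm_cos mt; have [ms _] := bm_sin mt.
have k1 := measurable_funD n1 n3; have k2 := measurable_funB n1 n3.
have k3 := measurable_funD n2 n4; have k4 := measurable_funB n2 n4.
have k5 := measurable_funB n4 n2; have k6 := measurable_funB n3 n1.
have mtp (f g h : T * RT -> R) : measurable_fun setT f -> measurable_fun setT g -> measurable_fun setT h ->
    measurable_fun setT (fun z : T * RT => tp (f z, g z, h z) z.2).
  move=> mf mg mh; rewrite /tp/=; apply: measurable_funD; last exact: measurable_funM.
  by apply: measurable_funD => //; exact: measurable_funM.
have mp : measurable_fun setT (fun z : T * RT => tp (pcoef alpha x (X1 z.1) (Y1 z.1) (X2 z.1) (Y2 z.1)) z.2).
  apply: mtp.
  - by apply: measurable_funD; exact: measurable_funM.
  - apply: measurable_funB; last exact: measurable_funM.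
    by apply: measurable_funM => //; exact: measurableT_comp.
  - by apply: measurable_funB; exact: measurable_funM.
have mq : measurable_fun setT (fun z : T * RT => tp (qcoef alpha x (X1 z.1) (Y1 z.1) (X2 z.1) (Y2 z.1)) z.2).
  apply: mtp.
  - by apply: measurable_funD; exact: measurable_funM.
  - by apply: measurable_funB; exact: measurable_funM.
  - by apply: measurable_funD; exact: measurable_funM.
have mw : measurable_fun setT (fun z : T * RT => tp (wcoef alpha (X1 z.1) (Y1 z.1) (X2 z.1) (Y2 z.1)) z.2).
  by apply: mtp => //; apply: measurable_funB; exact: measurable_funM.
apply: measurable_funB; first exact: measurableT_comp.
apply: measurableT_comp.
  by apply: continuous_measurable_fun; exact: sqrt_continuous.
by apply: measurable_funD; exact: measurable_funX.
Qed.

Lemma measurable_gapw_lt : measurable [set z : T * RT | gw z.1 z.2 < 0].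
Proof.
rewrite (_ : [set z | _] = setT `&` (fun z : T * RT => gw z.1 z.2) @^-1` `]-oo, 0%R[%classic); last first.
  by apply/seteqP; split => z; rewrite /= in_itv/=//; case.
by apply: measurable_gapw => //; exact: measurable_itv.
Qed.

Lemma measurable_gapw_eq : measurable [set z : T * RT | gw z.1 z.2 = 0].
Proof.
rewrite (_ : [set z | _] = setT `&` (fun z : T * RT => gw z.1 z.2) @^-1` [set 0]); last first.
  by apply/seteqP; split => z //=; case.
by apply: measurable_gapw => //; exact: measurable_set1.
Qed.

Lemma cos_eq_null : mu ([set t | cos t = cos alpha] `&` I) = 0%E.
Proof.
have mS : measurable ([set t : RT | cos t = cos alpha] `&` I).
  apply: measurableI => //.
  rewrite -[X in measurable X]setTI.
  have [mc _] := @bm_cos _ _ _ (fun t : RT => t) (@measurable_id _ _ _).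
  by apply: (mc measurableT [set cos alpha]); exact: measurable_set1.
apply/eqP; rewrite eq_le measure_ge0 andbT.
apply: (@le_trans _ _ (mu [set acos (cos alpha); 2 * pi - acos (cos alpha)])); last first.
  rewrite measureU_null//; exact: lebesgue_measure_set1.
apply: le_measure; rewrite ?inE//; first by apply: measurableU; exact: measurable_set1.
move=> t [/= ct]; rewrite /I/= in_itv/= => /andP[t0 t2].
by apply: cos_eq_cases => //; exact: ltW.
Qed.

(** For almost every [t] the event [gap = 0] is null; by Tonelli the level set is then null for
    almost every path. *)
Lemma ae_gap_null : {ae P, forall w, mu ([set t | gw w t = 0] `&` I) = 0%E}.
Proof.
have [m1 m2 e] := prob_sections P measurable_gapw_eq mI.
have I0 : (\int[P]_w mu ([set t | gw w t = 0%R] `&` I) = 0)%E.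
  rewrite [LHS]e.
  rewrite (@ae_eq_integral _ _ _ mu I (cst 0%E))//; first by rewrite integral0.
  - exact: (measurable_funS measurableT).
  exists ([set t | cos t = cos alpha] `&` I); split.
  - apply: measurableI => //; rewrite -[X in measurable X]setTI.
    have [mc _] := @bm_cos _ _ _ (fun t : RT => t) (@measurable_id _ _ _).
    by apply: (mc measurableT [set cos alpha]); exact: measurable_set1.
  - exact: cos_eq_null.
  - move=> t /= h; have [It|It] := pselect (I t); last by exfalso; apply: h.
    split=> //; apply: contrapT => /eqP ct; apply: h => _.
    exact: prob_gap_eq0.
have := @ae_eq_integral_abs _ _ _ P setT measurableT _ m1.
rewrite (eq_integral (fun w => mu ([set t | gw w t = 0] `&` I))); last first.
  by move=> w _; rewrite gee0_abs.
move=> [h _]; have := h I0; apply: filterS => w /= /(_ Logic.I) //.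
Qed.

Definition limit_density w := len [set t | gw w t < 0] 0 (2 * pi) / pi.

Lemma limit_densityE w : (limit_density w)%:E = (mu ([set t | (gw w t < 0)%R] `&` I) * (pi^-1)%:E)%E.
Proof.
have mE : measurable [set t | gw w t < 0].
  rewrite -[X in measurable X]setTI.
  exact: (@pair1_measurable _ _ _ _ w measurableT _ measurable_gapw_lt).
by rewrite /limit_density /len EFinM fineK// len_fin.
Qed.

Lemma measurable_limit_density : measurable_fun setT (fun w => (limit_density w)%:E).
Proof.
have [m1 _ _] := prob_sections P measurable_gapw_lt mI.
rewrite (_ : (fun w => _) = fun w => (mu ([set t | (gw w t < 0)%R] `&` I) * (pi^-1)%:E)%E); last first.
  by apply/funext => w; rewrite limit_densityE.
exact: emeasurable_funM.
Qed.

Lemma limit_density_bound w : 0 <= limit_density w <= 2.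
Proof.
have p0 := @pi_gt0 R.
have mE : measurable [set t | gw w t < 0].
  rewrite -[X in measurable X]setTI.
  exact: (@pair1_measurable _ _ _ _ w measurableT _ measurable_gapw_lt).
rewrite -!lee_fin limit_densityE; apply/andP; split.
  by rewrite mule_ge0// lee_fin invr_ge0 ltW.
have : (mu ([set t | (gw w t < 0)%R] `&` I) <= mu I)%E.
  by apply: le_measure; rewrite ?inE//; exact: measurableI.
rewrite lebesgue_measure_itv/= lte_fin mulr_gt0// oppr0 adde0 => h.
apply: (le_trans (lee_wpmul2r _ h)); first by rewrite lee_fin invr_ge0 ltW.
by rewrite -EFinM lee_fin mulfK ?gt_eqF.
Qed.

Lemma integral_limit_density : (\int[P]_w (limit_density w)%:E =
  (pi^-1)%:E * \int[mu]_(t in I) P [set w | (gw w t < 0)%R])%E.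
Proof.
have [m1 _ e] := prob_sections P measurable_gapw_lt mI.
rewrite -[in RHS]e muleC -ge0_integralZr//; last by rewrite lee_fin invr_ge0 ltW// pi_gt0.
by apply: eq_integral => w _; rewrite limit_densityE.
Qed.

End Expectation.

(** * Mean of the limiting density *)

Section LimitValue.
Context {R : realType} {d : measure_display} {T : measurableType d}.
Variable P : probability T R.
Local Notation mu := (@lebesgue_measure R).
Local Notation RT := (measurableTypeR R).
Variables (alpha x : R) (X1 Y1 X2 Y2 : T -> R).
Hypotheses (sa : sin alpha != 0) (H : iid4 P X1 Y1 X2 Y2).
Let I : set RT := `[0, 2 * pi[%classic.
Let J : set RT := `[0, 2 * pi]%classic.
Let mI : measurable I. Proof. exact: measurable_itv. Qed.
Let mJ : measurable J. Proof. exact: measurable_itv. Qed.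
Let h (z : RT * RT) : R := Num.sqrt (1 + `|gfun alpha x z.1 z.2| ^+ 2).

Lemma measurable_ell_integrand : measurable_fun setT h.
Proof.
have mt : measurable_fun setT (fun z : RT * RT => z.1) by exact: measurable_fst.
have mu' : measurable_fun setT (fun z : RT * RT => z.2) by exact: measurable_snd.
have m (f : RT * RT -> R) : measurable_fun setT f -> measurable_fun setT (fun z => sin (f z / 2)).
  by move=> mf; have [] := @bm_sin _ _ _ (fun z => f z / 2) (measurable_funM mf (measurable_cst _)).
have s1 := m _ (measurable_funB mt (measurable_cst alpha)).
have s2 := m _ (measurable_funD mt (measurable_cst alpha)).
have s3 := m _ (measurable_funB mu' (measurable_cst x)).
have s4 := m _ (measurable_funD mu' (measurable_cst x)).
rewrite /h; apply: measurableT_comp.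
  by apply: continuous_measurable_fun; exact: sqrt_continuous.
apply: measurable_funD => //; apply: measurable_funX; apply: measurableT_comp => //.
apply: measurable_funM.
  by apply: measurable_funM => //; exact: measurable_funM.
apply: measurableT_comp; first exact: measurable_inv.
by apply: measurable_funD; apply: measurable_funM; exact: measurable_funX.
Qed.

Let K (t : RT) : \bar R := (\int[mu]_(u in J) (h (t, u))%:E)%E.

Let hJ (z : RT * RT) : \bar R := (h z * \1_J z.2)%:E.

Let mhJ : measurable_fun setT hJ.
Proof.
apply/measurable_EFinP; apply: measurable_funM; first exact: measurable_ell_integrand.
by apply: measurableT_comp; [exact: measurable_indic|exact: measurable_snd].
Qed.

Let hJ0 z : (0 <= hJ z)%E.
Proof. by rewrite lee_fin mulr_ge0 ?sqrtr_ge0 ?indicE. Qed.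

Let KE t : (\int[mu]_u hJ (t, u) = K t)%E.
Proof.
rewrite /K [RHS]integral_mkcond; apply: eq_integral => u _.
by rewrite patchE /hJ indicE/=; case: (u \in J); rewrite ?mulr1 ?mulr0.
Qed.

Let mK : measurable_fun setT K.
Proof.
have := @measurable_fun_fubini_tonelli_F _ _ _ _ _ mu hJ mhJ hJ0.
by rewrite /fubini_F; congr measurable_fun; apply/funext => w; rewrite KE.
Qed.

Let K0 t : (0 <= K t)%E.
Proof. by apply: integral_ge0 => u _; rewrite lee_fin sqrtr_ge0. Qed.

Lemma ell_iterated : ell alpha x = (((4 * pi ^+ 2)^-1)%:E * \int[mu]_(t in I) K t)%E.
Proof.
rewrite /ell; congr (_ * _)%E.
pose f (z : RT * RT) : \bar R := (hJ z * (\1_J z.1)%:E)%E.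
have mf : measurable_fun setT f.
  apply: emeasurable_funM => //; apply/measurable_EFinP.
  by apply: measurableT_comp; [exact: measurable_indic|exact: measurable_fst].
have f0 z : (0 <= f z)%E by rewrite mule_ge0// lee_fin indicE.
transitivity (\int[mu \x mu]_z f z)%E.
  rewrite integral_mkcond; apply: eq_integral => -[t u] _.
  rewrite patchE /f /hJ !indicE in_setX /=.
  by case: (t \in _); case: (u \in _); rewrite /= ?mule1 ?mulr1 ?mulr0 ?mule0.
have mKI : measurable_fun I K by exact: (measurable_funS measurableT).
rewrite (fubini_tonelli1 _ mf)// [RHS](integral_itv_bndo_bndc mKI).
rewrite [RHS]integral_mkcond; apply: eq_integral => t _.
rewrite patchE /fubini_F /f /= indicE; have [tJ|tJ] := boolP (t \in J).
  by rewrite -KE; apply: eq_integral => u _; rewrite mule1.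
by rewrite integral0_eq// => u _; rewrite mule0.
Qed.

(** The excluded times, where [lpar] vanishes and the cone degenerates, number at most two in a
    period. *)
Lemma ae_on_circle (Q : R -> Prop) : (forall t, cos t != cos alpha -> Q t) ->
  {ae mu, forall t, I t -> Q t}.
Proof.
move=> hQ; exists ([set t | cos t = cos alpha] `&` I); split.
- apply: measurableI => //; rewrite -[X in measurable X]setTI.
  have [mc _] := @bm_cos _ _ _ (fun t : RT => t) (@measurable_id _ _ _).
  by apply: (mc measurableT [set cos alpha]); exact: measurable_set1.
- exact: cos_eq_null.
- move=> t /= hn; have [It|It] := pselect (I t); last by exfalso; apply: hn.
  by split=> //; apply: contrapT => /eqP ct; apply: hn => _; exact: hQ.
Qed.

Lemma integral_limit_density_ell : sin x != 0 ->
  (\int[P]_w (limit_density alpha x X1 Y1 X2 Y2 w)%:E = ell alpha x)%E.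
Proof.
move=> sx; rewrite (integral_limit_density alpha x H) ell_iterated.
have p0 := @pi_gt0 R.
have [_ m2 _] := prob_sections P (measurable_gapw_lt alpha x H) mI.
rewrite (@ae_eq_integral _ _ _ mu I (fun t => ((4 * pi)^-1)%:E * K t)%E)//; last 3 first.
- exact: (measurable_funS measurableT) m2.
- by apply: emeasurable_funM => //; exact: (measurable_funS measurableT).
- by apply: ae_on_circle => t ct; exact: prob_gap_lt0.
rewrite ge0_integralZl//; last 2 first.
- exact: (measurable_funS measurableT).
- by rewrite lee_fin invr_ge0 mulr_ge0// ltW.
rewrite muleA -EFinM; congr (_%:E * _)%E.
by move: p0; move: (pi : R) => p p0; field; rewrite gt_eqF.
Qed.

Lemma mu_circle : mu I = (2 * pi)%:E.
Proof. by rewrite lebesgue_measure_itv/= lte_fin mulr_gt0 ?pi_gt0// oppr0 adde0. Qed.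

Lemma integral_circle1 : (\int[mu]_(t in I) 1 = (2 * pi)%:E)%E.
Proof. by rewrite integral_cst//= mul1e; exact: mu_circle. Qed.

Lemma integral_limit_density_sin0 : sin x = 0 ->
  (\int[P]_w (limit_density alpha x X1 Y1 X2 Y2 w)%:E = 2%:E)%E.
Proof.
move=> sx; rewrite (integral_limit_density alpha x H).
under eq_integral do rewrite (prob_gap_lt0_sin0 sa H _ sx).
rewrite integral_circle1 -EFinM; congr EFin.
have := @pi_gt0 R; move: (pi : R) => p p0; field; by rewrite gt_eqF.
Qed.

(** If the integral of [1 - F] over the circle were zero, [F] would equal 1 almost everywhere there,
    against the strict inequality of [prob_gap_lt0_lt1] at almost every time. *)
Lemma integral_limit_density_lt2 : sin x != 0 ->
  (\int[P]_w (limit_density alpha x X1 Y1 X2 Y2 w)%:E < 2%:E)%E.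
Proof.
move=> sx; rewrite (integral_limit_density alpha x H).
have p0 := @pi_gt0 R.
have [_ m2 _] := prob_sections P (measurable_gapw_lt alpha x H) mI.
pose F (t : RT) : \bar R := P [set w | (gapw alpha x X1 Y1 X2 Y2 w t < 0)%R].
have mE (t : RT) : measurable [set w | gapw alpha x X1 Y1 X2 Y2 w t < 0].
  rewrite -[X in measurable X]setTI.
  exact: (@pair2_measurable _ _ _ _ t measurableT _ (measurable_gapw_lt alpha x H)).
have F1 t : (F t <= 1)%E by exact: probability_le1.
have F0 t : (0 <= F t)%E by exact: measure_ge0.
have Ff t : F t \is a fin_num by exact: fin_num_measure.
have mF : measurable_fun I F by exact: (measurable_funS measurableT).
have mG : measurable_fun I (fun t => 1 - F t)%E by apply: emeasurable_funB.
have G0 t : (0 <= 1 - F t)%E.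
  have := F1 t; have := Ff t; case: (F t) => // r _; rewrite -EFinB !lee_fin; lra.
have S : (\int[mu]_(t in I) (1 - F t) + \int[mu]_(t in I) F t = (2 * pi)%:E)%E.
  rewrite -ge0_integralD// -integral_circle1.
  by apply: eq_integral => t _; rewrite subeK.
have G1 : (0 < \int[mu]_(t in I) (1 - F t))%E.
  rewrite lt0e integral_ge0 ?andbT//; apply/negP => /eqP Gz.
  have [h1 _] := @ae_eq_integral_abs _ _ _ mu I mI _ mG.
  have Gz' : (\int[mu]_(t in I) `|1 - F t| = 0)%E.
    by rewrite -[RHS]Gz; apply: eq_integral => t _; rewrite gee0_abs.
  have aeF : {ae mu, forall t, I t -> (1 - F t)%E <> 0%E}.
    apply: ae_on_circle => t ct.
    have := prob_gap_lt0_lt1 sa H sx ct; rewrite -/(F t) -sube_gt0 => h2 h3.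
    by move: h2; rewrite h3 ltxx.
  have : {ae mu, forall t, ~ I t}.
    apply: filterS2 (h1 Gz') aeF => t /= h2 h3 It; exact: h3 It (h2 It).
  move=> [N [mN N0 sub]].
  have : (mu I <= mu N)%E.
    by apply: le_measure; rewrite ?inE// => t It; apply: sub => /= hI; exact: hI It.
  rewrite N0 mu_circle lee_fin leNgt mulr_gt0//.
have fin1 : (\int[mu]_(t in I) F t)%E \is a fin_num.
  rewrite ge0_fin_numE ?integral_ge0//; apply: (@le_lt_trans _ _ (2 * pi)%:E); last exact: ltry.
  by rewrite -S leeDr// integral_ge0.
have fin2 : (\int[mu]_(t in I) (1 - F t))%E \is a fin_num.
  rewrite ge0_fin_numE ?integral_ge0//; apply: (@le_lt_trans _ _ (2 * pi)%:E); last exact: ltry.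
  by rewrite -S leeDl// integral_ge0.
rewrite -/F; move: S G1; rewrite -(fineK fin1) -(fineK fin2).
move: (fine _) (fine _) => u v; rewrite -EFinD lte_fin => -[S] v0.
by rewrite -EFinM lte_fin mulrC ltr_pdivrMr//; lra.
Qed.

End LimitValue.

(** * Expectations *)

Section ExpectedZeros.
Context {R : realType} {d : measure_display} {T : measurableType d}.
Variables (P : probability T R) (alpha : R).
Hypothesis sa : sin alpha != 0.
Variables a b : nat -> {RV P >-> R}.
Hypotheses (gauss_a : gaussian_process P a) (gauss_b : gaussian_process P b).
Hypotheses (centered_a : centered_process P a) (centered_b : centered_process P b).
Hypothesis indep_ab : independent_processes P a b.
Hypothesis cov_a : forall k l : nat, (0 < k)%N -> (0 < l)%N ->
  ('E_P[a k \* a l])%E = (cos ((k%:R - l%:R) * alpha))%:E.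
Hypothesis cov_b : forall k l : nat, (0 < k)%N -> (0 < l)%N ->
  ('E_P[b k \* b l])%E = (cos ((k%:R - l%:R) * alpha))%:E.

Let HX : iid4 P (X1 alpha a b) (Y1 alpha a b) (X2 alpha a b) (Y2 alpha a b).
Proof. exact: iid4_rotated. Qed.

Definition zero_count n w : \bar R := num_zeros (trig_poly a b n w) 0 (2 * pi).

Lemma continuous_trig_poly n w : continuous (trig_poly a b n w).
Proof.
move=> t; rewrite /trig_poly; apply: cvgM; first exact: cvg_cst.
elim: n => [|n IH]; first by under eq_fun do rewrite big_nil; rewrite big_nil; exact: cvg_cst.
under eq_fun do rewrite big_nat_recr//=.
rewrite big_nat_recr//=; apply: cvgD; first exact: IH.
have cl : (fun x : R => n.+1%:R * x) x @[x --> t] --> n.+1%:R * t.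
  by apply: cvgM; [exact: cvg_cst|exact: cvg_id].
apply: cvgD; apply: cvgM; try exact: cvg_cst.
  exact: (continuous_comp cl (@continuous_cos _ _)).
exact: (continuous_comp cl (@continuous_sin _ _)).
Qed.

Lemma measurable_zero_count n : measurable_fun setT (zero_count n).
Proof.
apply: (@measurable_num_zeros _ _ _ (fun w => trig_poly a b n w)) => [t|w].
  rewrite /trig_poly; apply: measurable_funM => //.
  by apply: measurable_sum => k; apply: measurable_funD; apply: measurable_funM.
exact: continuous_trig_poly.
Qed.

Lemma zero_count_ge0 n w : (0 <= zero_count n w)%E.
Proof. by rewrite /zero_count /num_zeros /counting; case: ifP => _; rewrite ?leey// lee_fin. Qed.

(** [a 1] is almost surely the first coordinate of the pair turned by [alpha], hence standard
    normal; the bound on the number of roots relies on it. *)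
Lemma ae_first_coef_neq0 : {ae P, forall w, a 1%N w <> 0}.
Proof.
have H0 : iid4 P (ccoord alpha a) (scoord alpha a) (ccoord alpha b) (scoord alpha b).
  exact: iid4_coord.
have [m1 m2 m3 m4 _] := H0.
have H1 : iid4 P (fun w => cos alpha * ccoord alpha a w + sin alpha * scoord alpha a w)
   (fun w => cos alpha * scoord alpha a w - sin alpha * ccoord alpha a w) (ccoord alpha b) (scoord alpha b).
  apply: (iid4_transform H0) => //.
  - by apply: measurable_funD; exact: measurable_funM.
  - by apply: measurable_funB; exact: measurable_funM.
  move=> x y z v; exists (cos alpha * x - sin alpha * y), (sin alpha * x + cos alpha * y), z, v; split.
    transitivity ((x ^+ 2 + y ^+ 2) * (cos alpha ^+ 2 + sin alpha ^+ 2) + z ^+ 2 + v ^+ 2); first by ring.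
    by rewrite cos2Dsin2 mulr1.
  by move=> w; ring.
have [n1 _ _ _ _] := H1.
have h1 : {ae P, forall w, cos alpha * ccoord alpha a w + sin alpha * scoord alpha a w <> 0}.
  apply: measure0_ae; last exact: (iid4_eq0_null H1).
  rewrite -[X in measurable X]setTI.
  by apply: (n1 measurableT [set 0]); exact: measurable_set1.
have h2 := process_repr sa cov_a.
apply: filterS2 h1 h2 => w /= h1 h2; rewrite h2//.
by move=> h; apply: h1; rewrite -h mul1r; ring.
Qed.

Lemma ae_cdet_neq0 x : {ae P, forall w,
  cdet alpha x (X1 alpha a b w) (Y1 alpha a b w) (X2 alpha a b w) (Y2 alpha a b w) <> 0}.
Proof.
have [m1 m2 m3 m4 _] := HX.
apply: measure0_ae; last exact: (cdet_null alpha x HX).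
have m : measurable_fun setT (fun w => cdet alpha x (X1 alpha a b w) (Y1 alpha a b w) (X2 alpha a b w) (Y2 alpha a b w)).
  apply: measurable_funB; apply: measurable_funM => //.
    by apply: measurable_funB; exact: measurable_funM.
  by apply: measurable_funD; exact: measurable_funM.
rewrite -[X in measurable X]setTI.
by apply: (m measurableT [set 0]); exact: measurable_set1.
Qed.

Section OneClass.
Variable x : R.
Let L w := limit_density alpha x (X1 alpha a b) (Y1 alpha a b) (X2 alpha a b) (Y2 alpha a b) w.
Let C n := (0 < n)%N && `[< in_piZ (n%:R * alpha - x) >].
(** Outside the class the sequence is set equal to its limit, so that dominated convergence applies
    along all [n] at once. *)
Let g n w : \bar R := if C n then (zero_count n w * (n%:R^-1)%:E)%E else (L w)%:E.

Lemma ae_class_cvg : {ae P, forall w, g n w @[n --> \oo] --> (L w)%:E}.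
Proof.
have r1 := process_repr sa cov_a; have r2 := process_repr sa cov_b.
have dt := ae_cdet_neq0 x; have gn := ae_gap_null x sa HX.
apply: filterS2 (filterI r1 r2) (filterI dt gn) => w /= [ra rb] [dw gw].
have c0 : (Num.sqrt 2 : R) != 0 by rewrite gt_eqF// sqrtr_gt0.
have pw := @num_zeros_pathwise R alpha x (fun k => a k w) (fun k => b k w)
  (ccoord alpha a w) (scoord alpha a w) (ccoord alpha b w) (scoord alpha b w) (Num.sqrt 2)
  (X1 alpha a b w) (Y1 alpha a b w) (X2 alpha a b w) (Y2 alpha a b w) sa ra rb c0.
have {}pw : forall e : R, 0 < e -> exists N : nat, forall n, (N <= n)%N ->
    in_piZ (n%:R * alpha - x) ->
    ((n%:R * (L w - e) - 2)%:E <= zero_count n w)%E /\ (zero_count n w <= (n%:R * (L w + e))%:E)%E.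
  move=> e e0; apply: pw => //; try by rewrite /X1 /Y1 /X2 /Y2 mulrC divfK.
  exact/eqP.
have near e : 0 < e -> exists N : nat, forall n, (N <= n)%N ->
    exists2 r : R, g n w = r%:E & `|L w - r| <= e.
  move=> e0; have e2 : 0 < e / 2 by rewrite divr_gt0.
  have [N hN] := pw _ e2.
  (* Beyond [4 / e], the two zeros lost in the lower bound amount to at most [e / 2] after division
     by [n]. *)
  exists (maxn N (Num.trunc (4 / e)).+1) => n; rewrite geq_max => /andP[Nn en].
  rewrite /g; have [/andP[n0 /asboolP Cn]|_] := boolP (C n); last first.
    by exists (L w) => //; rewrite subrr normr0 ltW.
  have [lo up] := hN n Nn Cn.
  have [z zE] : exists z : R, zero_count n w = z%:E.
    move: lo up; case: (zero_count n w) => [z| |]; first by exists z.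
      by rewrite leye_eq.
    by rewrite leeNy_eq.
  rewrite zE !lee_fin in lo up; exists (z * n%:R^-1); first by rewrite zE -EFinM.
  have np : 0 < n%:R :> R by rewrite ltr0n.
  have n4 : 4 / e < n%:R.
    by rewrite (lt_le_trans (truncnS_gt _))// ler_nat.
  rewrite ler_distlC; apply/andP; split.
    rewrite ler_pdivlMr// (le_trans _ lo)//.
    move: n4; rewrite ltr_pdivrMr// => n4; move: np n4; move: (n%:R) => m m0 n4; lra.
  rewrite ler_pdivrMr// (le_trans up)//; move: np; move: (n%:R) => m m0.
  by rewrite mulrC ler_pM2r//; lra.
apply/fine_cvgP; split.
  have [N hN] := near 1 ltr01; exists N => // n /= /hN[r -> _] //.
apply/cvgrPdist_le => e e0; have [N hN] := near e e0.
by exists N => // n /= /hN[r rE]; rewrite /= rE.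
Qed.

Lemma class_integral_cvg :
  (if C n then (expected_zeros P a b n / n%:R%:E)%E else (\int[P]_w (L w)%:E)%E) @[n --> \oo]
    --> (\int[P]_w (L w)%:E)%E.
Proof.
have mg n : measurable_fun setT (g n).
  rewrite /g; case: (C n); last exact: (measurable_limit_density alpha x HX).
  by apply: emeasurable_funM => //; exact: measurable_zero_count.
(* The constant 3 dominates [(2 n + 1) / n] for [n >= 1], and also the limit, which is at most 2. *)
have i3 : P.-integrable setT (cst 3%:E).
  exact: (bounded_integrable P (bm_cst 3)).
have cv : {ae P, forall w, setT w -> g n w @[n --> \oo] --> (L w)%:E}.
  by apply: filterS ae_class_cvg => w.
have dom : {ae P, forall w n, setT w -> (`|g n w| <= 3%:E)%E}.
  apply: filterS ae_first_coef_neq0 => w a1 n _; rewrite /g.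
  have [L0 L2] := andP (limit_density_bound alpha x HX w).
  have [/andP[n0 _]|_] := boolP (C n); last by rewrite abse_EFin lee_fin ger0_norm// (le_trans L2)// ler_nat.
  have np : 0 < n%:R :> R by rewrite ltr0n.
  rewrite gee0_abs; last by rewrite mule_ge0 ?zero_count_ge0// lee_fin invr_ge0 ltW.
  rewrite lee_pdivrMr//.
  have /eqP a1' := a1.
  apply: (le_trans (num_zeros_ub (fun k => b k w) n0 a1')).
  rewrite -EFinM lee_fin; move: (n0); rewrite -(ler_nat R) => n1; lra.
have [_ _] := @dominated_convergence _ _ _ P setT measurableT g (fun w => (L w)%:E) (cst 3%:E) mg
  (measurable_limit_density alpha x HX) cv i3 dom.
have -> // : (fun n => if C n then (expected_zeros P a b n / n%:R%:E)%E else (\int[P]_w (L w)%:E)%E) =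
   (fun n => \int[P]_w g n w)%E.
apply/funext => n; rewrite /g; have [/andP[n0 _]|] := boolP (C n) => //.
rewrite ge0_integralZr//.
- by rewrite inver pnatr_eq0 gtn_eqF.
- exact: measurable_zero_count.
Qed.

Lemma integral_limit_density_fin : (\int[P]_w (L w)%:E)%E \is a fin_num.
Proof.
apply: integrable_fin_num => //; apply: (le_integrable _ _ _ (bounded_integrable P (bm_cst 2))) => //.
  exact: (measurable_limit_density alpha x HX).
move=> w _; have [L0 L2] := andP (limit_density_bound alpha x HX w).
by rewrite !abse_EFin lee_fin ger0_norm// ger0_norm.
Qed.

Lemma class_indic_cvg :
  (`|expected_zeros P a b n / n%:R%:E - \int[P]_w (L w)%:E|
     * (\1_[set m : nat | in_piZ (m%:R * alpha - x)] n)%:E)%E @[n --> \oo] --> 0%E.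
Proof.
have /cvge_sub0 := class_integral_cvg; move=> /(_ integral_limit_density_fin)/cvg_abse; rewrite abse0.
move=> h; apply: cvg_trans h; apply: near_eq_cvg; near=> n.
have n0 : (0 < n)%N by near: n; exists 1%N.
rewrite /C n0 /= indicE; case: ifPn => [/asboolP Cn|/asboolP Cn].
  by rewrite mem_set// mule1.
by rewrite memNset// mule0 subee ?abse0// integral_limit_density_fin.
Unshelve. all: by end_near. Qed.

(** The condition [k < phi k] provides both the divergence of [phi] and the positivity of its
    values. *)
Lemma class_subseq_cvg (phi : nat -> nat) :
  (forall k, k < phi k)%N -> (forall k, in_piZ ((phi k)%:R * alpha - x)) ->
  (expected_zeros P a b (phi k) / (phi k)%:R%:E)%E @[k --> \oo] --> (\int[P]_w (L w)%:E)%E.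
Proof.
move=> phik Cphi.
have phioo : phi k @[k --> \oo] --> \oo.
  move=> A [N _ NA]; exists N => // k /= Nk; apply: NA => /=.
  exact: leq_trans Nk (ltnW (phik k)).
have := cvg_comp _ _ phioo class_integral_cvg.
apply: cvg_trans; apply: near_eq_cvg; near=> k => /=.
rewrite /C ifT//; apply/andP; split; first exact: leq_ltn_trans (phik k).
exact/asboolP/Cphi.
Unshelve. all: by end_near. Qed.

End OneClass.
End ExpectedZeros.

(** * Residues modulo pi *)

Section ModPi.
Context {R : realType}.
Implicit Types (x y alpha : R) (q : rat).

Lemma modpi_itv y : 0 <= modpi y < pi.
Proof.
have p0 := pi_gt0 R.
have /andP[h1 h2] := floor_itv (y / pi).
rewrite /modpi subr_ge0 mulrC -ler_pdivlMr// h1/= ltrBlDr.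
by move: h2; rewrite ltr_pdivrMr// intrD mulrDl mul1r addrC.
Qed.

Lemma modpiD y (m : int) : modpi (y + pi * m%:~R) = modpi y.
Proof.
have p0 : pi != 0 :> R by rewrite gt_eqF// pi_gt0.
rewrite /modpi (mulrDl y) (mulrC pi m%:~R) mulfK//.
by rewrite floorDrz ?intr_int// intrKfloor intrD; ring.
Qed.

Lemma in_piZ_modpi y : in_piZ (y - modpi y).
Proof. by exists (Num.floor (y / pi)); rewrite /modpi; ring. Qed.

Lemma modpi_eq y x : in_piZ (y - x) -> modpi y = modpi x.
Proof. by case=> m h; rewrite -(modpiD x m) -h addrCA subrr addr0. Qed.

Lemma modpi_eq0 y : modpi y = 0 <-> in_piZ y.
Proof.
split=> [h|h]; first by have := in_piZ_modpi y; rewrite h subr0.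
by rewrite (@modpi_eq y 0) ?subr0// /modpi mul0r floor0 mulr0 subr0.
Qed.

Lemma in_piZ_mulrn n y : in_piZ y -> in_piZ (n%:R * y).
Proof. by move=> [m ->]; exists (n%:Z * m); rewrite intrM; ring. Qed.

Lemma denq_mul_piQ q : `|denq q|%:R * (pi * ratr q) = pi * (numq q)%:~R :> R.
Proof.
rewrite /ratr mulrCA; congr (_ * _).
have -> : `|denq q|%:R = (denq q)%:~R :> R by rewrite -[in RHS]absz_denq.
by rewrite mulrC divfK// intr_eq0 denq_neq0.
Qed.

Lemma values_modpi_sub_itv alpha : values_modpi alpha `<=` `[0, pi[%classic.
Proof. by move=> _ [n _ <-]; rewrite /= in_itv/= modpi_itv. Qed.

(** The denominator of [q] times the angle is a multiple of [pi], so the class of [n] times the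
    angle depends only on [n] modulo that denominator. *)
Lemma finite_values_modpi q : finite_set (values_modpi (pi * ratr q : R)).
Proof.
have D0 : (0 < `|denq q|)%N by rewrite absz_gt0 denq_neq0.
apply: (@sub_finite_set _ _ ((fun n => modpi (n%:R * (pi * ratr q))) @` `I_(`|denq q|%N))).
  move=> _ [n _ <-]; exists (n %% `|denq q|)%N; first by rewrite /= ltn_mod.
  apply/esym/modpi_eq; exists ((n %/ `|denq q|)%N%:Z * numq q).
  rewrite {1}(divn_eq n `|denq q|) natrD natrM intrM mulrDl addrK -mulrA denq_mul_piQ.
  by ring.
exact/finite_image/finite_II.
Qed.

Lemma values_modpi_neq0 alpha x : (values_modpi alpha `\ 0) x -> sin x != 0.
Proof.
move=> [/values_modpi_sub_itv]; rewrite /= in_itv/= => /andP[x0 xpi] /eqP xn0.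
by rewrite gt_eqF// sin_gt0_pi// lt_neqAle eq_sym xn0 x0.
Qed.

Lemma values_modpi_notin_piZ alpha : values_modpi alpha `\ 0 !=set0 <-> ~ in_piZ alpha.
Proof.
split=> [[x [[n _ <-] n0]] /(in_piZ_mulrn n)/modpi_eq0//|h].
exists (modpi alpha); split; last by move=> /modpi_eq0.
by exists 1%N; rewrite //= mul1r.
Qed.

Lemma sin_neq0_notin_piZ alpha : ~ in_piZ alpha -> sin alpha != 0.
Proof.
move=> h.
have : sin (modpi alpha) != 0.
  apply: (@values_modpi_neq0 alpha); split; last by move=> /modpi_eq0.
  by exists 1%N; rewrite //= mul1r.
have [e e1 [_ ->]] := in_piZ_sign (in_piZ_modpi alpha).
by case: e1 => ->; rewrite ?mul1r// mulN1r oppr_eq0.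
Qed.

End ModPi.

Theorem corollary1p1 (R : realType) (d : measure_display)
    (T : measurableType d) (P : probability T R)
    (alpha : R) (alpha_ge0 : 0 <= alpha)
    (alpha_piQ : exists q : rat, alpha = pi * ratr q)
    (a b : nat -> {RV P >-> R})
    (gauss_a : gaussian_process P a) (gauss_b : gaussian_process P b)
    (centered_a : centered_process P a) (centered_b : centered_process P b)
    (stat_a : stationary_process P a) (stat_b : stationary_process P b)
    (indep_ab : independent_processes P a b)
    (cov_a : forall k l : nat, (0 < k)%N -> (0 < l)%N ->
       ('E_P[a k \* a l])%E = (cos ((k%:R - l%:R) * alpha))%:E)
    (cov_b : forall k l : nat, (0 < k)%N -> (0 < l)%N ->
       ('E_P[b k \* b l])%E = (cos ((k%:R - l%:R) * alpha))%:E)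
    (cov_ab : forall k l : nat, (0 < k)%N -> (0 < l)%N ->
       ('E_P[a k \* b l])%E = 0%E) :
  let S := values_modpi alpha in
  [/\ finite_set S /\ S `<=` `[0, pi[%classic,
      forall x : R, x \in S `\ 0 ->
        (`|expected_zeros P a b n / n%:R%:E - ell alpha x|
           * (\1_[set m : nat | in_piZ (m%:R * alpha - x)] n)%:E)%E
          @[n --> \oo] --> 0%E,
      S `\ 0 !=set0 <-> ~ in_piZ alpha &
      S `\ 0 !=set0 ->
        ~ cvgn (fun n : nat => (expected_zeros P a b n / n%:R%:E)%E)].

Proof.
move=> S.
have [q alphaE] := alpha_piQ.
have sin_neq0 : S `\ 0 !=set0 -> sin alpha != 0.
  by move=> /values_modpi_notin_piZ/sin_neq0_notin_piZ.
split; first by rewrite {1}/S alphaE; split;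
  [exact: finite_values_modpi | exact: values_modpi_sub_itv].
- move=> x /set_mem xS; have sx := values_modpi_neq0 xS.
  have sa : sin alpha != 0 by apply: sin_neq0; exists x.
  have HX := iid4_rotated sa gauss_a gauss_b centered_a centered_b indep_ab cov_a cov_b.
  rewrite -(integral_limit_density_ell sa HX sx).
  exact: class_indic_cvg.
- exact: values_modpi_notin_piZ.
move=> S0 cvgu; have sa := sin_neq0 S0.
have HX := iid4_rotated sa gauss_a gauss_b centered_a centered_b indep_ab cov_a cov_b.
have sx : sin (modpi alpha) != 0.
  apply: (@values_modpi_neq0 _ alpha); split; first by exists 1%N; rewrite //= mul1r.
  by move=> /modpi_eq0; apply/values_modpi_notin_piZ.
(* Multiples of [D] lie in the class of 0 and their successors in that of [alpha]; a limit of the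
   whole sequence would be shared by these two subsequences. *)
pose D := `|denq q|%N.
have D0 : (0 < D)%N by rewrite absz_gt0 denq_neq0.
have piZ_D k : (k * D)%:R * alpha = pi * (k%:Z * numq q)%:~R.
  by rewrite natrM -mulrA alphaE denq_mul_piQ intrM; ring.
have lim_eq x phi : (forall k, k < phi k)%N -> (forall k, in_piZ ((phi k)%:R * alpha - x)) ->
    limn (fun n : nat => (expected_zeros P a b n / n%:R%:E)%E) =
    (\int[P]_w (limit_density alpha x (X1 alpha a b) (Y1 alpha a b)
                  (X2 alpha a b) (Y2 alpha a b) w)%:E)%E.
  move=> phik Cphi; apply: cvg_unique (class_subseq_cvg sa gauss_a gauss_b centered_a
    centered_b indep_ab cov_a cov_b phik Cphi) => //.
  have phioo : phi k @[k --> \oo] --> \oo.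
    move=> A [N _ NA]; exists N => // k /= Nk; apply: NA => /=.
    exact: leq_trans Nk (ltnW (phik k)).
  exact: (cvg_comp _ _ phioo cvgu).
have : (2%:E < 2%:E :> \bar R)%E; last by rewrite ltxx.
rewrite -[X in (X < _)%E](integral_limit_density_sin0 sa HX (sin0 R)).
rewrite -(@lim_eq 0 (fun k => k.+1 * D)%N) => [|k|k]; last 2 first.
- exact: leq_pmulr.
- by rewrite subr0 piZ_D; exists (k.+1%:Z * numq q).
rewrite (@lim_eq (modpi alpha) (fun k => (k * D).+1)) => [|k|k].
- exact: (integral_limit_density_lt2 sa HX sx).
- by rewrite ltnS leq_pmulr.
rewrite -natr1 mulrDl mul1r piZ_D -addrA.
have [m ->] := in_piZ_modpi alpha; exists (k%:Z * numq q + m).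
by rewrite intrD mulrDr.
Qed.
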